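(* Let $\underline M$ be a pure Anderson motive of rank $r$ over the finite field $\mathbb F_s$ with Frobenius endomorphism $\pi$, let $\varepsilon\ne v\in\mathrm{Spec}\,A$ be a maximal ideal and $0\le i\le r$. Then in an algebraic closure of $Q_\infty$ all eigenvalues of $\wedge^i\pi_v\in\mathrm{End}_{Q_v}(\wedge^iV_v\underline M)$ have the same absolute value $(\#\mathbb F_s)^{i\,\mathrm{wt}(\underline M)}$.
   Context: Setting. $C$ is a smooth projective geometrically irreducible curve over the finite field $\mathbb F_q$, $\infty\in C(\mathbb F_q)$ a fixed point, $A=\Gamma(C\setminus\{\infty\},\mathcal O_C)$, $Q=\mathrm{Quot}(A)$, $Q_\infty$ the completion of $Q$ at $\infty$, with absolute value $|a|_\infty=q^{-\mathrm{ord}_\infty(a)}$ extended to an algebraic closure. For a maximal ideal $v$ of $A$, $A_v$ is the completion of $A$ at $v$, $Q_v=\mathrm{Quot}(A_v)$. For a field $L\supset\mathbb F_q$: $C_L=C\times_{\mathbb F_q}L$, $A_L=A\otimes_{\mathbb F_q}L$, $\sigma^*$ the endomorphism $a\otimes b\mapsto a\otimes b^q$ of $A_L$ (also the corresponding pullback on $C_L$), $\sigma^*M=M\otimes_{A_L,\sigma^*}A_L$, $A_{v,L}=A_v\widehat\otimes_{\mathbb F_q}L=\varprojlim_n(A/v^n\otimes_{\mathbb F_q}L)$. Pure Anderson motives. Fix an $\mathbb F_q$-homomorphism $c^*:A\to L$, let $\varepsilon=\ker c^*\in\mathrm{Spec}\,A$ and $J=(a\otimes1-1\otimes c^*(a):a\in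 A)\subset A_L$. A pure Anderson motive $\underline M=(M,\tau)$ of rank $r$, dimension $d$ and characteristic $c^*$ over $L$ is a locally free $A_L$-module $M$ of rank $r$ with an injective $A_L$-homomorphism $\tau:\sigma^*M\to M$ such that $\mathrm{coker}\,\tau$ has $L$-dimension $d$ and is annihilated by $J^d$, and $M$ extends to a locally free sheaf $\mathcal M$ of rank $r$ on $C_L$ such that for some integers $k,l>0$ the map $\tau^l=\tau\circ\sigma^*\tau\circ\cdots\circ(\sigma^* )^{l-1}\tau$ induces an isomorphism of stalks $(\sigma^* )^l\mathcal M_\infty\to\mathcal M(k\cdot\infty)_\infty$. The weight is $\mathrm{wt}(\underline M)=k/l=d/r$. Tate module and Frobenius. For a maximal ideal $v\ne\varepsilon$, $T_v\underline M=\{x\in M\otimes_{A_L}A_{v,L^{\mathrm{sep}}}:\tau(\sigma^*x)=x\}$, free of rank $r$ over $A_v$, and $V_v\underline M=T_v\underline M\otimes_{A_v}Q_v$. If $L=\mathbb F_s$, $s=q^e$, then $(\sigma^* )^eM=M$ and $\pi=\tau\circ\sigma^*\tau\circ\cdots\circ(\sigma^* )^{e-1}\tau\in\mathrm{End}(\underline M)$ is the Frobenius; $\pi_v$ is the induced endomorphism of $V_v\underline M$. The characteristic polynomial of $\wedge^i\pi_v$ has coefficients in $Q$, so that its roots (the eigenvalues) may be considered in an algebraic closure of $Q_\infty$. *)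

(* Defs.v *)
From HB Require Import structures.
From mathcomp Require Import all_boot all_order all_algebra all_field.
From mathcomp Require Import all_classical all_reals exp.

Set Implicit Arguments.
Unset Strict Implicit.
Unset Printing Implicit Defensive.

Import Order.TTheory GRing.Theory Num.Theory.
Local Open Scope classical_set_scope.
Local Open Scope ring_scope.

(** * Curves

  Following Hartshorne I.6, the smooth projective curve is the "abstract
  nonsingular curve" of its function field: its closed points are the discrete
  valuations trivial on the constants, the stalk at a point is the
  valuation ring, and a function is regular on an open set iff it lies in all
  the stalks at the points of that set. *)

(* [ord 0] is meant to be +oo; the value 0 is a placeholder, under which the
   conditions [0 <= ord x] and [- k <= ord x] used below hold at [x = 0]. *)
Record place (k K : fieldType) (i : {rmorphism k -> K}) := Place {
  ord :> K -> int;
  ord0 : ord 0 = 0;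
  ordM : forall x y, x != 0 -> y != 0 -> ord (x * y) = ord x + ord y;
  ordD : forall x y, x != 0 -> y != 0 -> x + y != 0 ->
    Num.min (ord x) (ord y) <= ord (x + y);
  ord_const : forall c, ord (i c) = 0;
  ord_uniformizer : exists x, ord x = 1 }.

(* The residue field of the place is the field of constants. *)
Definition rational_place (k K : fieldType) (i : {rmorphism k -> K})
    (P : place i) : Prop :=
  forall x, 0 <= P x -> exists c, x = i c \/ 0 < P (x - i c).

(* The last axiom is geometric irreducibility: the constant field is perfect,
   and it is algebraically closed in the function field. *)
Record curve (F : finFieldType) := Curve {
  funField :> fieldType;
  const : {rmorphism F -> funField};
  funField_trdeg1 : exists t : funField,
    (forall p : {poly F}, root (map_poly const p) t -> p = 0) /\
    exists n (b : 'I_n -> funField), forall x,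
      exists (p : {poly F}) (s : 'I_n -> {poly F}),
        p != 0 /\ (map_poly const p).[t] * x =
                  \sum_j (map_poly const (s j)).[t] * b j;
  funField_const : forall x : funField,
    (exists2 p : {poly F}, p != 0 & root (map_poly const p) x) ->
    exists c, x = const c }.

Definition regular_away (F : finFieldType) (C : curve F)
    (oo : place (const C)) (x : C) : Prop :=
  forall P : place (const C), (exists y, P y <> oo y) -> 0 <= P x.

(* The ring A of functions on C regular outside oo. *)
Record coordRing (F : finFieldType) (C : curve F) (oo : place (const C)) :=
  CoordRing {
  coord_ring :> comNzRingType;
  coord_const : {rmorphism F -> coord_ring};
  coord_fun : {rmorphism coord_ring -> C};
  coord_fun_const : forall c, coord_fun (coord_const c) = const C c;
  coord_fun_inj : injective coord_fun;
  coord_funP : forall x, regular_away oo x <-> exists a, coord_fun a = x }.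
Arguments coord_fun {F C oo} _.

(** * Ideals and adic completions *)

Definition is_ideal (R : comNzRingType) (I : set R) : Prop :=
  [/\ I 0, forall x y, I x -> I y -> I (x + y) & forall a x, I x -> I (a * x)].

Definition maximal_ideal (R : comNzRingType) (I : set R) : Prop :=
  [/\ is_ideal I, ~ I 1 &
    forall J : set R, is_ideal J -> ~ J 1 -> I `<=` J -> J = I].

Definition ideal_gen (R : comNzRingType) (X : set R) : set R :=
  [set y | exists n (a x : 'I_n -> R),
    (forall j, X (x j)) /\ y = \sum_j a j * x j].

Definition ideal_exp (R : comNzRingType) (I : set R) (n : nat) : set R :=
  ideal_gen [set y | exists x : 'I_n -> R,
    (forall j, I (x j)) /\ y = \prod_j x j].

Definition ideal_ext (R S : comNzRingType) (f : {rmorphism R -> S})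
    (I : set R) : set S := ideal_gen (f @` I).

(* S is the inverse limit of the R / I^n: the kernels K n of the projections
   S -> R / I^n identify S / K n with R / I^n, and every coherent sequence of
   residue classes comes from exactly one element of S. *)
Definition is_adic_completion (R S : comNzRingType) (I : set R)
    (f : {rmorphism R -> S}) : Prop :=
  exists K : nat -> set S,
  [/\ forall n, is_ideal (K n) /\ K n.+1 `<=` K n,
      forall n a, K n (f a) <-> ideal_exp I n a,
      forall n x, exists a, K n (x - f a) &
      forall a : nat -> R, (forall n, ideal_exp I n (a n.+1 - a n)) ->
        exists! x, forall n, K n (x - f (a n))].

(** * Tensor products *)

(* [N = M (x)_R S], with [j m = m (x) 1]; a linear map for the scaling
   [f \; *:%R] is an f-semilinear map. *)
Definition is_base_change (R S : comNzRingType) (f : {rmorphism R -> S})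
    (M : lmodType R) (N : lmodType S) (j : {linear M -> N | f \; *:%R}) : Prop :=
  forall (P : lmodType S) (g : {linear M -> P | f \; *:%R}),
  exists h : {linear N -> P},
    (forall m, h (j m) = g m) /\
    forall h' : {linear N -> P}, (forall m, h' (j m) = g m) -> h' =1 h.

(* [T = A (x)_F L], with [iA a = a (x) 1] and [iL b = 1 (x) b]. *)
Definition is_tensor (F A L T : comNzRingType)
    (fA : {rmorphism F -> A}) (fL : {rmorphism F -> L})
    (iA : {rmorphism A -> T}) (iL : {rmorphism L -> T}) : Prop :=
  (forall c, iA (fA c) = iL (fL c)) /\
  forall (P : lmodType F) (beta : A -> L -> P),
    (forall c a a' b, beta (fA c * a + a') b = c *: beta a b + beta a' b) ->
    (forall c a b b', beta a (fL c * b + b') = c *: beta a b + beta a b') ->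
    let lifts (h : T -> P) :=
      (forall c x y, h (iA (fA c) * x + y) = c *: h x + h y) /\
      (forall a b, h (iA a * iL b) = beta a b) in
    exists h, lifts h /\ forall h', lifts h' -> h' =1 h.

(* The ring A_L with its endomorphism sigma^*. It is a domain because C is
   geometrically irreducible, and its fraction field is the function field of
   the curve C_L. *)
Record scalarExt (F : finFieldType) (A : comNzRingType) (L : fieldType)
    (fA : {rmorphism F -> A}) (fL : {rmorphism F -> L}) := ScalarExt {
  ext_ring :> idomainType;
  extl : {rmorphism A -> ext_ring};
  extr : {rmorphism L -> ext_ring};
  ext_tensor : is_tensor fA fL extl extr;
  sigma : {rmorphism ext_ring -> ext_ring};
  sigma_extl : forall a, sigma (extl a) = extl a;
  sigma_extr : forall b, sigma (extr b) = extr (b ^+ #|F|) }.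

(* The embedding of L in the function field of C_L. *)
Definition const_ext (F : finFieldType) (A : comNzRingType) (L : fieldType)
    (fA : {rmorphism F -> A}) (fL : {rmorphism F -> L})
    (AL : scalarExt fA fL) : {rmorphism L -> {fraction AL}} :=
  (@tofrac AL \o @extr _ _ _ _ _ AL).

(* The point of C_L above oo; it is unique since oo is rational. *)
Record placeAbove (F : finFieldType) (C : curve F) (oo : place (const C))
    (A : coordRing oo) (L : fieldType) (fL : {rmorphism F -> L})
    (AL : scalarExt (coord_const A) fL) := PlaceAbove {
  place_above :> place (const_ext AL);
  place_aboveP : forall a : A,
    place_above (tofrac (extl AL a)) = oo (coord_fun A a) }.

(** * Pure Anderson motives *)

Definition is_basis (K : comNzRingType) (V : lmodType K) (n : nat)
    (b : 'I_n -> V) : Prop :=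
  forall x, exists! c : {ffun 'I_n -> K}, x = \sum_j c j *: b j.

(* M is free of rank r over each D(f j) of an open cover of Spec R. A basis of
   M_f can be scaled to consist of images of elements e of M; the last two
   conditions say that these images generate M_f and are independent. *)
Definition locally_free (R : comNzRingType) (r : nat) (M : lmodType R) : Prop :=
  exists n (f g : 'I_n -> R), \sum_j g j * f j = 1 /\
  forall j, exists e : 'I_r -> M,
    (forall m, exists N (c : 'I_r -> R), f j ^+ N *: m = \sum_i c i *: e i) /\
    (forall c : 'I_r -> R, \sum_i c i *: e i = 0 ->
       exists N, forall i, f j ^+ N * c i = 0).

Section Motives.
Context (F : finFieldType) (C : curve F) (oo : place (const C)).
Context (A : coordRing oo) (L : fieldType) (fL : {rmorphism F -> L}).
Context (AL : scalarExt (coord_const A) fL).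

Definition char_ideal (c : {rmorphism A -> L}) : set AL :=
  ideal_gen [set x | exists a : A, x = extl AL a - extr AL (c a)].

(* The module M with tau : sigma^* M -> M; [mot_pull m] is sigma^* m = m (x) 1. *)
Record preMotive := PreMotive {
  mot_mod :> lmodType AL;
  mot_sigma : lmodType AL;
  mot_pull : {linear mot_mod -> mot_sigma | sigma AL \; *:%R};
  mot_pullP : is_base_change mot_pull;
  mot_tau : {linear mot_sigma -> mot_mod} }.

(* The sigma-semilinear map x |-> tau (sigma^* x). *)
Definition stau (M : preMotive) (m : M) : M := mot_tau M (mot_pull M m).

Definition coker_dim (M : preMotive) (d : nat) : Prop :=
  exists b : 'I_d -> M,
  (forall m : M, exists (c : 'I_d -> L) x,
     m = \sum_j extr AL (c j) *: b j + mot_tau M x) /\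
  (forall (c : 'I_d -> L) x,
     \sum_j extr AL (c j) *: b j = mot_tau M x -> forall j, c j = 0).

(* The stalk at oo of E(k.oo), where E is locally free and b is a basis of the
   stalk of E, inside the generic fibre V of E. *)
Definition stalk_twist (ooL : placeAbove AL) (V : lmodType {fraction AL})
    (r : nat) (b : 'I_r -> V) (k : nat) : set V :=
  [set x | exists c : 'I_r -> {fraction AL},
     (forall j, - k%:Z <= ooL (c j)) /\ x = \sum_j c j *: b j].

(* An extension of M to a locally free sheaf on C_L is a free module of rank r
   over the stalk of O at oo that spans the generic fibre V of M; b is a basis
   of it. As the pullback of b under the l-th power of sigma^* is a basis of the
   pullback of that stalk, tau^l is an isomorphism onto the stalk of M(k.oo) iff
   it maps this pulled back basis to a basis. *)
Definition pure_at (ooL : placeAbove AL) (M : preMotive) (r k l : nat) : Prop :=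
  exists (sK : {rmorphism {fraction AL} -> {fraction AL}})
    (V : lmodType {fraction AL})
    (j : {linear M -> V | (@tofrac AL : {rmorphism AL -> {fraction AL}}) \; *:%R})
    (tV : {linear V -> V | sK \; *:%R}) (b : 'I_r -> V),
  [/\ forall a, sK (tofrac a) = tofrac (sigma AL a),
      is_base_change j,
      forall m, tV (j m) = j (stau m),
      is_basis b &
      let b' i := iter l tV (b i) in
      is_basis b' /\ stalk_twist ooL b' 0 = stalk_twist ooL b k].

Definition is_pure_motive (ooL : placeAbove AL) (c : {rmorphism A -> L})
    (r d : nat) (M : preMotive) : Prop :=
  [/\ locally_free r M,
      injective (mot_tau M),
      coker_dim M d,
      forall x m, ideal_exp (char_ideal c) d x ->
        exists y, x *: m = mot_tau M y &
      exists k l, [/\ (0 < k)%N, (0 < l)%N & pure_at ooL M r k l]].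

Definition is_weight (ooL : placeAbove AL) (r : nat) (M : preMotive)
    (w : rat) : Prop :=
  exists k l, [/\ (0 < k)%N, (0 < l)%N, pure_at ooL M r k l &
    w = k%:R / l%:R].

(** * Tate modules *)

Record sepClosure (K : fieldType) := SepClosure {
  sep_field :> fieldType;
  sep_in : {rmorphism K -> sep_field};
  sep_alg : forall x, exists2 p : {poly K},
    separable_poly p & root (map_poly sep_in p) x;
  sep_closed : forall p : {poly sep_field}, separable_poly p ->
    (1 < size p)%N -> exists x, root p x }.

(* The rings A_v and A_{v,L^sep} with the canonical maps between them. The
   latter is lim A/v^n (x) L^sep, and A/v^n (x) L^sep is the quotient of
   A_{L^sep} by the n-th power of the extension of v. *)
Record vadicRings (v : set A) := VadicRings {
  Lsep : sepClosure L;
  ALsep : scalarExt (coord_const A) (sep_in Lsep \o fL);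
  Av : idomainType;
  toAv : {rmorphism A -> Av};
  toAvP : is_adic_completion v toAv;
  AvLsep : comNzRingType;
  toAvLsep : {rmorphism ALsep -> AvLsep};
  toAvLsepP : is_adic_completion (ideal_ext (extl ALsep) v) toAvLsep;
  AvAvLsep : {rmorphism Av -> AvLsep};
  AvAvLsepP : forall a, AvAvLsep (toAv a) = toAvLsep (extl ALsep a);
  ALAvLsep : {rmorphism AL -> AvLsep};
  ALAvLsep_l : forall a, ALAvLsep (extl AL a) = toAvLsep (extl ALsep a);
  ALAvLsep_r : forall b,
    ALAvLsep (extr AL b) = toAvLsep (extr ALsep (sep_in Lsep b));
  sigmav : {rmorphism AvLsep -> AvLsep};
  sigmavP : forall x, sigmav (toAvLsep x) = toAvLsep (sigma ALsep x) }.

(* [tate_amb] is M (x) A_{v,L^sep} with [tate_tau x = tau (sigma^* x)];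
   [tate_T] is the Av-submodule of the fixed points of [tate_tau], and [tate_V]
   is V_v M. *)
Record tateModule (M : preMotive) (v : set A) (D : vadicRings v) :=
  TateModule {
  tate_amb : lmodType (AvLsep D);
  tate_in : {linear M -> tate_amb | ALAvLsep D \; *:%R};
  tate_inP : is_base_change tate_in;
  tate_tau : {linear tate_amb -> tate_amb | sigmav D \; *:%R};
  tate_tauP : forall m, tate_tau (tate_in m) = tate_in (stau m);
  tate_T : lmodType (Av D);
  tate_fix : {linear tate_T -> tate_amb | AvAvLsep D \; *:%R};
  tate_fix_inj : injective tate_fix;
  tate_fixP : forall x, tate_tau x = x <-> exists t, tate_fix t = x;
  tate_V : vectType {fraction Av D};
  tate_rat : {linear tate_T -> tate_V |
    (@tofrac (Av D) : {rmorphism Av D -> {fraction Av D}}) \; *:%R};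
  tate_ratP : is_base_change tate_rat }.

(* For L of cardinality q^e, f is the endomorphism pi_v of V_v M induced by the
   Frobenius pi of M, the composite of the pullbacks of tau under the powers
   e-1, .., 0 of sigma^*, i.e. the e-th iterate of x |-> tau (sigma^* x). The
   latter is linear since the e-th power of sigma is the identity of A_L. *)
Definition is_tate_frobenius (M : preMotive) (v : set A) (D : vadicRings v)
    (T : tateModule M D) (e : nat) (f : 'End(tate_V T)) : Prop :=
  exists p : {linear tate_amb T -> tate_amb T},
    (forall m : M, p (tate_in T m) = tate_in T (iter e (@stau M) m)) /\
    forall t : tate_T T, exists t' : tate_T T,
      tate_fix T t' = p (tate_fix T t) /\ f (tate_rat T t) = tate_rat T t'.

End Motives.

(** * Exterior powers *)

Definition multilinear_alternating (K : fieldType) (V W : lmodType K) (n : nat)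
    (f : {ffun 'I_n -> V} -> W) : Prop :=
  (forall (u : {ffun 'I_n -> V}) i a x y,
     let upd z := [ffun j => if j == i then z else u j] in
     f (upd (a *: x + y)) = a *: f (upd x) + f (upd y)) /\
  (forall (u : {ffun 'I_n -> V}) i j, i != j -> u i = u j -> f u = 0).

Record exteriorPower (K : fieldType) (n : nat) (V : vectType K) :=
  ExteriorPower {
  ext_pow :> vectType K;
  wedge : {ffun 'I_n -> V} -> ext_pow;
  wedge_alt : multilinear_alternating wedge;
  wedge_univ : forall (P : lmodType K) (f : {ffun 'I_n -> V} -> P),
    multilinear_alternating f ->
    exists h : {linear ext_pow -> P},
      (forall u, h (wedge u) = f u) /\
      forall h' : {linear ext_pow -> P},
        (forall u, h' (wedge u) = f u) -> h' =1 h }.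

Definition is_exterior_map (K : fieldType) (n : nat) (V : vectType K)
    (W : exteriorPower n V) (f : 'End(V)) (g : 'End(W)) : Prop :=
  forall u : {ffun 'I_n -> V}, g (wedge W u) = wedge W [ffun j => f (u j)].

Definition lfun_char_poly (K : fieldType) (V : vectType K) (f : 'End(V)) :
    {poly K} :=
  char_poly (passmx.mxof (vbasis {:V}) (vbasis {:V}) f).

(** * Absolute values *)

Definition nonarch_abs (R : realType) (K : fieldType) (a : K -> R) : Prop :=
  [/\ forall x, 0 <= a x, forall x, a x = 0 <-> x = 0,
      forall x y, a (x * y) = a x * a y &
      forall x y, a (x + y) <= Num.max (a x) (a y)].

Definition place_abs (R : realType) (F : finFieldType) (C : curve F)
    (P : place (const C)) (x : C) : R :=
  if x == 0 then 0 else #|F|%:R ^ (- P x).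

Record absCompletion (R : realType) (K : fieldType) (a : K -> R) :=
  AbsCompletion {
  compl_field :> fieldType;
  compl_in : {rmorphism K -> compl_field};
  compl_abs : compl_field -> R;
  compl_abs_nonarch : nonarch_abs compl_abs;
  compl_absE : forall x, compl_abs (compl_in x) = a x;
  compl_dense : forall x eps, 0 < eps ->
    exists y, compl_abs (x - compl_in y) < eps;
  compl_complete : forall u : nat -> compl_field,
    (forall eps, 0 < eps -> exists N, forall m n, (N <= m)%N -> (N <= n)%N ->
       compl_abs (u m - u n) < eps) ->
    exists l, forall eps, 0 < eps -> exists N, forall n, (N <= n)%N ->
      compl_abs (u n - l) < eps }.

Record absAlgClosure (R : realType) (K : fieldType) (a : K -> R) :=
  AbsAlgClosure {
  acl_field :> closedFieldType;
  acl_in : {rmorphism K -> acl_field};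
  acl_alg : forall x, exists2 p : {poly K},
    p != 0 & root (map_poly acl_in p) x;
  acl_abs : acl_field -> R;
  acl_abs_nonarch : nonarch_abs acl_abs;
  acl_absE : forall x, acl_abs (acl_in x) = a x }.

(* Main.v *)
(* Let Q_L be the fraction field of A_L. Purity gives a basis of the generic
   fibre M (x) Q_L in which the e-th iterate of x |-> tau (sigma^* x) has a
   matrix P such that P^l maps the standard lattice at oo onto its multiple by
   an element of valuation - k e; here P^l is indeed the matrix of the e l-th
   iterate since sigma^e = 1. Hence the characteristic polynomial of the i-th
   compound matrix of P^l, whose coefficients are sigma-invariant and so lie in
   A, has a Newton polygon at oo that is a single segment of slope k e i. Its
   roots include the l-th powers of the eigenvalues of the i-th compound of P,
   so that these all have the absolute value q^(e i k / l).

   The eigenvalues on the Tate module are the same because the fixed vectors of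
   tau form a basis of M (x) A_{v,L^sep}. Modulo v this is Lang's theorem: some
   iterate tau^a generates a periodic module, which is spanned by the averages
   sum_i l^(q^i) tau^i x with l in a finite field, and tau is surjective up to
   span because its cokernel is killed by J^d while v <> epsilon. The equation
   tau y - y = x is then solved v-adically to lift the fixed vectors. *)
Require Import Defs.
From HB Require Import structures.
From mathcomp Require Import all_boot all_order all_fingroup all_solvable all_algebra all_field.
From mathcomp Require Import all_classical all_reals exp.
From mathcomp Require Import zify ring.
Set Implicit Arguments.
Unset Strict Implicit.
Unset Printing Implicit Defensive.
Import Order.TTheory GRing.Theory Num.Theory.
Local Open Scope classical_set_scope.
Local Open Scope ring_scope.

(** Three obstacles shape the proof. [M] is only locally free and has no basis in general, so its
    endomorphisms are written in a dual basis, as matrices over [A_L] of a size [m] that may exceed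
    [r]. Over the function field, and over [A_{v,L^sep}], such a matrix becomes [E *m Q *m D] with
    [D *m E = 1], and Sylvester's identity recovers the characteristic polynomial of [Q] up to a
    power of X. These matrices over [A_L] link the two fibres; the zeroth power of Frobenius, an
    idempotent, shows that there are exactly [r] independent fixed vectors. Exterior powers, tensor
    products and completions are given only by universal properties or limits, so that bases,
    spanning sets and filtrations must be extracted from those. Points of the curve are bare
    valuations. The finiteness of [A/v^n], on which completions and periodicity depend, rests on the
    fact that a nonzero element of [A] has no zero at [oo]. This needs the existence of poles, hence
    the construction of a discrete valuation ring. *)

(** * Base change of modules and dual bases *)

Section BaseChange.
Context (R S : comNzRingType) (f : {rmorphism R -> S}).
Context (M : lmodType R) (N : lmodType S) (j : {linear M -> N | f \; *:%R}).
Hypothesis jP : is_base_change j.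

Lemma base_change_map (P : lmodType S) (g : M -> P) :
  (forall a x y, g (a *: x + y) = f a *: g x + g y) ->
  exists h : {linear N -> P}, forall m, h (j m) = g m.
Proof.
move=> glin.
pose gl := @GRing.isLinear.Build R M P (f \; *:%R) g glin.
pose G : {linear M -> P | f \; *:%R} := HB.pack g gl.
by have [h [hE _]] := jP G; exists h.
Qed.

Lemma base_change_uniq (P : lmodType S) (h h' : {linear N -> P}) :
  (forall m, h (j m) = h' (j m)) -> h =1 h'.
Proof.
move=> hh'.
have glin a x y : h (j (a *: x + y)) = f a *: h (j x) + h (j y).
  by rewrite !linearP.
pose gl := @GRing.isLinear.Build R M P (f \; *:%R) (fun x => h (j x)) glin.
pose G : {linear M -> P | f \; *:%R} := HB.pack (fun x => h (j x)) gl.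
have [k [_ kU]] := jP G.
by move=> x; rewrite (kU h) // (kU h') // => m; rewrite -hh'.
Qed.

(** A dual basis is what a projective module has in place of a basis. It survives base change: the
    functionals extend by the universal property, and the sum over [i] is an endomorphism that
    agrees with the identity on the image of [j]. *)
Lemma base_change_dual_basis (I : finType) (e : I -> M)
    (kap : I -> {linear M -> R^o}) :
  (forall m, m = \sum_i kap i m *: e i) ->
  exists kap' : I -> {linear N -> S^o},
    (forall i m, kap' i (j m) = f (kap i m)) /\
    (forall x, x = \sum_i kap' i x *: j (e i)).
Proof.
move=> ek.
have ex i : exists h : {linear N -> S^o}, forall m, h (j m) = f (kap i m).
  apply: base_change_map => a x y.
  by rewrite linearP rmorphD rmorphM.
have /choice[kap' kap'E] := ex.
exists kap'; split=> // x.
have lin a y z : \sum_i kap' i (a *: y + z) *: j (e i) =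
    a *: (\sum_i kap' i y *: j (e i)) + \sum_i kap' i z *: j (e i).
  rewrite scaler_sumr -big_split /=; apply: eq_bigr => i _.
  by rewrite linearP scalerDl scalerA.
pose gl := @GRing.isLinear.Build S N N *:%R (fun x => \sum_i kap' i x *: j (e i)) lin.
pose G : {linear N -> N} := HB.pack (fun x => \sum_i kap' i x *: j (e i)) gl.
apply: (base_change_uniq (h := idfun) (h' := G)) => m /=.
rewrite {1}[m]ek linear_sum; apply: eq_bigr => i _.
by rewrite linearZ kap'E.
Qed.

End BaseChange.

(** * Characteristic polynomials and exterior powers *)

Section CharPolySylvester.
Variable R : comNzRingType.

(** Sylvester's identity: the block matrix [M] is made triangular in two ways, and its determinant
    is read off from both. *)
Lemma char_poly_mulmxC m n (A : 'M[R]_(m, n)) (B : 'M[R]_(n, m)) :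
  'X^n * char_poly (A *m B) = 'X^m * char_poly (B *m A).
Proof.
pose f := map_mx (@polyC R).
have XA p q (C : 'M[{poly R}]_(p, q)) : C *m 'X%:M = 'X *: C by rewrite mul_mx_scalar.
pose M := block_mx ('X%:M : 'M_m) (f _ _ A) (f _ _ B) (1%:M : 'M_n).
have E1 : M *m block_mx 1%:M 0 (- f _ _ B) 1%:M =
    block_mx (char_poly_mx (A *m B)) (f _ _ A) 0 1%:M.
  rewrite mulmx_block !mulmx1 !mul1mx !mulmx0 !add0r mulmxN /char_poly_mx.
  by rewrite /f map_mxM subrr.
have E2 : M *m block_mx 1%:M (- f _ _ A) 0 'X%:M =
    block_mx ('X%:M) 0 (f _ _ B) (char_poly_mx (B *m A)).
  rewrite mulmx_block !mulmx1 !mulmx0 !addr0 mul1mx !mulmxN mul_scalar_mx XA.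
  by rewrite addNr addrC /char_poly_mx /f map_mxM.
have D1 : \det M = char_poly (A *m B).
  have := congr1 determinant E1.
  by rewrite det_mulmx det_lblock det_ublock !det1 !mulr1.
have := congr1 determinant E2.
rewrite det_mulmx det_ublock det_lblock det1 mul1r !det_scalar D1.
by rewrite mulrC.
Qed.

End CharPolySylvester.

(** These subsets index the basis of an exterior power and the minors of a matrix. *)
Definition kset n r := {S : {set 'I_r} | #|S| == n}.

Definition kfun n r (S : kset n r) (k : 'I_n) : 'I_r :=
  enum_val (cast_ord (esym (eqP (valP S))) k).

Lemma kfun_inj n r (S : kset n r) : injective (kfun S).
Proof. by move=> k l /enum_val_inj/cast_ord_inj. Qed.

Lemma kfun_image n r (S : kset n r) : [set kfun S k | k in 'I_n]%SET = val S.
Proof.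
apply/eqP; rewrite eqEcard card_imset; last exact: kfun_inj.
rewrite card_ord (eqP (valP S)) leqnn andbT.
by apply/fintype.subsetP => _ /imsetP[k _ ->]; apply: enum_valP.
Qed.

Section Alternating.
Variables (R : comNzRingType) (V W : lmodType R) (n r : nat).
Variable g : {ffun 'I_n -> V} -> W.

Definition upd (u : {ffun 'I_n -> V}) i z : {ffun 'I_n -> V} :=
  [ffun j => if j == i then z else u j].

Hypothesis gD : forall u i a x y,
  g (upd u i (a *: x + y)) = a *: g (upd u i x) + g (upd u i y).

Lemma multilinear_sum u i (t : 'I_r -> V) (c : 'I_r -> R) :
  g (upd u i (\sum_j c j *: t j)) = \sum_j c j *: g (upd u i (t j)).
Proof.
have g0 : g (upd u i 0) = 0.
  have := gD u i 1 0 0; rewrite scaler0 addr0 scale1r => /eqP.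
  by rewrite -subr_eq subrr => /eqP<-.
have gZ a x : g (upd u i (a *: x)) = a *: g (upd u i x).
  by rewrite -[a *: x]addr0 gD g0 addr0.
apply: (big_ind2 (fun x y => g (upd u i x) = y)) => // x x' y y' <- <-.
by rewrite -{1}[x]scale1r gD scale1r.
Qed.

Lemma multilinear_expand (t : 'I_r -> V) (m : 'M[R]_(n, r)) :
  g [ffun k => \sum_j m k j *: t j] =
  \sum_(w : {ffun 'I_n -> 'I_r}) (\prod_k m k (w k)) *: g [ffun k => t (w k)].
Proof.
(* The induction below needs a default index, hence [0 < r]; the case [r = 0] in turn needs a slot,
   hence [0 < n]. *)
case: (posnP n) => [n0|n_gt0].
  have no (k : 'I_n) : False by case: k => k; rewrite n0.
  have fE (T : Type) (f h : {ffun 'I_n -> T}) : f = h.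
    by apply/ffunP => k; case: (no k).
  pose w0 : {ffun 'I_n -> 'I_r} := [ffun k => False_rect _ (no k)].
  rewrite (bigD1 w0) //= [X in _ + X]big1 => [|w]; last by rewrite (fE _ w w0) eqxx.
  rewrite addr0 big1 => [|k _]; last by case: (no k).
  by rewrite scale1r; congr g; apply: fE.
case: (posnP r) => [r0|r_gt0].
  have no (k : 'I_r) : False by case: k => k; rewrite r0.
  rewrite [RHS]big1; last by move=> w; case: (no (w (Ordinal n_gt0))).
  set u := finfun _.
  have -> : u = upd u (Ordinal n_gt0) (\sum_j m (Ordinal n_gt0) j *: t j).
    by apply/ffunP => k; rewrite !ffunE; case: eqP => // ->.
  by rewrite multilinear_sum big1 // => j; case: (no j).
pose j0 := Ordinal r_gt0.
pose us (s : seq 'I_n) (w : {ffun 'I_n -> 'I_r}) : {ffun 'I_n -> V} :=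
  [ffun k => if k \in s then t (w k) else \sum_j m k j *: t j].
pose setw (w : {ffun 'I_n -> 'I_r}) k j : {ffun 'I_n -> 'I_r} :=
  [ffun l => if l == k then j else w l].
(* The slots are expanded one after another along [s]. A partial choice is stored as a function
   equal to [j0] outside [s], so that each is counted once. *)
have key (s : seq 'I_n) : uniq s -> g [ffun k => \sum_j m k j *: t j] =
   \sum_(w : {ffun 'I_n -> 'I_r} | [forall k, (k \notin s) ==> (w k == j0)])
      (\prod_(k <- s) m k (w k)) *: g (us s w).
  elim: s => [_|k s IHs /= /andP[kNs s_uniq]].
    rewrite (bigD1 [ffun=> j0]) /=; last by apply/forallP => k; rewrite ffunE.
    rewrite [X in _ + X]big1 => [|w /andP[/forallP/= w0 /eqP wn]]; last first.
      by case: wn; apply/ffunP => k; rewrite ffunE (eqP (w0 k)).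
    by rewrite addr0 big_nil scale1r; congr g; apply/ffunP => k; rewrite !ffunE.
  rewrite IHs //.
  rewrite [RHS](partition_big (fun w => setw w k j0)
    (fun w => [forall k, (k \notin s) ==> (w k == j0)])) /=; last first.
    move=> w /forallP/= wP; apply/forallP => l; rewrite !ffunE.
    case: (l =P k) => [-> | /eqP lk]; first by rewrite kNs eqxx.
    by have := wP l; rewrite inE negb_or lk.
  apply: eq_bigr => w /forallP wP.
  have wk : w k = j0 by have := wP k; rewrite kNs => /eqP.
  have -> : us s w = upd (us s w) k (\sum_j m k j *: t j).
    by apply/ffunP => l; rewrite !ffunE; case: eqP => // ->; rewrite (negbTE kNs).
  rewrite multilinear_sum scaler_sumr.
  rewrite (reindex_onto (fun j => setw w k j) (fun w' => w' k)) /=; last first.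
    move=> w' /andP[_ /eqP <-]; apply/ffunP => l; rewrite !ffunE.
    by case: eqP => // ->.
  apply: eq_big => [j|j _].
    rewrite !ffunE eqxx !eqxx andbT; symmetry; apply/andP; split.
      apply/forallP => l; rewrite inE negb_or !ffunE.
      by case: eqP => //= _; apply: wP.
    apply/eqP/ffunP => l; rewrite !ffunE; case: eqP => // ->.
    by rewrite wk.
  rewrite big_cons !ffunE eqxx scalerA mulrC.
  congr (_ * _ *: _).
    rewrite big_seq [RHS]big_seq; apply: eq_bigr => l ls.
    by rewrite ffunE; case: eqP ls => // ->; rewrite (negbTE kNs).
  congr g; apply/ffunP => l; rewrite !ffunE inE.
  by case: eqP => //.
rewrite (key (index_enum 'I_n)) ?index_enum_uniq //.
apply: eq_big => [w|w _].
  by apply/forallP => k; rewrite mem_index_enum.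
by congr (_ *: g _); apply/ffunP => k; rewrite !ffunE mem_index_enum.
Qed.

Hypothesis g0 : forall (u : {ffun 'I_n -> V}) i j, i != j -> u i = u j -> g u = 0.

(** Expand [g] with [u i + u j] in both slots. *)
Lemma alternating_tperm (u : {ffun 'I_n -> V}) i j : i != j ->
  g [ffun k => u (tperm i j k)] = - g u.
Proof.
move=> ij.
pose G a b := g (upd (upd u i a) j b).
have updC a b : upd (upd u i a) j b = upd (upd u j b) i a.
  apply/ffunP => k; rewrite !ffunE; case: (k =P j) => [->|//].
  by rewrite eq_sym (negbTE ij).
have GD1 a b c : G (a + b) c = G a c + G b c.
  by rewrite /G !updC -{1}[a]scale1r gD scale1r.
have GD2 a b c : G a (b + c) = G a b + G a c.
  by rewrite /G -{1}[b]scale1r gD scale1r.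
have G0 a : G a a = 0.
  by apply: (g0 ij); rewrite !ffunE !eqxx (negbTE ij).
have := G0 (u i + u j); rewrite GD1 !GD2 !G0 add0r addr0 => /eqP.
rewrite addrC addr_eq0 => /eqP.
have -> : G (u i) (u j) = g u.
  congr g; apply/ffunP => k; rewrite !ffunE.
  by case: eqP => [->|_] //; case: eqP => [->|].
move=> <-; congr g; apply/ffunP => k; rewrite !ffunE.
case: (k =P j) => [->|kj]; first by rewrite tpermR.
case: (k =P i) => [->|ki]; first by rewrite tpermL.
by rewrite tpermD // eq_sym; apply/eqP.
Qed.

Lemma alternating_perm (u : {ffun 'I_n -> V}) (s : 'S_n) :
  g [ffun k => u (s k)] = (-1) ^+ s *: g u.
Proof.
case: (prod_tpermP s) => ts -> tsP.
elim: ts u tsP => [|[i j] ts IHts] u /=.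
  move=> _; rewrite big_nil odd_perm1 scale1r; congr g.
  by apply/ffunP => k; rewrite ffunE perm1.
case/andP=> ij tsP; rewrite big_cons odd_mul_tperm ij /= signrN.
have -> : [ffun k => u ((tperm i j * \prod_(t <- ts) tperm t.1 t.2)%g k)] =
          [ffun k => [ffun l => u ((\prod_(t <- ts) tperm t.1 t.2)%g l)]
             (tperm i j k)].
  by apply/ffunP => k; rewrite !ffunE permM.
by rewrite alternating_tperm // IHts // scaleNr.
Qed.

(** Choices with a repeated index contribute nothing. The injective ones are grouped by their image
    [S]; each is [kfun S] after a permutation, and the signs add up to a determinant. *)
Lemma alternating_expand (t : 'I_r -> V) (m : 'M[R]_(n, r)) :
  g [ffun k => \sum_j m k j *: t j] =
  \sum_(S : kset n r) \det (colsub (kfun S) m) *: g [ffun k => t (kfun S k)].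
Proof.
rewrite multilinear_expand (bigID (fun w : {ffun 'I_n -> 'I_r} => injectiveb w)) /=.
rewrite addrC big1 ?add0r.
  have wP (w : {ffun 'I_n -> 'I_r}) : injectiveb w ->
      #|[set w k | k in 'I_n]%SET| == n.
    by move/injectiveP => wi; rewrite card_imset // card_ord.
  have iT (w : {ffun 'I_n -> 'I_r}) (wi : injectiveb w) :
      insub [set w k | k in 'I_n]%SET =
      Some (exist (fun S : {set 'I_r} => #|S| == n) _ (wP w wi)) :> option (kset n r).
    by case: insubP => [u _ uE|/negP[]]; [congr Some; apply: val_inj | apply: wP].
  rewrite (partition_big (fun w : {ffun 'I_n -> 'I_r} =>
      insub [set w k | k in 'I_n]%SET : option (kset n r)) isSome) /=; last first.
    by move=> w wi; rewrite (iT w wi).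
  rewrite (reindex_omap Some id) /=; last by case.
  apply: eq_big => [S|S _]; first by rewrite eqxx.
  rewrite /determinant scaler_suml.
  pose F (s : 'S_n) : {ffun 'I_n -> 'I_r} := [ffun k => kfun S (s k)].
  have FP (w : {ffun 'I_n -> 'I_r}) : injectiveb w ->
      insub [set w k | k in 'I_n]%SET == Some S -> exists s, F s = w.
    move=> wi /eqP; rewrite (iT w wi) => /Some_inj/(congr1 val) iw0.
    have {iw0} iw : [set w k | k in 'I_n]%SET = val S by exact: iw0.
    have ex k : exists l, kfun S l == w k.
      have : w k \in val S by rewrite -iw imset_f.
      by rewrite -kfun_image => /imsetP[l _ ->]; exists l.
    pose h k := xchoose (ex k).
    have hE k : kfun S (h k) = w k by apply/eqP/(xchooseP (ex k)).
    have h_inj : injective h.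
      move=> k l hkl; apply: (injectiveP _ wi); by rewrite -!hE hkl.
    by exists (perm h_inj); apply/ffunP => k; rewrite ffunE permE hE.
  rewrite (reindex_onto F (fun w => odflt 1%g [pick s | F s == w])) /=; last first.
    move=> w /andP[wi wS]; case: pickP => [s /eqP //|nos].
    by have [s sw] := FP w wi wS; have := nos s; rewrite sw eqxx.
  apply: eq_big => [s|s _].
    have Fi : injectiveb (F s).
      by apply/injectiveP => k l; rewrite !ffunE => /kfun_inj/perm_inj.
    rewrite Fi (iT _ Fi) /=; apply/andP; split.
      apply/eqP; congr Some; apply/val_inj => /=.
      rewrite -kfun_image; apply/setP => x; apply/imsetP/imsetP => -[k _ ->].
        by exists (s k); rewrite ?ffunE.
      by exists ((s^-1)%g k); rewrite // ffunE permKV.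
    case: pickP => [s' /eqP|/(_ s)]; last by rewrite eqxx.
    move=> /ffunP Fs /=; apply/eqP/permP => k; apply: (@kfun_inj _ _ S).
    by have := Fs k; rewrite !ffunE.
  have -> : [ffun k => t (F s k)] =
      [ffun k => [ffun l => t (kfun S l)] (s k)].
    by apply/ffunP => k; rewrite !ffunE.
  rewrite alternating_perm scalerA mulrC; congr (_ * _ *: _).
  by apply: eq_bigr => k _; rewrite mxE ffunE.
move=> w /injectivePn[k [l kl wkl]].
by rewrite (g0 kl) ?scaler0 // !ffunE wkl.
Qed.

End Alternating.

Section Compound.
Variables (R : comNzRingType) (n : nat).

(** The matrix of the [n]-th exterior power of [A]. *)
Definition compound p q (A : 'M[R]_(p, q)) : 'M[R]_(#|{: kset n p}|, #|{: kset n q}|) :=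
  \matrix_(a, b) \det (mxsub (kfun (enum_val a)) (kfun (enum_val b)) A).

Lemma det_upd q (w : 'I_n -> 'I_q) (u : {ffun 'I_n -> 'rV[R]_q}) i a x y :
  \det (\matrix_(k, l) upd u i (a *: x + y) k 0 (w l)) =
  a * \det (\matrix_(k, l) upd u i x k 0 (w l)) +
  \det (\matrix_(k, l) upd u i y k 0 (w l)).
Proof.
rewrite -[X in _ = _ + X]mul1r; apply: (determinant_multilinear (i0 := i)).
- by apply/rowP => l; rewrite !mxE !ffunE eqxx !mxE mul1r.
- by apply/matrixP => k l; rewrite !mxE !ffunE eq_sym (negbTE (neq_lift i k)).
- by apply/matrixP => k l; rewrite !mxE !ffunE eq_sym (negbTE (neq_lift i k)).
Qed.

Lemma det_rows_eq q (w : 'I_n -> 'I_q) (u : {ffun 'I_n -> 'rV[R]_q}) i j :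
  i != j -> u i = u j -> \det (\matrix_(k, l) u k 0 (w l)) = 0.
Proof.
move=> ij uij; apply: (determinant_alternate ij) => l.
by rewrite !mxE uij.
Qed.

(** Cauchy-Binet: a minor is alternating in the rows, and the rows of [A *m B] are combinations of
    those of [B]. *)
Lemma compoundM p q s (A : 'M[R]_(p, q)) (B : 'M[R]_(q, s)) :
  compound (A *m B) = compound A *m compound B.
Proof.
apply/matrixP => a b; rewrite !mxE.
pose w := kfun (enum_val b).
pose g (u : {ffun 'I_n -> 'rV[R]_s}) : R^o := \det (\matrix_(k, l) u k 0 (w l)).
pose m : 'M[R]_(n, q) := rowsub (kfun (enum_val a)) A.
have := @alternating_expand R 'rV[R]_s R^o n q g.
move=> /(_ (fun u i a => det_upd w u i a) (fun u i j => @det_rows_eq _ w u i j)).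
move=> /(_ (fun j => row j B) m) E.
transitivity (g [ffun k => \sum_j m k j *: row j B]).
  rewrite /g; congr (\det _); apply/matrixP => k l; rewrite !mxE ffunE summxE.
  by apply: eq_bigr => j _; rewrite !mxE.
rewrite E (reindex_onto (@enum_val _ _) enum_rank) /=; last first.
  by move=> S _; rewrite enum_rankK.
apply: eq_big => [c|c _]; first by rewrite enum_valK eqxx.
rewrite !mxE; congr (_ * _).
  by congr (\det _); apply/matrixP => k l; rewrite !mxE.
by congr (\det _); apply/matrixP => k l; rewrite !mxE !ffunE !mxE.
Qed.

Lemma det_kfun p (S T : kset n p) :
  \det (\matrix_(k, l) (kfun S k == kfun T l)%:R) = (S == T)%:R :> R.
Proof.
have [->|ST] := eqVneq S T.
  rewrite -[RHS](det1 _ n); congr (\det _); apply/matrixP => k l; rewrite !mxE.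
  by rewrite (inj_eq (@kfun_inj _ _ T)).
have [k kP] : exists k, kfun S k \notin val T.
  apply/existsP; apply: contraT; rewrite negb_exists => /forallP kP.
  case/eqP: ST; apply/val_inj/eqP; rewrite eqEcard.
  rewrite (eqP (valP S)) (eqP (valP T)) leqnn andbT -kfun_image.
  by apply/fintype.subsetP => _ /imsetP[k _ ->]; have := kP k; rewrite negbK.
rewrite (expand_det_row _ k) big1 // => l _; rewrite !mxE.
case: eqP => [E|_]; last by rewrite mul0r.
by case/negP: kP; rewrite E -kfun_image imset_f.
Qed.

Lemma compound1 p : compound (1%:M : 'M[R]_p) = 1%:M.
Proof.
apply/matrixP => a b; rewrite !mxE -(inj_eq enum_val_inj) -det_kfun.
by congr (\det _); apply/matrixP => k l; rewrite !mxE.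
Qed.

End Compound.

Lemma map_compound (R S : comNzRingType) (f : {rmorphism R -> S}) n p q
  (A : 'M[R]_(p, q)) : map_mx f (compound n A) = compound n (map_mx f A).
Proof.
apply/matrixP => a b; rewrite !mxE -det_map_mx; congr (\det _).
by apply/matrixP => k l; rewrite !mxE.
Qed.

Lemma compoundZ (R : comNzRingType) n p q (a : R) (A : 'M[R]_(p, q)) :
  compound n (a *: A) = a ^+ n *: compound n A.
Proof.
apply/matrixP => k l; rewrite !mxE -detZ; congr (\det _).
by apply/matrixP => i j; rewrite !mxE.
Qed.

Section CharPolyBasis.
Variables (K : fieldType).

Lemma mulmx1_dim m n (A : 'M[K]_(m, n)) (B : 'M[K]_(n, m)) :
  A *m B = 1%:M -> (m <= n)%N.
Proof.
move=> AB; rewrite -[m](mxrank1 K) -AB.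
exact: leq_trans (mxrankM_maxl _ _) (rank_leq_col _).
Qed.

(** [Z] and [Z'] pass between the canonical basis and [w]. Their sizes agree only propositionally,
    which [char_poly_mulmxC] accommodates. *)
Lemma lfun_char_polyE (W : vectType K) p (w : 'I_p -> W) (D : {linear W -> 'rV[K]_p})
  (g : 'End(W)) (P : 'M[K]_p) :
  (forall a, D (w a) = delta_mx 0 a) -> (forall x, x = \sum_a D x 0 a *: w a) ->
  (forall a, g (w a) = \sum_b P a b *: w b) ->
  lfun_char_poly g = char_poly P.
Proof.
move=> Dw wD gP; rewrite /lfun_char_poly.
set b := vbasis {:W}; set m := \dim {:W}.
have bP : basis_of {:W} b := vbasisP _.
have bE x : x = \sum_i coord b i x *: b`_i by apply: coord_basis bP (memvf x).
pose Z : 'M[K]_(m, p) := \matrix_(i, a) D b`_i 0 a.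
pose Z' : 'M[K]_(p, m) := \matrix_(a, i) coord b i (w a).
have cE (i j : 'I_m) : coord b j b`_i = (i == j)%:R.
  by rewrite coord_free ?(basis_free bP).
have ZZ' : Z *m Z' = 1%:M.
  apply/matrixP => i j; rewrite !mxE -cE [b`_i in RHS]wD linear_sum.
  by apply: eq_bigr => a _; rewrite !mxE linearZ.
have Z'Z : Z' *m Z = 1%:M.
  apply/matrixP => a c; rewrite !mxE.
  have := congr1 (fun v : 'rV_p => v 0 c) (Dw a); rewrite [w a]bE linear_sum summxE !mxE eqxx /= eq_sym.
  by move=> <-; apply: eq_bigr => i _; rewrite linearZ !mxE.
have -> : passmx.mxof b b g = Z *m (P *m Z').
  apply/matrixP => i j; rewrite !mxE /= passmx.vecof_delta.
  rewrite [b`_i]wD !linear_sum; apply: eq_bigr => a _; rewrite !linearZ /= !mxE.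
  congr (_ * _); rewrite gP linear_sum; apply: eq_bigr => c _.
  by rewrite linearZ !mxE.
have pm : p = m by apply/eqP; rewrite eqn_leq (mulmx1_dim ZZ') (mulmx1_dim Z'Z).
have := char_poly_mulmxC Z (P *m Z'); rewrite -mulmxA Z'Z mulmx1 -[in 'X^m]pm.
by apply: mulfI; rewrite -size_poly_eq0 size_polyXn.
Qed.

End CharPolyBasis.

(** The exterior power is known only by its universal property, so its basis must be found. The
    minors of the coordinates form an alternating map [F], whose linear extension [h] provides
    coordinates; expanding in the wedges [w] agrees with the identity on every wedge, hence
    everywhere by uniqueness. *)
Lemma exterior_char_poly (K : fieldType) (V : vectType K) r (t : 'I_r -> V)
    (D : {linear V -> 'rV[K]_r}) (f : 'End(V)) (Q : 'M[K]_r) n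
    (W : exteriorPower n V) (g : 'End(W)) :
  (forall a, D (t a) = delta_mx 0 a) -> (forall x, x = \sum_a D x 0 a *: t a) ->
  (forall a, f (t a) = \sum_b Q a b *: t b) ->
  is_exterior_map f g -> lfun_char_poly g = char_poly (compound n Q).
Proof.
move=> Dt tD fQ gE.
have [wD wA] := wedge_alt W.
pose wS S := wedge W [ffun k => t (kfun S k)].
pose w (a : 'I_#|{: kset n r}|) := wS (enum_val a).
have wX u : wedge W u =
    \sum_(S : kset n r) \det (\matrix_(k, l) D (u k) 0 (kfun S l)) *: wS S.
  have := alternating_expand wD wA t (\matrix_(k, j) D (u k) 0 j).
  have -> : [ffun k => \sum_j (\matrix_(k0, j0) D (u k0) 0 j0) k j *: t j] = u.
    apply/ffunP => k; rewrite ffunE [RHS]tD.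
    by apply: eq_bigr => j _; rewrite mxE.
  move=> ->; apply: eq_bigr => S _; congr (\det _ *: _).
  by apply/matrixP => k l; rewrite !mxE.
pose N := #|{: kset n r}|.
pose F (u : {ffun 'I_n -> V}) : 'rV[K]_N :=
  \row_a \det (\matrix_(k, l) D (u k) 0 (kfun (enum_val a) l)).
have FE u a : F u 0 a = \det (\matrix_(k, l)
     [ffun k => D (u k)] k 0 (kfun (enum_val a) l)).
  by rewrite mxE; congr (\det _); apply/matrixP => k l; rewrite !mxE ffunE.
have FA : multilinear_alternating F.
  split=> [u i a x y|u i j ij uij].
    apply/rowP => b; rewrite [in RHS]mxE [X in _ = X + _]mxE !FE -/(upd _ _ _).
    have updE z : [ffun k => D ([ffun j => if j == i then z else u j] k)]
      = upd [ffun k => D (u k)] i (D z).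
      by apply/ffunP => k; rewrite !ffunE; case: eqP.
    by rewrite !updE linearP det_upd.
  apply/rowP => b; rewrite FE mxE (det_rows_eq _ ij) // !ffunE uij //.
have [h [hE hU]] := @wedge_univ _ _ _ W _ _ FA.
have wsum u : wedge W u = \sum_a F u 0 a *: w a.
  rewrite wX (reindex_onto (@enum_val _ _) enum_rank) /=; last first.
    by move=> S _; rewrite enum_rankK.
  by apply: eq_big => [c|c _]; [rewrite enum_valK eqxx | rewrite mxE].
have hw a : h (w a) = delta_mx 0 a.
  rewrite hE; apply/rowP => b; rewrite !mxE eqxx /= eq_sym.
  rewrite -(inj_eq enum_val_inj) -(det_kfun K); congr (\det _).
  by apply/matrixP => k l; rewrite !mxE ffunE Dt !mxE eqxx eq_sym.
have lin : linear_for *:%R (fun x : W => \sum_a h x 0 a *: w a).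
  move=> c x y; rewrite scaler_sumr -big_split; apply: eq_bigr => a _.
  by rewrite linearP !mxE scalerDl scalerA.
pose gl := @GRing.isLinear.Build K W W *:%R (fun x : W => \sum_a h x 0 a *: w a) lin.
pose G : {linear W -> W} := HB.pack (fun x : W => \sum_a h x 0 a *: w a) gl.
have [k [_ kU]] := @wedge_univ _ _ _ W _ _ (wedge_alt W).
have wh x : x = \sum_a h x 0 a *: w a.
  rewrite -[LHS]/(idfun x) (kU idfun) // -(kU G) // => u.
  by rewrite /= hE -wsum.
apply: lfun_char_polyE hw wh _ => a.
rewrite /w /wS gE wsum; apply: eq_bigr => b _; congr (_ *: _).
rewrite !mxE; congr (\det _); apply/matrixP => i j; rewrite !mxE !ffunE fQ.
rewrite linear_sum summxE (bigD1 (kfun (enum_val b) j)) //=.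
rewrite linearZ Dt !mxE !eqxx mulr1 big1 ?addr0 // => c cN.
by rewrite linearZ Dt !mxE eqxx eq_sym (negbTE cN) mulr0.
Qed.

(** * Places with a prescribed zero *)

Lemma dependent_rows (F : fieldType) (I J : finType) (M : I -> J -> F) :
  (#|J| < #|I|)%N ->
  exists f : I -> F, (exists i, f i != 0) /\ forall j, \sum_i f i * M i j = 0.
Proof.
move=> lt_JI.
pose A : 'M[F]_(#|I|, #|J|) := \matrix_(a, b) M (enum_val a) (enum_val b).
have kerA : kermx A != 0.
  rewrite -mxrank_eq0 mxrank_ker subn_eq0 -ltnNge.
  exact: leq_ltn_trans (rank_leq_col _) lt_JI.
have [a aN] : exists a, row a (kermx A) != 0.
  apply/existsP; apply: contraNT kerA; rewrite negb_exists => /forallP ker0.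
  by apply/eqP/row_matrixP => a; rewrite row0; apply/eqP; have := ker0 a; rewrite negbK.
pose v := row a (kermx A).
have vA : v *m A = 0 by apply/sub_kermxP/row_sub.
exists (fun i => v 0 (enum_rank i)); split.
  have /rV0Pn[k vk] := aN.
  by exists (enum_val k); rewrite enum_valK.
move=> j; transitivity ((v *m A) 0 (enum_rank j)); last by rewrite vA mxE.
rewrite mxE.
rewrite [LHS](reindex_onto (@enum_val _ _) enum_rank) /=; last first.
  by move=> i _; rewrite enum_rankK.
apply: eq_big => [b|b _]; first by rewrite enum_valK eqxx.
by rewrite enum_valK [A _ _]mxE enum_rankK.
Qed.

Section Relation.
Context (F K : fieldType) (i : {rmorphism F -> K}) (t : K).
Hypothesis t_trans : forall p : {poly F}, root (map_poly i p) t -> p = 0.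
Context (n : nat) (b : 'I_n -> K).
Local Notation ev p := ((map_poly i p).[t]).
Hypothesis bP : forall x, exists (p : {poly F}) (s : 'I_n -> {poly F}),
  p != 0 /\ ev p * x = \sum_j ev (s j) * b j.

Let evM p q : ev (p * q) = ev p * ev q. Proof. by rewrite rmorphM hornerM. Qed.

Let ev_sum (I : finType) (G : I -> {poly F}) : ev (\sum_i G i) = \sum_i ev (G i).
Proof. by rewrite rmorph_sum horner_sum. Qed.

Let bnd d (p : {poly F}) := (size p <= d.+1)%N.

Let bndM d e p q : bnd d p -> bnd e q -> bnd (d + e) (p * q).
Proof.
rewrite /bnd => dp eq; have := size_polyMleq p q; lia.
Qed.

Let bnd_sum d (I : finType) (G : I -> {poly F}) :
  (forall i, bnd d (G i)) -> bnd d (\sum_i G i).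
Proof. by move=> dG; apply: leq_trans (size_sum _ _ _) _; apply/bigmax_leqP => k _; apply: dG. Qed.

Let mult_matrix x : exists (p : {poly F}) (S : 'I_n -> 'I_n -> {poly F}) d,
  [/\ p != 0, bnd d p, forall j k, bnd d (S j k) &
      forall j, ev p * (x * b j) = \sum_k ev (S j k) * b k].
Proof.
have /choice[p /choice[s psP]] : forall j, exists (p : {poly F}) (s : 'I_n -> {poly F}),
    p != 0 /\ ev p * (x * b j) = \sum_k ev (s k) * b k by move=> j; apply: bP.
pose P := \prod_j p j.
pose S j k := (\prod_(l | l != j) p l) * s j k.
pose d := (size P + \sum_j \sum_k size (S j k))%N.
exists P, S, d; split.
- by apply/prodf_neq0 => j _; case: (psP j).
- by apply: leq_trans (leqnSn _); apply: leq_addr.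
- move=> j k; apply: leq_trans (leqnSn _); apply: leq_trans (leq_addl _ _).
  by rewrite (bigD1 j) //= (bigD1 k) //= -addnA leq_addr.
move=> j; rewrite /P (bigD1 j) //= [p j * _]mulrC evM -mulrA.
rewrite (proj2 (psP j)) mulr_sumr.
by apply: eq_bigr => k _; rewrite evM mulrA.
Qed.

(** All powers up to [X] get the same denominator, so that they can enter one linear system. *)
Let mult_pow x x0 (p : {poly F}) (S : 'I_n -> 'I_n -> {poly F}) d (P0 : {poly F}) u0 d0 :
  bnd d p -> (forall j k, bnd d (S j k)) ->
  (forall j, ev p * (x * b j) = \sum_k ev (S j k) * b k) ->
  (forall k, bnd d0 (u0 k)) -> ev P0 * x0 = \sum_k ev (u0 k) * b k ->
  forall X a, (a <= X)%N -> exists u : 'I_n -> {poly F},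
    (forall k, bnd (d0 + X * d) (u k)) /\
    ev (p ^+ X * P0) * (x ^+ a * x0) = \sum_k ev (u k) * b k.
Proof.
move=> dp dS ES du0 Eu0; elim=> [|X IHX] a.
  rewrite leqn0 => /eqP->; exists u0; rewrite addn0.
  by rewrite !expr0 !mul1r.
rewrite leq_eqVlt => /orP[/eqP->|aX]; last first.
  have [u [du Eu]] := IHX a aX; exists (fun k => p * u k); split=> [k|].
    by rewrite mulSn addnCA; apply: bndM.
  rewrite exprS -mulrA evM -mulrA Eu mulr_sumr.
  by apply: eq_bigr => k _; rewrite evM mulrA.
have [u [du Eu]] := IHX X (leqnn _).
exists (fun k => \sum_j u j * S j k); split=> [k|].
  apply: bnd_sum => j; rewrite mulSn [(d + _)%N]addnC addnA.
  by apply: bndM.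
have -> : ev (p ^+ X.+1 * P0) * (x ^+ X.+1 * x0) =
    ev p * (x * (ev (p ^+ X * P0) * (x ^+ X * x0))).
  rewrite exprS -mulrA evM -!mulrA; congr (_ * _).
  by rewrite [x * _]mulrCA exprS !mulrA.
rewrite Eu !mulr_sumr.
under eq_bigr => j _ do rewrite [x * _]mulrCA [ev p * _]mulrCA ES mulr_sumr.
rewrite exchange_big; apply: eq_bigr => k _ /=.
rewrite ev_sum mulr_suml; apply: eq_bigr => j _.
by rewrite evM mulrA.
Qed.

(** [N0] depends on [y] alone; this uniformity in [z] later makes the valuation discrete. Once
    denominators are cleared, the products [y ^+ a * z ^+ c] are combinations of the [b k] with
    coefficients of bounded degree in [t], and there are more products than coefficients. *)
Lemma bounded_relation y : exists N0, forall z, exists P : 'I_N0.+1 -> {poly F},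
  (exists c, P c != 0) /\ \sum_c (map_poly i (P c)).[y] * z ^+ c = 0.
Proof.
have [p [S [D [p0 dp dS ES]]]] := mult_matrix y.
have [P1 [s1 [P1_0 E1]]] := bP 1.
pose d1 := (\sum_j size (s1 j))%N.
have ds1 k : bnd d1 (s1 k).
  by apply: leq_trans (leqnSn _); rewrite /d1 (bigD1 k) //= leq_addr.
exists (n * D)%N => z; set N0 := (n * D)%N.
have [pz [Sz [Dz [pz0 dpz dSz ESz]]]] := mult_matrix z.
(* Each further power of [y] costs [n * D = N0] equations and brings [N0.+1] unknowns; this [X]
   absorbs the constant terms. *)
pose X := (n * (d1 + N0 * Dz).+1)%N.
pose B := (d1 + X * D + N0 * Dz)%N.
have rel_ex (ac : 'I_X.+1 * 'I_N0.+1) : exists u : 'I_n -> {poly F},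
    (forall k, bnd B (u k)) /\
    ev (pz ^+ N0 * (p ^+ X * P1)) * (z ^+ ac.2 * (y ^+ ac.1 * 1)) =
      \sum_k ev (u k) * b k.
  have [u [du Eu]] := mult_pow dp dS ES ds1 E1 (leq_ord ac.1).
  by have [w [dw Ew]] := mult_pow dpz dSz ESz du Eu (leq_ord ac.2); exists w.
have [u uP] := choice rel_ex.
have [|f [[ac fN] f0]] := @dependent_rows F ('I_X.+1 * 'I_N0.+1)%type ('I_n * 'I_B.+1)%type
   (fun ac kl => (u ac kl.1)`_kl.2).
  rewrite !card_prod !card_ord.
  have -> : (n * B.+1 = N0 * X + X)%N.
    by rewrite -[X in (_ + X)%N]/(n * (d1 + N0 * Dz).+1)%N /B /N0; ring.
  by rewrite mulSn mulnS; lia.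
exists (fun c => \poly_(a < X.+1) f (inord a, c)); split.
  exists ac.2; apply: contraNneq fN => /polyP/(_ ac.1).
  by rewrite coef_poly ltn_ord inord_val coef0 -surjective_pairing => ->.
apply/eqP; have evN0 : ev (pz ^+ N0 * (p ^+ X * P1)) != 0.
  apply/negP => /t_trans/eqP; apply/negP.
  by rewrite !mulf_neq0 ?expf_neq0.
rewrite -(mulrI_eq0 _ (mulfI evN0)); apply/eqP.
transitivity (\sum_ac0 i (f ac0) * (\sum_k ev (u ac0 k) * b k)).
  rewrite (eq_bigr (fun ac0 : 'I_X.+1 * 'I_N0.+1 => i (f ac0) *
     (ev (pz ^+ N0 * (p ^+ X * P1)) * (z ^+ ac0.2 * (y ^+ ac0.1 * 1))))); last first.
    by move=> ac0 _; rewrite (proj2 (uP ac0)).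
  rewrite (eq_bigr (fun ac0 : 'I_X.+1 * 'I_N0.+1 =>
     ev (pz ^+ N0 * (p ^+ X * P1)) * (i (f (ac0.1, ac0.2)) * y ^+ ac0.1 * z ^+ ac0.2))); last first.
    by move=> ac0 _; rewrite -surjective_pairing mulrCA mulr1 -mulrA [y ^+ _ * _]mulrC.
  rewrite -mulr_sumr -(pair_big xpredT xpredT
     (fun (a : 'I_X.+1) (c : 'I_N0.+1) => i (f (a, c)) * y ^+ a * z ^+ c)) /=.
  rewrite exchange_big; congr (_ * _); apply: eq_bigr => c _ /=.
  rewrite -mulr_suml; congr (_ * _).
  rewrite (@horner_coef_wide _ X.+1); last first.
    by rewrite size_map_poly size_poly.
  by apply: eq_bigr => a _; rewrite coef_map coef_poly ltn_ord inord_val.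
under eq_bigr => ac0 _ do rewrite mulr_sumr.
rewrite exchange_big big1 // => k _ /=.
under eq_bigr => ac0 _ do rewrite mulrA.
rewrite -mulr_suml.
suff -> : \sum_ac0 i (f ac0) * ev (u ac0 k) = 0 by rewrite mul0r.
under eq_bigr => ac0 _.
  rewrite (@horner_coef_wide _ B.+1); last first.
    by rewrite size_map_poly; case: (uP ac0) => dB _; apply: dB.
  rewrite mulr_sumr; over.
rewrite exchange_big big1 // => l _ /=.
under eq_bigr => ac0 _ do rewrite coef_map mulrA -rmorphM.
by rewrite -mulr_suml -rmorph_sum /= (f0 (k, l)) rmorph0 mul0r.
Qed.

End Relation.

Section PlaceExistence.
Context (F K : fieldType) (i : {rmorphism F -> K}) (y : K).
Hypothesis y_trans : forall p : {poly F}, root (map_poly i p) y -> p = 0.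
Local Notation ev p := ((map_poly i p).[y]).

(* A maximal ring omitting [y^-1] exists by Zorn; it is a valuation ring, and
   [bounded_relation] bounds its value group, so that it is discrete. *)
Definition omits (S : set K) : Prop :=
  [/\ forall c, S (i c), S y, forall a b, S a -> S b -> S (a + b),
      forall a b, S a -> S b -> S (a * b) & ~ S y^-1].

Lemma y_neq0 : y != 0.
Proof.
apply/eqP => y0; suff /eqP : ('X : {poly F}) = 0 by rewrite polyX_eq0.
by apply: y_trans; rewrite map_polyX /root hornerX y0.
Qed.

Lemma omits_poly : omits [set x | exists p, x = ev p].
Proof.
split.
- by move=> c; exists c%:P; rewrite map_polyC hornerC.
- by exists 'X; rewrite map_polyX hornerX.
- by move=> _ _ [p ->] [q ->]; exists (p + q); rewrite rmorphD hornerD.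
- by move=> _ _ [p ->] [q ->]; exists (p * q); rewrite rmorphM hornerM.
move=> [p yp]; have p1 : 'X * p - 1 = 0.
  apply: y_trans; rewrite rmorphB rmorphM rmorph1 /= map_polyX.
  by rewrite /root !hornerE -yp divff ?y_neq0 // subrr.
have := congr1 (fun p => p.[0]) p1; rewrite !hornerE => /eqP.
by rewrite ?mul0r ?sub0r ?add0r oppr_eq0 oner_eq0.
Qed.

Lemma omits_max : exists V, omits V /\ forall S, V `<=` S -> omits S -> S `<=` V.
Proof.
have [|V [[V0|Vg] Vmax]] := @Zorn_bigcup K (fun S => S = set0 \/ omits S).
- move=> G GP Gtot; have [[S GS Sg]|none] := pselect (exists2 S, G S & omits S); last first.
    left; rewrite -subset0 => x [S GS Sx]; case: (GP S GS) => [S0|Sg].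
      by rewrite -S0.
    by case: none; exists S.
  right; have [Sc Sy _ _ _] := Sg.
  split=> [c||a b [S1 G1 Sa] [S2 G2 Sb]|a b [S1 G1 Sa] [S2 G2 Sb]|[S1 G1]].
  + by exists S.
  + by exists S.
  + wlog S12 : a b S1 S2 G1 G2 Sa Sb / S1 `<=` S2.
      move=> W; case: (Gtot S1 S2 G1 G2) => S12; first exact: (W a b S1 S2).
      by rewrite addrC; apply: (W b a S2 S1).
    case: (GP S2 G2) => [S0|[_ _ D _ _]]; first by move: Sb; rewrite S0.
    by exists S2 => //; apply: D => //; apply: S12.
  + wlog S12 : a b S1 S2 G1 G2 Sa Sb / S1 `<=` S2.
      move=> W; case: (Gtot S1 S2 G1 G2) => S12; first exact: (W a b S1 S2).
      by rewrite mulrC; apply: (W b a S2 S1).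
    case: (GP S2 G2) => [S0|[_ _ _ M _]]; first by move: Sb; rewrite S0.
    by exists S2 => //; apply: M => //; apply: S12.
  case: (GP S1 G1) => [->//|[_ _ _ _ no]]; exact: no.
- case: (Vmax [set x | exists p, x = ev p]); last by right; apply: omits_poly.
  rewrite V0; split=> [x []|/(_ 0)]; apply.
  by exists 0; rewrite rmorph0 horner0.
exists V; split=> // S VS Sg; apply: contrapT => nSV.
by apply: (Vmax S); [split | right].
Qed.

Section Maximal.
Variable V : set K.
Hypotheses (V_omits : omits V) (V_max : forall S, V `<=` S -> omits S -> S `<=` V).

Let Vi c : V (i c). Proof. by case: V_omits. Qed.
Let Vy : V y. Proof. by case: V_omits. Qed.
Let VD a b : V a -> V b -> V (a + b). Proof. by case: V_omits => _ _ H _ _; apply: H. Qed.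
Let VM a b : V a -> V b -> V (a * b). Proof. by case: V_omits => _ _ _ H _; apply: H. Qed.
Let Vx : ~ V y^-1. Proof. by case: V_omits. Qed.
Let V0 : V 0. Proof. by rewrite -(rmorph0 i). Qed.
Let V1 : V 1. Proof. by rewrite -(rmorph1 i). Qed.
Let VN a : V a -> V (- a).
Proof. by move=> Va; rewrite -mulN1r -(rmorph1 i) -rmorphN; apply: VM. Qed.
Let VX a n : V a -> V (a ^+ n).
Proof. by move=> Va; elim: n => [|n IHn]; rewrite ?exprS //; apply: VM. Qed.
Let Vsum (I : finType) (G : I -> K) : (forall j, V (G j)) -> V (\sum_j G j).
Proof. by move=> VG; apply: (big_ind V). Qed.

Let y1N w : V w -> y * w <> 1.
Proof.
move=> Vw yw; apply: Vx; suff -> : y^-1 = w by [].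
by rewrite -[LHS]mulr1 -yw mulKf ?y_neq0.
Qed.

(** The localization of [V] at the powers of [u] still omits [y^-1], because [u ^+ n] is 1 modulo
    [y]; by maximality it is [V]. *)
Let Vunit1 v : V v -> V (1 + y * v)^-1.
Proof.
move=> Vv; set u := 1 + y * v.
have Vu : V u by apply: VD => //; apply: VM.
have uN0 : u != 0.
  apply/eqP => u0; apply: (y1N (VN Vv)).
  by rewrite mulrN; apply/eqP; rewrite eq_sym -subr_eq0 opprK -/u u0.
have uX n : exists2 w, V w & u ^+ n = 1 + y * w.
  elim: n => [|n [w Vw IHn]]; first by exists 0; rewrite // mulr0 addr0.
  exists (w + v * (1 + y * w)); last by rewrite exprS IHn /u; ring.
  by apply: VD => //; apply: VM => //; apply: VD => //; apply: VM.
pose S := [set z | exists n, V (z * u ^+ n)].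
have VS : V `<=` S by move=> z Vz; exists 0%N; rewrite mulr1.
apply: (V_max VS); last by exists 1%N; rewrite mulVf.
split=> [c||a b [n an] [m bm]|a b [n an] [m bm]|[n xn]].
- exact: VS.
- exact: VS.
- exists (n + m)%N; rewrite mulrDl exprD mulrA [u ^+ n * _]mulrC mulrA.
  by apply: VD; apply: VM => //; apply: VX.
- exists (n + m)%N; rewrite exprD mulrACA; exact: VM.
have [w Vw E] := uX n.
apply: (@y1N (y^-1 * u ^+ n - w)); first by apply: VD => //; apply: VN.
by rewrite mulrBr mulrA divff ?y_neq0 // E mul1r addrK.
Qed.

(* A relation [1 = y * p(z)] with [p] of degree at most [n] over [V]. *)
Let rel z n := exists a : nat -> K, (forall j, V (a j)) /\
  1 = \sum_(j < n.+1) y * a j * z ^+ j.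

Let rel0 z : ~ rel z 0.
Proof.
move=> [a [Va]]; rewrite big_ord1 mulr1 => /esym; exact: y1N.
Qed.

(** By maximality [V[z]] contains [y^-1]. *)
Let rel_ex z : ~ V z -> exists n, rel z n.
Proof.
move=> Vz; apply: contrapT => no.
pose S := [set w | exists p : {poly K}, (forall j, V p`_j) /\ w = p.[z]].
have VS : V `<=` S.
  by move=> w Vw; exists w%:P; rewrite hornerC; split=> // -[|j]; rewrite coefC.
apply: Vz; apply: (V_max VS); last first.
  by exists 'X; rewrite hornerX; split=> // j; rewrite coefX; case: eqP.
split=> [c||_ _ [p [Vp ->]] [q [Vq ->]]|_ _ [p [Vp ->]] [q [Vq ->]]|[p [Vp xp]]].
- exact: VS.
- exact: VS.
- by exists (p + q); rewrite hornerD; split=> // j; rewrite coefD; apply: VD.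
- exists (p * q); rewrite hornerM; split=> // j; rewrite coefM.
  by apply: Vsum => l; apply: VM.
apply: no; exists (size p), (fun j => p`_j); split=> //.
rewrite -(divff y_neq0) xp (horner_coef_wide _ (leqnSn (size p))) mulr_sumr.
by apply: eq_bigr => j _; rewrite mulrA.
Qed.

(** Since [1 - y * b 0] is a unit, the relation for [z^-1] can be solved for its constant part and
    expresses [z ^+ n.+1] by lower powers of [z]. *)
Let rel_red z n m : z != 0 -> (m <= n.+1)%N -> rel z n.+1 -> rel z^-1 m -> rel z n.
Proof.
move=> z0 mn [a [Va Ea]] [b [Vb Eb]].
pose u := (1 + y * (- b 0))^-1.
have Vu : V u by apply: Vunit1; apply: VN.
have uN0 : 1 + y * (- b 0) != 0.
  apply/eqP => u0; apply: (y1N (Vb 0)); apply/eqP.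
  by rewrite eq_sym -subr_eq0 -mulrN u0.
have zE : z ^+ n.+1 = \sum_(j < m) y * (u * b j.+1) * z ^+ (n - j).
  rewrite -[LHS](mulKf uN0) -/u.
  have {1}-> : 1 + y * - b 0 = \sum_(j < m) y * b j.+1 * z^-1 ^+ j.+1.
    rewrite [X in X + _]Eb big_ord_recl mulr1 mulrN addrAC subrr add0r.
    by apply: eq_bigr => j _; rewrite lift0.
  rewrite mulr_suml mulr_sumr; apply: eq_bigr => j _.
  have jn : (j <= n)%N by rewrite -ltnS (leq_trans (ltn_ord j)).
  have -> : z ^+ n.+1 = z ^+ (n - j) * z ^+ j.+1 by rewrite -exprD; congr (_ ^+ _); lia.
  have zj := expf_neq0 j.+1 z0.
  by rewrite exprVn; field.
exists (fun j => a j + if (n - j < m)%N then y * a n.+1 * (u * b (n - j).+1) else 0).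
split=> [j|].
  by apply: VD => //; case: ifP => // _; apply: VM; apply: VM.
under eq_bigr => j _ do rewrite mulrDr mulrDl.
rewrite big_split /= [LHS]Ea big_ord_recr /=; congr (_ + _).
rewrite zE mulr_sumr.
have -> : \sum_(j < m) y * a n.+1 * (y * (u * b j.+1) * z ^+ (n - j)) =
  \sum_(j < n.+1) if (j < m)%N then y * a n.+1 * (y * (u * b j.+1) * z ^+ (n - j)) else 0.
  rewrite (big_ord_widen _ (fun j => y * a n.+1 * (y * (u * b j.+1) * z ^+ (n - j))) mn).
  by rewrite big_mkcond.
rewrite (reindex_inj rev_ord_inj); apply: eq_bigr => j _ /=.
rewrite subSS; case: ifP => _; last by rewrite mulr0 mul0r.
by rewrite subKn ?leq_ord //; ring.
Qed.

(** Relations for both [z] and [z^-1] would be shortened by [rel_red] until one has degree 0, which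
    [rel0] excludes. *)
Let val_total z : z != 0 -> V z \/ V z^-1.
Proof.
move=> z0; apply: contrapT => /not_orP[/rel_ex[n zn] /rel_ex[m zm]].
move: {2}(n + m)%N (leqnn (n + m)) => s.
elim: s z n m z0 zn zm => [|s IHs] z n m z0 zn zm.
  by rewrite leqn0 addn_eq0 => /andP[/eqP n0 _]; move: zn; rewrite n0; apply: rel0.
wlog mn : z n m z0 zn zm / (m <= n)%N.
  move=> W; case/orP: (leq_total m n) => mn; first exact: (W z n m).
  by rewrite addnC; apply: (W z^-1 m n); rewrite ?invr_eq0 ?invrK.
case: n zn mn => [|n] zn mn; first by case: (rel0 zn).
by rewrite addSn ltnS; apply: IHs z0 (rel_red z0 mn zn zm) zm.
Qed.

Let vunit z := [/\ z != 0, V z & V z^-1].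

Let vunitM z w : vunit z -> vunit w -> vunit (z * w).
Proof.
move=> [z0 Vz Vz'] [w0 Vw Vw']; split; rewrite ?mulf_neq0 //; first exact: VM.
by rewrite invfM; apply: VM.
Qed.

Let vunitV z : vunit z -> vunit z^-1.
Proof. by move=> [z0 Vz Vz']; split; rewrite ?invr_eq0 ?invrK. Qed.

Let vunit1 : vunit 1.
Proof. by split; rewrite ?oner_eq0 ?invr1. Qed.

Let vunitX z n : vunit z -> vunit (z ^+ n).
Proof. by move=> uz; elim: n => [|n IHn]; rewrite ?exprS //; apply: vunitM. Qed.

Let vunit_i c : c != 0 -> vunit (i c).
Proof. by move=> c0; split; rewrite ?fmorph_eq0 -?fmorphV. Qed.

Let vunit_opp z : vunit z -> vunit (- z).
Proof.
by move=> [z0 Vz Vz']; split; rewrite ?oppr_eq0 ?invrN //; apply: VN.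
Qed.

Let nonunitD a b : V a -> V b -> ~ vunit a -> ~ vunit b -> ~ vunit (a + b).
Proof.
wlog ab : a b / V (a / b).
  move=> W Va Vb na nb; have [->|b0] := eqVneq b 0; first by rewrite addr0.
  have [->|a0] := eqVneq a 0; first by rewrite add0r.
  have /val_total[ab|] : a / b != 0 by rewrite mulf_neq0 ?invr_eq0.
    exact: W.
  by rewrite invf_div addrC => ba; apply: W.
move=> Va Vb na nb [s0 Vs Vs']; have [b0|b0] := eqVneq b 0.
  by move: s0 Vs Vs'; rewrite b0 addr0 => s0 Vs Vs'; apply: na.
apply: nb; split=> //.
have E : b^-1 = (a / b + 1) * (a + b)^-1.
  by field; rewrite b0 s0.
by rewrite E; apply: VM => //; apply: VD.
Qed.

Let nonunit_sum (I : finType) (P : pred I) (G : I -> K) :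
  (forall j, P j -> V (G j) /\ ~ vunit (G j)) -> ~ vunit (\sum_(j | P j) G j).
Proof.
move=> GP; suff [] : V (\sum_(j | P j) G j) /\ ~ vunit (\sum_(j | P j) G j) by [].
apply: (big_ind (fun z => V z /\ ~ vunit z)) => //.
  by split=> // -[]; rewrite eqxx.
by move=> a b [Va na] [Vb nb]; split; [apply: VD | apply: nonunitD].
Qed.

Let minval (I : finType) (G : I -> K) : (exists j, G j != 0) ->
  exists j, G j != 0 /\ forall l, V (G l / G j).
Proof.
have : forall s : seq I, (exists2 j, j \in s & G j != 0) ->
    exists j, G j != 0 /\ forall l, l \in s -> V (G l / G j).
  elim=> [[]//|j s IHs] ex.
  have [[l ls Gl]|no] := pselect (exists2 l, l \in s & G l != 0); last first.
    have sG l : l \in s -> G l = 0.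
      by move=> ls; apply: contrapT => /eqP Gl; apply: no; exists l.
    have Gj : G j != 0.
      case: ex => l; rewrite inE => /orP[/eqP-> //|ls].
      by rewrite sG ?eqxx.
    exists j; split=> // l; rewrite inE => /orP[/eqP->|ls].
      by rewrite divff.
    by rewrite sG // mul0r.
  have [|l' [Gl' Vl]] := IHs; first by exists l.
  move: {l ls Gl} l' Gl' Vl => l Gl Vl.
  have [Gj|Gj] := eqVneq (G j) 0.
    exists l; split=> // m; rewrite inE => /orP[/eqP->|]; last exact: Vl.
    by rewrite Gj mul0r.
  have /val_total[jl|] : G j / G l != 0 by rewrite mulf_neq0 ?invr_eq0.
    by exists l; split=> // m; rewrite inE => /orP[/eqP->//|]; apply: Vl.
  rewrite invf_div => lj; exists j; split=> // m; rewrite inE => /orP[/eqP->|ms].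
    by rewrite divff.
  have -> : G m / G j = G m / G l * (G l / G j) by field; rewrite Gl Gj.
  by apply: VM => //; apply: Vl.
move=> H [j Gj]; have [|l [Gl Vl]] := H (enum I); first by exists j; rewrite ?mem_enum.
by exists l; split=> // m; apply: Vl; rewrite mem_enum.
Qed.

(** In a vanishing sum the least valuation occurs twice; otherwise dividing by the term of least
    valuation would make [-1] a sum of nonunits. *)
Let sum0_units (I : finType) (G : I -> K) : (exists j, G j != 0) ->
  \sum_j G j = 0 -> exists j l, [/\ j != l, G j != 0 & vunit (G l / G j)].
Proof.
move=> /minval[j [Gj VG]] G0; apply: contrapT => no.
have nu : ~ vunit (\sum_(l | l != j) G l / G j).
  apply: nonunit_sum => l lj; split=> // ul; apply: no.
  by exists j, l; split=> //; rewrite eq_sym.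
apply: nu; have -> : \sum_(l | l != j) G l / G j = -1.
  move/(congr1 (fun z => z / G j)): G0; rewrite (bigD1 j) //= mulrDl divff //.
  by rewrite mul0r mulr_suml addrC => /eqP; rewrite addr_eq0 => /eqP.
exact: vunit_opp.
Qed.

(** Factor out the largest power of [X]; what remains is a nonzero constant times an element
    [1 + y * v]. *)
Let ev_unit p : p != 0 -> exists k u, vunit u /\ ev p = y ^+ k * u.
Proof.
have [n] := ubnP (size p); elim: n p => // n IHn p pn p0.
have [c c0] : {c | c = p`_0} by exists p`_0.
have VP (q : {poly F}) : V (ev q).
  rewrite horner_coef; apply: Vsum => j; rewrite coef_map.
  by apply: VM; [apply: Vi | apply: VX].
have [q Ep] : exists q, p = q * 'X + c%:P.
  elim/poly_ind: p c0 {pn p0} => [|q d _] /=; first by move=> ->; exists 0; rewrite coef0 mul0r add0r.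
  by rewrite coefD coefMX coefC /= add0r => ->; exists q.
have [c00|cN0] := eqVneq c 0; last first.
  exists 0%N, (ev p); rewrite mul1r; split=> //.
  have -> : ev p = i c * (1 + y * (i c^-1 * ev q)).
    have -> : ev p = ev q * y + i c.
      by rewrite Ep rmorphD rmorphM /= map_polyX map_polyC !hornerE.
    have ic : i c != 0 by rewrite fmorph_eq0.
    by rewrite mulrDr mulr1 [y * _]mulrC fmorphV -mulrA mulVKf // addrC.
  have V' : V (i c^-1 * ev q) by apply: VM.
  apply: vunitM; first exact: vunit_i.
  split; [|by apply: VD => //; apply: VM|exact: Vunit1].
  by apply/eqP => /eqP; rewrite addr_eq0 eq_sym => /eqP E; apply: (y1N (VN V')); rewrite mulrN E.
have q0 : q != 0.
  by apply: contraNneq p0 => q0; rewrite Ep q0 c00 mul0r add0r.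
have [||k [u [uu E]]] := IHn q => //.
  by move: pn; rewrite Ep c00 addr0 size_mulX.
exists k.+1, u; split=> //; rewrite Ep c00 addr0 rmorphM /= map_polyX hornerMX E.
by rewrite exprSr mulrAC.
Qed.

Context (t : K) (t_trans : forall p : {poly F}, root (map_poly i p) t -> p = 0).
Context (n : nat) (b : 'I_n -> K).
Hypothesis bP : forall x, exists (p : {poly F}) (s : 'I_n -> {poly F}),
  p != 0 /\ (map_poly i p).[t] * x = \sum_j (map_poly i (s j)).[t] * b j.

Let yX_unit (k : int) : vunit (y ^ k) -> k = 0.
Proof.
have aux (k' : nat) : ~ vunit (y ^+ k'.+1).
  move=> [_ _ Vk]; apply: Vx.
  have -> : y^-1 = y ^+ k' * (y ^+ k'.+1)^-1.
    by rewrite exprSr invfM mulrA mulfV ?mul1r ?expf_neq0 // y_neq0.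
  by apply: VM => //; apply: VX.
case: k => [[|k]|k] //.
  by rewrite -exprnP => /aux.
by rewrite NegzE -exprnN => /vunitV; rewrite invrK => /aux.
Qed.

(** Two terms of the relation have equal valuation, so that some [z ^+ e] with [0 < e <= N0] is a
    power of [y] up to a unit. The factorial serves all these [e] at once, and hence every [z]. *)
Let ordN_ex : exists N : nat, (0 < N)%N /\ forall z, z != 0 ->
  exists k : int, vunit (z ^+ N / y ^ k).
Proof.
have [N0 N0P] := bounded_relation t_trans bP y.
exists N0`!; split=> [|z z0]; first exact: fact_gt0.
have [P [Pne PE]] := N0P z.
have [|c [d [cd Tc]]] := sum0_units _ PE.
  case: Pne => c Pc; exists c; rewrite mulf_neq0 ?expf_neq0 //.
  by apply: contra Pc => /y_trans->.
move: Tc; rewrite mulf_eq0 expf_eq0 (negbTE z0) andbF orbF => Pc [T0 VT VT'].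
have Pd : ev (P d) != 0.
  by apply: contraNneq T0 => ->; rewrite !mul0r.
have [|kc [uc [uuc Ec]]] := @ev_unit (P c).
  by apply: contraNneq Pc => ->; rewrite rmorph0 horner0.
have [|kd [ud [uud Ed]]] := @ev_unit (P d).
  by apply: contraNneq Pd => ->; rewrite rmorph0 horner0.
have yk0 k := expf_neq0 k y_neq0.
have uc0 : uc != 0 by case: uuc.
have ud0 : ud != 0 by case: uud.
have zk (e : nat) (k : int) : (0 < e <= N0)%N -> vunit (z ^+ e / y ^ k) ->
    exists k : int, vunit (z ^+ N0`! / y ^ k).
  move=> eN uz; have /dvdnP[q ->] : (e %| N0`!)%N by rewrite dvdn_fact.
  exists (k * q%:Z); rewrite mulnC exprM -exprz_exp -exprnP -exprVn -exprMn.
  exact: vunitX.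
have H (c1 d1 : 'I_N0.+1) k1 l1 : (c1 < d1)%N ->
   vunit (y ^+ k1 * z ^+ d1 / (y ^+ l1 * z ^+ c1)) -> exists k : int, vunit (z ^+ N0`! / y ^ k).
  move=> cd1 u1; apply: (@zk (d1 - c1)%N (l1%:Z - k1%:Z)).
    by rewrite subn_gt0 cd1 (leq_trans (leq_subr _ _)) ?leq_ord.
  rewrite expfzDr ?y_neq0 // -exprnP -exprnN.
  suff -> : z ^+ (d1 - c1) / (y ^+ l1 * y ^- k1) = y ^+ k1 * z ^+ d1 / (y ^+ l1 * z ^+ c1) by [].
  rewrite -[in RHS](subnK (ltnW cd1)) exprD.
  by have h0 := yk0 k1; have h1 := yk0 l1; have h2 := expf_neq0 c1 z0; field; rewrite ?h0 ?h1 ?h2.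
have U : vunit (y ^+ kd * z ^+ d / (y ^+ kc * z ^+ c)).
  have -> : y ^+ kd * z ^+ d / (y ^+ kc * z ^+ c) =
    ev (P d) * z ^+ d / (ev (P c) * z ^+ c) * (uc / ud).
    by rewrite Ec Ed; have h0 := yk0 kc; have h1 := uc0; have h2 := ud0; have h3 := expf_neq0 c z0; field; rewrite ?h0 ?h1 ?h2 ?h3.
  by apply: vunitM => //; apply: vunitM => //; apply: vunitV.
case: (ltngtP c d) => cd'; first exact: H U.
  apply: (H d c kc kd) => //.
  by rewrite -invf_div; apply: vunitV.
by case/eqP: cd; apply: val_inj.
Qed.

Lemma maximal_place : exists P : place i, 0 < P y.
Proof.
have [N [N_gt0 NP]] := ordN_ex.
have /choice[o oP] : forall z, exists k : int, z != 0 -> vunit (z ^+ N / y ^ k).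
  move=> z; have [->|z0] := eqVneq z 0; first by exists 0.
  by have [k kP] := NP z z0; exists k.
have yz0 k : y ^ k != 0 by rewrite expfz_neq0 ?y_neq0.
have oE z k : z != 0 -> vunit (z ^+ N / y ^ k) -> o z = k.
  move=> z0 zk; apply/eqP; rewrite -subr_eq0; apply/eqP/yX_unit.
  rewrite expfzDr ?y_neq0 // -invr_expz.
  suff -> : y ^ o z * (y ^ k)^-1 = z ^+ N / y ^ k * (z ^+ N / y ^ o z)^-1.
    by apply: vunitM => //; apply: vunitV; apply: oP.
  by have h0 := yz0 k; have h1 := yz0 (o z); have h2 := expf_neq0 N z0; field; rewrite ?h0 ?h1 ?h2.
have oM z w : z != 0 -> w != 0 -> o (z * w) = o z + o w.
  move=> z0 w0; apply: oE; rewrite ?mulf_neq0 //.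
  rewrite expfzDr ?y_neq0 // exprMn invfM mulrACA.
  by apply: vunitM; apply: oP.
have oy : o y = N%:Z.
  by apply: oE; rewrite ?y_neq0 // -exprnP divff ?expf_neq0 ?y_neq0.
have oV z : z != 0 -> V z <-> 0 <= o z.
  move=> z0; have [u0 Vu Vu'] := oP z z0; split=> [Vz|].
    rewrite leNgt; apply/negP => oz; apply: Vx.
    move: Vu Vu'; case: (o z) oz => // k _; rewrite NegzE -exprnN invrK => Vu Vu'.
    have -> : y^-1 = z ^+ N * y ^+ k * (z ^+ N * y ^+ k.+1)^-1.
      by rewrite exprS; have h0 := y_neq0; have h1 := expf_neq0 k y_neq0; have h2 := expf_neq0 N z0; field; rewrite ?h0 ?h1 ?h2.
    by apply: VM => //; apply: VM; apply: VX.
  move: Vu; case: (o z) => // k; rewrite -exprnP => Vu _.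
  have Vz : V (z ^+ N).
    by rewrite -[z ^+ N](divfK (expf_neq0 k y_neq0)); apply: VM => //; apply: VX.
  have [//|Vz'] := val_total z0.
  rewrite -(prednK N_gt0) exprSr in Vz.
  have -> : z = z ^+ N.-1 * z * z^-1 ^+ N.-1.
    by rewrite exprVn mulrAC mulfV ?mul1r ?expf_neq0.
  by apply: VM => //; apply: VX.
have oD z w : z != 0 -> w != 0 -> z + w != 0 -> Num.min (o z) (o w) <= o (z + w).
  wlog zw : z w / V (z / w).
    move=> W z0 w0 zw0.
    have /val_total[zw|] : z / w != 0 by rewrite mulf_neq0 ?invr_eq0.
      exact: W.
    by rewrite invf_div addrC minC => wz; apply: W; rewrite // addrC.
  move=> z0 w0 zw0; rewrite ge_min; apply/orP; right.
  have -> : z + w = (z / w + 1) * w by field.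
  have s0 : z / w + 1 != 0.
    by apply: contraNneq zw0 => s0; rewrite -[z](divfK w0) -[X in _ + X]mul1r -mulrDl s0 mul0r.
  by rewrite oM // lerDr; apply/oV => //; apply: VD.
have o1 z k : z != 0 -> o (z ^+ k) = o z *+ k.
  move=> z0; elim: k => [|k IHk].
    by rewrite expr0 mulr0n; apply: oE; rewrite ?oner_eq0 // expr1n expr0z divr1.
  by rewrite exprS oM ?expf_neq0 // IHk mulrS.
have oVi z : z != 0 -> o z^-1 = - o z.
  move=> z0; have := oM z z^-1 z0; rewrite invr_eq0 mulfV // => /(_ z0).
  have -> : o 1 = 0 by rewrite -(expr0 z) o1.
  by move/esym/eqP; rewrite addrC addr_eq0 => /eqP.
(* The values of [o] form a subgroup of the integers; dividing by its least positive element [g]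
   yields a uniformizer. *)
have gex : exists g : nat, (0 < g)%N && `[< exists2 z, z != 0 & o z = g%:Z >].
  by exists N; rewrite N_gt0; apply/asboolP; exists y; rewrite ?y_neq0.
have [g /andP[g_gt0 /asboolP[z1 z10 oz1]] gmin] := ex_minnP gex.
have gZ : g%:Z != 0 by rewrite lt0r_neq0.
have gdvd z : z != 0 -> (g %| o z)%Z.
  move=> z0; apply/dvdz_mod0P; set r := (o z %% g)%Z.
  have r_ge0 : 0 <= r by apply: modz_ge0.
  have r_lt : r < g by rewrite ltz_pmod.
  have oExp (k : int) : o (z1 ^ k) = k * g%:Z.
    case: k => k; first by rewrite -exprnP o1 // oz1 -mulr_natl natz.
    by rewrite NegzE -exprnN oVi ?expf_neq0 // o1 // oz1 -mulr_natl natz mulNr.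
  have ow : o (z * z1 ^ (- (o z %/ g)%Z)) = r.
    rewrite oM ?expfz_neq0 // oExp mulNr.
    by rewrite {1}[o z](divz_eq _ g) addrAC subrr add0r.
  case: (ltgtP r 0) => [r_neg|r_gt|//].
    by rewrite ltNge r_ge0 in r_neg.
  have rE : r = `|r|%N%:Z by rewrite gez0_abs.
  suff : (g <= `|r|)%N by rewrite -lez_nat -rE leNgt r_lt.
  apply: gmin; rewrite absz_gt0 gt_eqF //=; apply/asboolP.
  exists (z * z1 ^ (- (o z %/ g)%Z)); last by rewrite ow.
  by rewrite mulf_neq0 ?expfz_neq0.
pose P z := if z == 0 then 0 else (o z %/ g)%Z.
have PE z : z != 0 -> P z * g%:Z = o z.
  by move=> z0; rewrite /P (negbTE z0); apply/divzK/gdvd.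
have g0 : 0 < g%:Z :> int by [].
have H0 : P 0 = 0 by rewrite /P eqxx.
have HM x z : x != 0 -> z != 0 -> P (x * z) = P x + P z.
  move=> x0 z0; apply: (mulIf gZ).
  by rewrite mulrDl !PE ?mulf_neq0 ?oM.
have HD x z : x != 0 -> z != 0 -> x + z != 0 -> Num.min (P x) (P z) <= P (x + z).
  move=> x0 z0 xz0; rewrite -(ler_pM2r g0) minr_pMl; last exact: ltW.
  by rewrite !PE // oD.
have Hc c : P (i c) = 0.
  have [->|c0] := eqVneq c 0; first by rewrite rmorph0.
  apply: (mulIf gZ); rewrite mul0r PE ?fmorph_eq0 //.
  by apply: oE; rewrite ?fmorph_eq0 // expr0z divr1; apply/vunitX/vunit_i.
have Hu : exists x, P x = 1.
  by exists z1; apply: (mulIf gZ); rewrite mul1r PE.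
exists (Place H0 HM HD Hc Hu) => /=.
by rewrite -(pmulr_lgt0 _ g0) PE ?y_neq0 // oy.
Qed.

End Maximal.
End PlaceExistence.

(** Applied to the inverse of a function, this zero of [y] is a pole. *)
Lemma place_pole (F K : fieldType) (i : {rmorphism F -> K}) (t : K) n (b : 'I_n -> K) (y : K) :
  (forall p : {poly F}, root (map_poly i p) t -> p = 0) ->
  (forall x, exists (p : {poly F}) (s : 'I_n -> {poly F}),
    p != 0 /\ (map_poly i p).[t] * x = \sum_j (map_poly i (s j)).[t] * b j) ->
  (forall p : {poly F}, root (map_poly i p) y -> p = 0) ->
  exists P : place i, 0 < P y.
Proof.
move=> tT bP yT; have [V [Vg Vmax]] := omits_max yT.
exact: (maximal_place yT Vg Vmax tT bP).
Qed.

(** * The coordinate ring at the point at infinity *)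

Section PlaceTheory.
Context (k K : fieldType) (i : {rmorphism k -> K}) (P : place i).

Lemma place1 : P 1 = 0.
Proof. by rewrite -(rmorph1 i) ord_const. Qed.

Lemma placeN x : P (- x) = P x.
Proof.
have [->|x0] := eqVneq x 0; first by rewrite oppr0.
rewrite -mulN1r ordM ?oppr_eq0 ?oner_eq0 //.
by rewrite -(rmorph1 i) -rmorphN ord_const add0r.
Qed.

Lemma placeX x n : x != 0 -> P (x ^+ n) = P x *+ n.
Proof.
move=> x0; elim: n => [|n IHn]; first by rewrite expr0 place1.
by rewrite exprS ordM ?expf_neq0 // IHn mulrS.
Qed.

Lemma placeV x : P x^-1 = - P x.
Proof.
have [->|x0] := eqVneq x 0; first by rewrite invr0 Defs.ord0 oppr0.
apply/eqP; rewrite -addr_eq0 addrC -ordM ?invr_eq0 //.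
by rewrite mulfV // place1.
Qed.

Lemma placeXz x (n : int) : x != 0 -> P (x ^ n) = P x * n.
Proof.
move=> x0; case: n => n; first by rewrite -exprnP placeX // -mulr_natr natz.
by rewrite NegzE -exprnN placeV placeX // -mulr_natr natz mulrN.
Qed.

Lemma place_surj (n : int) : exists2 x, x != 0 & P x = n.
Proof.
have [u uP] := ord_uniformizer P.
have u0 : u != 0 by apply/eqP => u0; move: uP; rewrite u0 Defs.ord0.
by exists (u ^ n); rewrite ?expfz_neq0 // placeXz // uP mul1r.
Qed.

(* Unlike [n <= P x], this is the expected condition when [x = 0]. *)
Definition vge (n : int) x := (x == 0) || (n <= P x).

Lemma vge0 n : vge n 0. Proof. by rewrite /vge eqxx. Qed.

Lemma vgeE n x : x != 0 -> vge n x = (n <= P x).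
Proof. by rewrite /vge => /negbTE->. Qed.

Lemma vgeD n x y : vge n x -> vge n y -> vge n (x + y).
Proof.
have [->|x0] := eqVneq x 0; first by rewrite add0r.
have [->|y0] := eqVneq y 0; first by rewrite addr0.
rewrite (vgeE _ x0) (vgeE _ y0) => nx ny.
case: (eqVneq (x + y) 0) => [->|xy0]; first exact: vge0.
rewrite vgeE //; apply: le_trans (ordD P x0 y0 xy0).
by rewrite le_min nx.
Qed.

Lemma vgeM m n x y : vge m x -> vge n y -> vge (m + n) (x * y).
Proof.
have [->|x0] := eqVneq x 0; first by move=> *; rewrite mul0r vge0.
have [->|y0] := eqVneq y 0; first by move=> *; rewrite mulr0 vge0.
by rewrite !vgeE ?mulf_neq0 // ordM //; apply: lerD.
Qed.

Lemma vge_const c : vge 0 (i c).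
Proof. by rewrite /vge ord_const lexx orbT. Qed.

Lemma vge1 : vge 0 1. Proof. by rewrite -(rmorph1 i) vge_const. Qed.

Lemma vgeN n x : vge n (- x) = vge n x.
Proof. by rewrite /vge oppr_eq0 placeN. Qed.

Lemma vge_sum (I : Type) (r : seq I) (Q : pred I) (G : I -> K) n :
  (forall j, Q j -> vge n (G j)) -> vge n (\sum_(j <- r | Q j) G j).
Proof. by move=> nG; apply: (big_ind (vge n) (vge0 n) (@vgeD n)). Qed.

Lemma place_dom x y : x != 0 -> vge (P x + 1) y -> x + y != 0 /\ P (x + y) = P x.
Proof.
move=> x0 xy; have [->|y0] := eqVneq y 0; first by rewrite addr0.
move: xy; rewrite vgeE // => xy.
have s0 : x + y != 0.
  apply/eqP => /eqP; rewrite addr_eq0 => /eqP xE.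
  by move: xy; rewrite xE placeN gerDl ler10.
split=> //; apply/le_anti/andP; split.
  have := ordD P s0 (_ : - y != 0); rewrite oppr_eq0 addrK placeN => /(_ y0 x0).
  by rewrite ge_min => /orP[//|yx]; move: (le_trans xy yx); rewrite gerDl ler10.
apply: le_trans (ordD P x0 y0 s0); rewrite le_min lexx /=.
by apply: le_trans xy; rewrite lerDl.
Qed.

End PlaceTheory.

Section CoordRing.
Context (F : finFieldType) (C : curve F) (oo : place (const C)).
Hypothesis oo_rational : rational_place oo.
Context (A : coordRing oo).

Lemma coord_fun_eq0 (a : A) : (coord_fun A a == 0) = (a == 0).
Proof. by rewrite -(inj_eq (@coord_fun_inj _ _ _ A)) rmorph0. Qed.

(** A nonzero function vanishing at [oo] is not constant, so that it has a pole; that pole lies away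
    from [oo], where [a] is regular. *)
Lemma regular_zero_at_oo (a : A) : 0 < oo (coord_fun A a) -> a = 0.
Proof.
move=> oa; apply/eqP; rewrite -coord_fun_eq0; set x := coord_fun A a in oa *.
have [//|x0] := eqVneq x 0.
have [t [tT [n [b bP]]]] := funField_trdeg1 C.
have yT (p : {poly F}) : root (map_poly (const C) p) x^-1 -> p = 0.
  move=> px; apply/eqP; apply: contraT => p0.
  have [c cE] : exists c, x^-1 = const C c by apply: funField_const; exists p.
  have := placeV oo x; rewrite cE ord_const => /eqP.
  by rewrite eq_sym oppr_eq0 gt_eqF.
have [P] := place_pole tT bP yT; rewrite placeV oppr_gt0 => Px.
have xreg : regular_away oo x by apply/coord_funP; exists a.
have := xreg P; rewrite leNgt Px => /(_ _)/negP; case=> //.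
by exists x => E; move: oa; rewrite -E ltNge ltW.
Qed.

(** The degree on [A]. Orders at [oo] are never positive, so that the absolute value loses nothing;
    zero gets degree 0. *)
Definition pole_order (a : A) := `|oo (coord_fun A a)|%N.
Local Notation deg := pole_order.

Lemma ord_coord (a : A) : oo (coord_fun A a) = - (deg a)%:Z.
Proof.
have [oa|oa] := leP (oo (coord_fun A a)) 0; first by rewrite /pole_order lez0_abs // opprK.
by rewrite /pole_order (regular_zero_at_oo oa) rmorph0 Defs.ord0.
Qed.

(** Rationality of [oo] gives the quotient of [x] by [z] a residue in [F]. Equality is a separate
    case because zero has degree 0, which is not less than every degree. *)
Lemma leading_coeff (x z : A) : x != 0 -> z != 0 -> deg x = deg z ->
  exists c, x = coord_const A c * z \/ (deg (x - coord_const A c * z)%R < deg x)%N.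
Proof.
move=> x0 z0 xz; have fx0 : coord_fun A x != 0 by rewrite coord_fun_eq0.
have fz0 : coord_fun A z != 0 by rewrite coord_fun_eq0.
have [|c cP] := oo_rational (x := coord_fun A x / coord_fun A z).
  by rewrite ordM ?invr_eq0 // placeV !ord_coord xz subrr.
exists c; case: cP => [E|oE].
  left; apply: (@coord_fun_inj _ _ _ A).
  by rewrite rmorphM coord_fun_const -E divfK.
have [->|u0] := eqVneq x (coord_const A c * z); first by left.
right; set u := x - _; have uE : coord_fun A u = (coord_fun A x / coord_fun A z - const C c) * coord_fun A z.
  by rewrite mulrBl divfK // rmorphB rmorphM coord_fun_const.
have v0 : coord_fun A x / coord_fun A z - const C c != 0.
  by apply: contraTneq oE => ->; rewrite Defs.ord0.
have := congr1 oo uE; rewrite ordM // !ord_coord -xz.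
rewrite -(ltz_nat (deg u)) => E.
by rewrite -ltrN2 E ltrDr.
Qed.

(** Division with remainder by degree. In each class of degrees modulo the degree [n] of [a],
    [g rho] has least degree; subtracting a constant times [a ^+ j * g rho] cancels the leading
    term. Thus the combinations of the [g rho] over the finite field [F] represent all classes
    modulo [a]. *)
Lemma principal_quotient_finite (a : A) : a != 0 ->
  exists (T : finType) (f : T -> A), forall x, exists u y, x = f u + y * a.
Proof.
(* In degree 0, [a] is a constant, hence a unit. *)
move=> a0; have [n0|n_gt0] := posnP (deg a).
  have [|c [E|]] := leading_coeff a0 (oner_neq0 A).
  - by rewrite n0 /pole_order rmorph1 place1.
  - exists unit, (fun=> 0) => x; exists tt, (x * coord_const A c^-1).
    have c0 : c != 0 by apply: contraNneq a0 => c0; rewrite E c0 rmorph0 mul0r.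
    by rewrite add0r E mulr1 -mulrA -rmorphM mulVf // rmorph1 mulr1.
  by rewrite n0 ltn0.
set n := deg a in n_gt0.
have degM (x z : A) : x != 0 -> z != 0 -> deg (x * z)%R = (deg x + deg z)%N.
  move=> x0 z0; apply/eqP; rewrite -eqz_nat PoszD -eqr_opp opprD -!ord_coord.
  by rewrite rmorphM ordM ?coord_fun_eq0.
have AM (x z : A) : x != 0 -> z != 0 -> x * z != 0.
  by rewrite -!coord_fun_eq0 rmorphM => x0 z0; apply: mulf_neq0.
have aX j : a ^+ j != 0 /\ deg (a ^+ j)%R = (j * n)%N.
  elim: j => [|j [j0 jn]]; first by rewrite expr0 oner_eq0 /pole_order rmorph1 place1.
  by rewrite exprS AM // degM // jn mulSn.
have /choice[g gP] (rho : 'I_n) : exists g : A, forall x : A, x != 0 ->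
    (deg x %% n)%N = rho -> [/\ g != 0, (deg g %% n)%N = rho & (deg g <= deg x)%N].
  have [[x0 x0N x0r]|no] := pselect (exists2 x : A, x != 0 & (deg x %% n)%N = rho); last first.
    by exists 0 => x xN xr; case: no; exists x.
  have ex : exists m, `[< exists x : A, [/\ x != 0, (deg x %% n)%N = rho & deg x = m] >].
    by exists (deg x0); apply/asboolP; exists x0.
  have [m /asboolP[g [g0 gr gm]] min] := ex_minnP ex.
  exists g => x xN xr; split=> //; rewrite gm; apply: min.
  by apply/asboolP; exists x.
exists {ffun 'I_n -> F}, (fun c : {ffun 'I_n -> F} => \sum_rho coord_const A (c rho) * g rho) => x.
have [d] := ubnP (deg x); elim: d x => // d IHd x xd.
have [->|x0] := eqVneq x 0.
  exists [ffun=> 0], 0; rewrite mul0r addr0 big1 // => rho _.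
  by rewrite ffunE rmorph0 mul0r.
pose rho := Ordinal (ltn_pmod (deg x) n_gt0).
have [g0 gr gx] := gP rho x x0 erefl.
have [j xE] : exists j, deg x = (j * n + deg (g rho))%N.
  exists ((deg x - deg (g rho)) %/ n)%N; rewrite divnK ?subnK //.
  by rewrite -eqn_mod_dvd // eq_sym; apply/eqP; rewrite gr.
have [aj0 ajn] := aX j.
have z0 : a ^+ j * g rho != 0 by apply: AM.
have [|c cP] := leading_coeff x0 z0; first by rewrite degM // ajn.
have [u [y xcE]] : exists (u : {ffun 'I_n -> F}) y, x - coord_const A c * (a ^+ j * g rho) =
    \sum_rho coord_const A (u rho) * g rho + y * a.
  case: cP => [->|lt]; last by apply: IHd; apply: leq_trans lt _.
  rewrite subrr; exists [ffun=> 0], 0; rewrite mul0r addr0 big1 // => r _.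
  by rewrite ffunE rmorph0 mul0r.
move/eqP: xcE; rewrite subr_eq => /eqP ->.
(* For [j = 0] the subtracted term belongs to the remainder; otherwise it is a multiple of [a]. *)
case: j {xE aj0 ajn z0 cP} => [|j].
  exists [ffun r => u r + if r == rho then c else 0], y.
  rewrite expr0 mul1r addrAC; congr (_ + _).
  under [RHS]eq_bigr => r _ do rewrite ffunE rmorphD mulrDl.
  rewrite big_split /=; congr (_ + _); rewrite (bigD1 rho) //= eqxx big1 ?addr0 // => r.
  by move/negbTE->; rewrite rmorph0 mul0r.
exists u, (y + coord_const A c * (a ^+ j * g rho)).
by rewrite -addrA mulrDl exprS; congr (_ + (_ + _)); ring.
Qed.

End CoordRing.

(** * Tensor products, ideals and completions *)

(* [T] as an [F]-module: the universal property of [T] is applied to the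
   submodule of the sums of pure tensors. *)
Definition tensor_carrier (F A T : comNzRingType) (fA : {rmorphism F -> A})
  (iA : {rmorphism A -> T}) : Type := T.

Section TensorModule.
Context (F A T : comNzRingType) (fA : {rmorphism F -> A}) (iA : {rmorphism A -> T}).
Local Notation TM := (tensor_carrier fA iA).
HB.instance Definition _ := GRing.Zmodule.copy TM T.
Let sc (c : F) (x : TM) : TM := (iA (fA c) : T) * (x : T).
Lemma tensor_scaleA a b v : sc a (sc b v) = sc (a * b) v.
Proof. by rewrite /sc !rmorphM mulrA. Qed.
Lemma tensor_scale1 v : sc 1 v = v.
Proof. by rewrite /sc !rmorph1 mul1r. Qed.
Lemma tensor_scaleDr c : {morph sc c : x y / x + y}.
Proof. by move=> x y; apply: mulrDr. Qed.
Lemma tensor_scaleDl v : {morph sc^~ v : a b / a + b}.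
Proof. by move=> a b; rewrite /sc !rmorphD mulrDl. Qed.
HB.instance Definition _ := GRing.Zmodule_isLmodule.Build F TM
  tensor_scaleA tensor_scale1 tensor_scaleDr tensor_scaleDl.

Context (L : comNzRingType) (iL : {rmorphism L -> T}).

Definition tensor_sums (x : T) : Prop := exists n (a : 'I_n -> A) (b : 'I_n -> L),
  x = \sum_k iA (a k) * iL (b k).

Lemma tensor_sums0 : tensor_sums 0.
Proof. by exists 0%N, (fun=> 0), (fun=> 0); rewrite big_ord0. Qed.

Lemma tensor_sumsD x y : tensor_sums x -> tensor_sums y -> tensor_sums (x + y).
Proof.
move=> [n [a [b ->]]] [m [a' [b' ->]]].
exists (n + m)%N, (fun k : 'I_(n + m) => match fintype.split k with inl j => a j | inr j => a' j end),
  (fun k : 'I_(n + m) => match fintype.split k with inl j => b j | inr j => b' j end).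
rewrite big_split_ord /=; congr (_ + _); apply: eq_bigr => k _.
  by rewrite -[lshift m k]/(unsplit (inl k)) !unsplitK.
by rewrite -[rshift n k]/(unsplit (inr k)) !unsplitK.
Qed.

Lemma tensor_sumsZ a x : tensor_sums x -> tensor_sums (iA a * x).
Proof.
move=> [n [b [c ->]]]; exists n, (fun k => a * b k), c.
by rewrite mulr_sumr; apply: eq_bigr => k _; rewrite rmorphM mulrA.
Qed.

Definition tensor_sumsb : {pred TM} := fun x => `[< tensor_sums x >].

Lemma tensor_sums_submod : submod_closed tensor_sumsb.
Proof.
split=> [|c x y /asboolP xP /asboolP yP]; first exact/asboolP/tensor_sums0.
by apply/asboolP/tensor_sumsD => //; apply: tensor_sumsZ.
Qed.
HB.instance Definition _ := GRing.isSubmodClosed.Build F TM tensor_sumsb tensor_sums_submod.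

Definition tensor_sub := {x : TM | tensor_sumsb x}.
HB.instance Definition _ := [isSub of tensor_sub for @sval _ _].
HB.instance Definition _ := [Choice of tensor_sub by <:].
HB.instance Definition _ := [SubChoice_isSubLmodule of tensor_sub by <:].

End TensorModule.

(** The identity, and the lift into the submodule followed by its inclusion, solve the same
    universal problem. *)
Lemma tensor_span (F A L T : comNzRingType) (fA : {rmorphism F -> A})
    (fL : {rmorphism F -> L}) (iA : {rmorphism A -> T}) (iL : {rmorphism L -> T}) :
  is_tensor fA fL iA iL -> forall x, tensor_sums iA iL x.
Proof.
move=> [cc univ].
pose S := tensor_sub fA iA iL.
have pureP a b : tensor_sumsb (fA := fA) iL (iA a * iL b : tensor_carrier fA iA).
  by apply/asboolP; exists 1%N, (fun=> a), (fun=> b); rewrite big_ord1.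
pose beta a b : S := exist (fun x : tensor_carrier fA iA => tensor_sumsb iL x) _ (pureP a b).
have [|| h [[hlin hpure] _]] := univ S beta.
- move=> c a a' b; apply: val_inj.
  rewrite linearP /=; rewrite -[_ *: _]/(iA (fA c) * (iA a * iL b) : T).
  by rewrite rmorphD rmorphM mulrDl mulrA.
- move=> c a b b'; apply: val_inj.
  rewrite linearP /=; rewrite -[_ *: _]/(iA (fA c) * (iA a * iL b) : T).
  by rewrite rmorphD rmorphM mulrDr [X in X + _]mulrCA cc.
have [||k [_ kU]] := univ (tensor_carrier fA iA) (fun a b => iA a * iL b).
- by move=> c a a' b; rewrite rmorphD rmorphM mulrDl -mulrA.
- by move=> c a b b'; rewrite rmorphD rmorphM mulrDr [X in X + _]mulrCA -cc.
move=> x; have E1 : val (h x) = k x.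
  apply: (kU (fun x => val (h x))); split=> [c y z|a b].
    by rewrite hlin linearP.
  by rewrite hpure.
have E2 : x = k x.
  by apply: (kU (fun x => x)).
rewrite E2 -E1; exact/asboolP/(valP (h x)).
Qed.

Section Ideals.
Context (R : comNzRingType).
Implicit Types (I J X : set R).

Lemma ideal0 I : is_ideal I -> I 0. Proof. by case. Qed.
Lemma idealD I x y : is_ideal I -> I x -> I y -> I (x + y).
Proof. by case=> _ H _; apply: H. Qed.
Lemma idealM I a x : is_ideal I -> I x -> I (a * x).
Proof. by case=> _ _ H; apply: H. Qed.
Lemma idealMr I a x : is_ideal I -> I x -> I (x * a).
Proof. by rewrite mulrC; apply: idealM. Qed.
Lemma idealN I x : is_ideal I -> I x -> I (- x).
Proof. by rewrite -mulN1r; apply: idealM. Qed.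
Lemma idealB I x y : is_ideal I -> I x -> I y -> I (x - y).
Proof. by move=> iI Ix Iy; apply: idealD => //; apply: idealN. Qed.
Lemma ideal_sum I (J : Type) (r : seq J) (P : pred J) (G : J -> R) : is_ideal I ->
  (forall j, P j -> I (G j)) -> I (\sum_(j <- r | P j) G j).
Proof.
move=> iI IG; apply: (big_ind I) => //; first exact: ideal0.
by move=> x y; apply: idealD.
Qed.
Lemma ideal_sub_sym I x y : is_ideal I -> I (x - y) -> I (y - x).
Proof. by move=> iI Ixy; rewrite -opprB; apply: idealN. Qed.
Lemma ideal_sub_trans I y x z : is_ideal I -> I (x - y) -> I (y - z) -> I (x - z).
Proof. by move=> iI Ixy Iyz; rewrite -(subrKA y); apply: idealD. Qed.

Lemma ideal_gen_ideal X : is_ideal (ideal_gen X).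
Proof.
split=> [|x y [n [a [u [Xu ->]]]] [m [b [w [Xw ->]]]]|c x [n [a [u [Xu ->]]]]].
- by exists 0%N, (fun=> 0), (fun=> 0); split=> [[]//|]; rewrite big_ord0.
- exists (n + m)%N,
    (fun k : 'I_(n + m) => match fintype.split k with inl j => a j | inr j => b j end),
    (fun k : 'I_(n + m) => match fintype.split k with inl j => u j | inr j => w j end).
  split=> [k|]; first by case: fintype.split.
  rewrite big_split_ord /=; congr (_ + _); apply: eq_bigr => k _.
    by rewrite -[lshift m k]/(unsplit (inl k)) !unsplitK.
  by rewrite -[rshift n k]/(unsplit (inr k)) !unsplitK.
exists n, (fun k => c * a k), u; split=> //.
by rewrite mulr_sumr; apply: eq_bigr => k _; rewrite mulrA.
Qed.

Lemma ideal_gen_mem X x : X x -> ideal_gen X x.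
Proof. by move=> Xx; exists 1%N, (fun=> 1), (fun=> x); rewrite big_ord1 mul1r. Qed.

Lemma ideal_gen_min X J : is_ideal J -> X `<=` J -> ideal_gen X `<=` J.
Proof.
move=> iJ XJ _ [n [a [u [Xu ->]]]]; apply: ideal_sum => // k _.
by apply: idealM => //; apply: XJ.
Qed.

Lemma ideal_exp_ideal I n : is_ideal (ideal_exp I n).
Proof. exact: ideal_gen_ideal. Qed.

Lemma ideal_exp0 I x : ideal_exp I 0 x.
Proof.
rewrite -[x]mulr1; apply: idealM; first exact: ideal_exp_ideal.
by apply: ideal_gen_mem; exists (fun=> 0); split=> [[]//|]; rewrite big_ord0.
Qed.

Lemma ideal_exp_prod I n (x : 'I_n -> R) : (forall j, I (x j)) ->
  ideal_exp I n (\prod_j x j).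
Proof. by move=> Ix; apply: ideal_gen_mem; exists x. Qed.

Lemma ideal_exp1 I x : I x -> ideal_exp I 1 x.
Proof. by move=> Ix; have := @ideal_exp_prod I 1 (fun=> x); rewrite big_ord1; apply. Qed.

Lemma ideal_exp1_sub I x : is_ideal I -> ideal_exp I 1 x -> I x.
Proof.
move=> iI; apply: ideal_gen_min => // _ [u [Iu ->]].
by rewrite big_ord1.
Qed.

(** The [x] that multiply [I^n] into [I^(m+n)] form an ideal, so that generators suffice; likewise
    for [y]. The same argument recurs for other products of ideals. *)
Lemma ideal_expD I m n x y : ideal_exp I m x -> ideal_exp I n y ->
  ideal_exp I (m + n) (x * y).
Proof.
move=> Ix Iy; pose J := [set x | forall y, ideal_exp I n y -> ideal_exp I (m + n) (x * y)].
suff /(_ x Ix)/(_ y Iy) : ideal_exp I m `<=` J by [].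
have iE := ideal_exp_ideal I (m + n).
apply: ideal_gen_min.
  split=> [z _|a b Ja Jb z Iz|a b Jb z Iz]; first by rewrite mul0r; apply: ideal0.
    by rewrite mulrDl; apply: idealD => //; [apply: Ja | apply: Jb].
  by rewrite -mulrA; apply: idealM => //; apply: Jb.
move=> _ [u [Iu ->]].
apply: ideal_gen_min.
  split=> [|a b Ja Jb|a b Jb]; first by rewrite /= mulr0; apply: ideal0.
    by rewrite /= mulrDr; apply: idealD.
  by rewrite /= mulrCA; apply: idealM.
move=> _ [w [Iw ->]] /=; apply: ideal_gen_mem.
exists (fun k : 'I_(m + n) => match fintype.split k with inl j => u j | inr j => w j end).
split=> [k|]; first by case: fintype.split.
rewrite big_split_ord /=; congr (_ * _); apply: eq_bigr => k _.
  by rewrite -[lshift n k]/(unsplit (inl k)) !unsplitK.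
by rewrite -[rshift m k]/(unsplit (inr k)) !unsplitK.
Qed.

Lemma ideal_expX I x n : I x -> ideal_exp I n (x ^+ n).
Proof.
move=> Ix; have := @ideal_exp_prod I n (fun=> x) (fun=> Ix).
by rewrite prodr_const card_ord.
Qed.

Lemma ideal_exp_split I m n (J : set R) : is_ideal J ->
  (forall x y, ideal_exp I m x -> ideal_exp I n y -> J (x * y)) ->
  ideal_exp I (m + n) `<=` J.
Proof.
move=> iJ IJ; apply: ideal_gen_min => // _ [u [Iu ->]].
by rewrite big_split_ord; apply: IJ; apply: ideal_exp_prod.
Qed.

Lemma ideal_exp_le I m n : is_ideal I -> (m <= n)%N -> ideal_exp I n `<=` ideal_exp I m.
Proof.
move=> iI mn; rewrite -(subnKC mn); apply: ideal_exp_split => [|x y Ix _].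
  exact: ideal_exp_ideal.
by apply: idealMr => //; apply: ideal_exp_ideal.
Qed.

End Ideals.

Section IdealExt.
Context (R S : comNzRingType) (f : {rmorphism R -> S}).

Lemma ideal_ext_ideal I : is_ideal (ideal_ext f I).
Proof. exact: ideal_gen_ideal. Qed.

Lemma ideal_ext_mem I x : I x -> ideal_ext f I (f x).
Proof. by move=> Ix; apply: ideal_gen_mem; exists x. Qed.

Lemma ideal_ext_exp I n : ideal_exp (ideal_ext f I) n `<=` ideal_ext f (ideal_exp I n).
Proof.
elim: n => [|n IHn] x.
  move=> _; rewrite -[x]mulr1 -(rmorph1 f); apply: idealM (ideal_ext_ideal _) _.
  by apply: ideal_ext_mem; apply: ideal_exp0.
rewrite -[n.+1]add1n; apply: ideal_exp_split (ideal_ext_ideal _) _ x => x y Ix /IHn Iy.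
have {Ix} : ideal_ext f I x by apply: ideal_exp1_sub Ix; apply: ideal_ext_ideal.
pose J := [set x | forall y, ideal_ext f (ideal_exp I n) y -> ideal_ext f (ideal_exp I (1 + n)) (x * y)].
have iE := ideal_ext_ideal (ideal_exp I (1 + n)).
suff /(_ x) H : ideal_ext f I `<=` J by move/H/(_ y Iy).
apply: ideal_gen_min.
  split=> [z _|a b Ja Jb z Iz|a b Jb z Iz]; first by rewrite mul0r; apply: ideal0.
    by rewrite mulrDl; apply: idealD => //; [apply: Ja | apply: Jb].
  by rewrite -mulrA; apply: idealM => //; apply: Jb.
move=> _ [u Iu <-]; apply: ideal_gen_min.
  split=> [|a b Ja Jb|a b Jb]; first by rewrite /= mulr0; apply: ideal0.
    by rewrite /= mulrDr; apply: idealD.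
  by rewrite /= mulrCA; apply: idealM.
move=> _ [w Iw <-] /=; rewrite -rmorphM; apply: ideal_ext_mem.
by apply: ideal_expD => //; apply: ideal_exp1.
Qed.

Lemma ideal_exp_ext I n x : ideal_exp I n x -> ideal_exp (ideal_ext f I) n (f x).
Proof.
have iE := ideal_exp_ideal (ideal_ext f I) n.
have iJ : is_ideal [set x | ideal_exp (ideal_ext f I) n (f x)].
  split=> [|a b Ja Jb|a b Jb] /=; first by rewrite rmorph0; apply: ideal0.
    by rewrite rmorphD; apply: idealD.
  by rewrite rmorphM; apply: idealM.
apply: (ideal_gen_min iJ) => _ [u [Iu ->]] /=; rewrite rmorph_prod.
by apply: ideal_exp_prod => j; apply: ideal_ext_mem.
Qed.

End IdealExt.

Section QuotientBasis.
Context (F : fieldType) (A : comNzRingType) (fA : {rmorphism F -> A}).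
Context (I : set A) (iI : is_ideal I).
Context (T : finType) (f : T -> A) (cover : forall x, exists u, I (x - f u)).

Let spans g := exists al : 'I_g -> A, forall x, exists c : 'I_g -> F,
  I (x - \sum_k fA (c k) * al k).

(** A spanning family of least size is a basis. The quotient by [I] is not formed: its coordinates
    [mu] are functions on [A] that vanish on [I]. *)
Lemma quotient_basis : exists g (al : 'I_g -> A) (mu : 'I_g -> A -> F),
  [/\ forall k c x y, mu k (fA c * x + y) = c * mu k x + mu k y,
      forall k x, I x -> mu k x = 0,
      forall k l, mu k (al l) = (k == l)%:R &
      forall x, I (x - \sum_k fA (mu k x) * al k)].
Proof.
have ex : exists g, `[< spans g >].
  exists #|T|; apply/asboolP; exists (fun k => f (enum_val k)) => x.
  have [u Iu] := cover x; exists (fun k => (k == enum_rank u)%:R).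
  rewrite (bigD1 (enum_rank u)) //= eqxx enum_rankK rmorph1 mul1r big1 ?addr0 // => k.
  by move/negbTE->; rewrite rmorph0 mul0r.
have [g /asboolP[al alP] gmin] := ex_minnP ex.
have indep (c : 'I_g -> F) : I (\sum_k fA (c k) * al k) -> forall k, c k = 0.
  move=> Ic k0; apply: contrapT => /eqP ck0.
  case: g al alP gmin c Ic k0 ck0 => [|g] al alP gmin c Ic k0 ck0; first by case: (k0).
  suff /asboolP/gmin : spans g by rewrite ltnn.
  exists (fun k => al (lift k0 k)) => x; have [d Id] := alP x.
  exists (fun k => d (lift k0 k) - d k0 / c k0 * c (lift k0 k)).
  suff -> : x - \sum_k fA (d (lift k0 k) - d k0 / c k0 * c (lift k0 k)) * al (lift k0 k) =
     (x - \sum_k fA (d k) * al k) + fA (d k0 / c k0) * \sum_k fA (c k) * al k.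
    by apply: idealD => //; apply: idealM.
  rewrite !(bigD1_ord k0) //= mulrDr mulrA -rmorphM divfK //.
  have -> : \sum_j fA (d (lift k0 j) - d k0 / c k0 * c (lift k0 j)) * al (lift k0 j) =
      \sum_j fA (d (lift k0 j)) * al (lift k0 j) -
      fA (d k0 / c k0) * \sum_j fA (c (lift k0 j)) * al (lift k0 j).
    rewrite mulr_sumr -sumrB; apply: eq_bigr => k _.
    by rewrite [fA (d _ - _)]rmorphB mulrBl mulrA -rmorphM.
  by ring.
have /choice[mu muP] : forall x, exists c : 'I_g -> F, I (x - \sum_k fA (c k) * al k).
  exact: alP.
have muU x (c : 'I_g -> F) : I (x - \sum_k fA (c k) * al k) -> forall k, mu x k = c k.
  move=> Ic k; apply/eqP; rewrite -subr_eq0; apply/eqP.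
  apply: (indep (fun k => mu x k - c k)).
  have := idealB iI Ic (muP x).
  have E (u v w : A) : (u - v) - (u - w) = w - v by ring.
  rewrite E -sumrB; congr (I _); by apply: eq_bigr => l _; rewrite rmorphB mulrBl.
exists g, al, (fun k x => mu x k); split=> [k c x y|k x Ix|k l|x]; last exact: muP.
- apply: (muU _ (fun k => c * mu x k + mu y k)).
  have := idealD iI (idealM (fA c) iI (muP x)) (muP y).
  congr (I _); rewrite mulrBr addrACA -opprD; congr (_ - _).
  rewrite mulr_sumr -big_split; apply: eq_bigr => l _.
  by rewrite rmorphD rmorphM mulrDl mulrA.
- apply: (muU _ (fun=> 0)); rewrite big1 ?subr0 // => l _.
  by rewrite rmorph0 mul0r.
apply: (muU _ (fun k => (k == l)%:R)).
rewrite (bigD1 l) //= eqxx rmorph1 mul1r big1 ?addr0 ?subrr; first exact: ideal0.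
by move=> m /negbTE->; rewrite rmorph0 mul0r.
Qed.

End QuotientBasis.

(* Coordinates on [T / I T = (A / I) (x) L] for a basis of [A / I]. *)
Lemma tensor_quotient (F L : fieldType) (A T : comNzRingType) (fA : {rmorphism F -> A})
    (fL : {rmorphism F -> L}) (iA : {rmorphism A -> T}) (iL : {rmorphism L -> T})
    (I : set A) g (al : 'I_g -> A) (mu : 'I_g -> A -> F) :
  is_tensor fA fL iA iL -> is_ideal I ->
  (forall k c x y, mu k (fA c * x + y) = c * mu k x + mu k y) ->
  (forall k x, I x -> mu k x = 0) -> (forall k l, mu k (al l) = (k == l)%:R) ->
  (forall x, I (x - \sum_k fA (mu k x) * al k)) ->
  exists h : 'I_g -> T -> L,
    [/\ forall k x y, h k (x + y) = h k x + h k y,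
        forall k a b, h k (iA a * iL b) = fL (mu k a) * b,
        forall k x, ideal_ext iA I x -> h k x = 0 &
        forall x, ideal_ext iA I (x - \sum_k iA (al k) * iL (h k x))].
Proof.
move=> tens iI mulin muI mual muE.
have span := tensor_span tens; have [cc univ] := tens.
(* This is [L] as an [F]-module through [fL]. *)
pose P := tensor_carrier (idfun : {rmorphism F -> F}) fL.
have /choice[h hP] (k : 'I_g) : exists h : T -> L,
    (forall x y, h (x + y) = h x + h y) /\
    (forall a b, h (iA a * iL b) = fL (mu k a) * b).
  have [||h [[hlin hpure] _]] := univ P (fun a b => fL (mu k a) * b).
  - move=> c a a' b; rewrite mulin rmorphD rmorphM mulrDl -mulrA.
    by [].
  - by move=> c a b b'; rewrite mulrDr mulrCA.
  exists h; split=> [x y|a b]; last exact: hpure.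
  by have := hlin 1 x y; rewrite !rmorph1 mul1r scale1r.
have hD k x y : h k (x + y) = h k x + h k y by case: (hP k).
have hp k a b : h k (iA a * iL b) = fL (mu k a) * b by case: (hP k).
have h0 k : h k 0 = 0.
  by apply: (addIr (h k 0)); rewrite -hD !add0r.
have hsum k (J : finType) (G : J -> T) : h k (\sum_j G j) = \sum_j h k (G j).
  by apply: (big_morph _ (hD k) (h0 k)).
have hI k x : ideal_ext iA I x -> h k x = 0.
  move=> [n [a [u [Iu ->]]]]; rewrite hsum big1 // => j _.
  have [w Iw <-] := Iu j; have [m [c [d ->]]] := span (a j).
  rewrite mulr_suml hsum big1 // => l _.
  rewrite mulrAC -rmorphM hp muI ?rmorph0 ?mul0r //.
  exact: idealM.
exists h; split=> // x; have [n [a [b ->]]] := span x.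
under [X in _ - X]eq_bigr => k _ do rewrite hsum rmorph_sum mulr_sumr.
rewrite exchange_big -sumrB; apply: ideal_sum (ideal_ext_ideal _ _) _ => j _.
have -> : iA (a j) * iL (b j) - \sum_k iA (al k) * iL (h k (iA (a j) * iL (b j))) =
   iL (b j) * iA (a j - \sum_k fA (mu k (a j)) * al k).
  rewrite rmorphB mulrBr [iL _ * iA (a j)]mulrC; congr (_ - _).
  rewrite rmorph_sum mulr_sumr; apply: eq_bigr => k _.
  by rewrite hp !rmorphM cc; ring.
by apply: idealM (ideal_ext_ideal _ _) _; apply: ideal_ext_mem.
Qed.

Definition finitely_generated (R : comNzRingType) (I : set R) : Prop :=
  exists m (g : 'I_m -> R), (forall j, I (g j)) /\
    forall x, I x -> exists c : 'I_m -> R, x = \sum_j c j * g j.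

Section Completion.
Context (R S : comNzRingType) (f : {rmorphism R -> S}) (I : set R).
Hypothesis iI : is_ideal I.
Hypothesis fg : forall n, finitely_generated (ideal_exp I n).

Local Notation J n := (ideal_ext f (ideal_exp I n)).

(** The kernels [K n] are given only by their traces on [R]; the task is to show that the image of
    [I^n] generates them. An element of [K n] is a limit of some [a p], whose later differences lie
    in [I^p I^n]; written in the finitely many generators of [I^n], their coefficients can be summed
    in [S]. *)
Lemma completion_filtration : is_adic_completion I f ->
  [/\ forall n a, J n (f a) -> ideal_exp I n a,
      forall n x, exists a, J n (x - f a),
      forall x, (forall n, J n x) -> x = 0 &
      forall u : nat -> S, (forall n, J n (u n.+1 - u n)) ->
        exists x, forall n, J n (x - u n)].
Proof.
move=> [K [Kdec Kf Kdense Klim]].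
have iK n : is_ideal (K n) by case: (Kdec n).
have Kle m n : (m <= n)%N -> K n `<=` K m.
  move=> mn; rewrite -(subnKC mn); elim: (n - m)%N => [|p IHp]; first by rewrite addn0.
  by rewrite addnS => x Kx; apply: IHp; case: (Kdec (m + p)%N) => _; apply.
have Ksep x : (forall n, K n x) -> x = 0.
  move=> Kx; have [n|z [_ zU]] := Klim (fun=> 0).
    by rewrite subrr; apply: (ideal0 (ideal_exp_ideal I n)).
  by rewrite -(zU x) ?(zU 0) // => n; rewrite rmorph0 subr0 //; apply: (ideal0 (iK n)).
have JK n : J n `<=` K n.
  by apply: ideal_gen_min => // _ [a Ia <-]; apply/Kf.
have KJ n : K n `<=` J n.
  move=> x Kx; have /choice[a aP] : forall m, exists a, K m (x - f a) by move=> m; apply: Kdense.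
  have da m : ideal_exp I m (a m.+1 - a m).
    apply/Kf; rewrite rmorphB.
    have -> : f (a m.+1) - f (a m) = (x - f (a m)) - (x - f (a m.+1)) by ring.
    by apply: idealB => //; apply: (Kle m m.+1).
  have an : ideal_exp I n (a n).
    apply/Kf; have -> : f (a n) = x - (x - f (a n)) by ring.
    exact: idealB.
  have [m [g [gI gP]]] := fg n.
  have /choice[c cP] p : exists c : 'I_m -> R, (forall j, ideal_exp I p (c j)) /\
      a (n + p).+1 - a (n + p)%N = \sum_j c j * g j.
    pose L := [set y | exists c : 'I_m -> R, (forall j, ideal_exp I p (c j)) /\
       y = \sum_j c j * g j].
    have iP := ideal_exp_ideal I p.
    suff H : ideal_exp I (p + n) `<=` L.
      by have /H := da (p + n)%N; rewrite [(p + n)%N]addnC.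
    apply: ideal_exp_split => [|y z Iy Iz].
      split=> [|_ _ [c [Ic ->]] [d [Id ->]]|y _ [c [Ic ->]]].
      - exists (fun=> 0); split=> [j|]; first exact: ideal0.
        by rewrite big1 // => j _; rewrite mul0r.
      - exists (fun j => c j + d j); split=> [j|]; first exact: idealD.
        by rewrite -big_split; apply: eq_bigr => j _; rewrite mulrDl.
      exists (fun j => y * c j); split=> [j|]; first exact: idealM.
      by rewrite mulr_sumr; apply: eq_bigr => j _; rewrite mulrA.
    have [c ->] := gP z Iz; exists (fun j => y * c j); split=> [j|].
      exact: idealMr.
    by rewrite mulr_sumr; apply: eq_bigr => j _; rewrite mulrA.
  pose s j p := \sum_(q < p) c q j.
  have /choice[y yP] j : exists y, forall p, K p (y - f (s j p)).
    have [p|y [yP _]] := Klim (s j); last by exists y.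
    by rewrite /s big_ord_recr /= addrAC subrr add0r; case: (cP p).
  have aE p : a (n + p)%N = a n + \sum_j s j p * g j.
    elim: p => [|p IHp].
      by rewrite addn0 big1 ?addr0 // => j _; rewrite /s big_ord0 mul0r.
    rewrite addnS -(subrK (a (n + p)%N) (a _.+1)) (proj2 (cP p)) IHp addrCA -big_split.
    congr (_ + _); apply: eq_bigr => j _ /=.
    by rewrite /s big_ord_recr /= mulrDl addrC.
  have -> : x = f (a n) + \sum_j y j * f (g j).
    apply/eqP; rewrite -subr_eq0; apply/eqP/Ksep => p.
    have -> : x - (f (a n) + \sum_j y j * f (g j)) =
       (x - f (a (n + p)%N)) - \sum_j f (g j) * (y j - f (s j p)).
      have -> : \sum_j y j * f (g j) =
          f (\sum_j s j p * g j) + \sum_j f (g j) * (y j - f (s j p)).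
        rewrite rmorph_sum -big_split; apply: eq_bigr => j _ /=.
        by rewrite rmorphM; ring.
      by rewrite aE rmorphD; ring.
    apply: idealB => //; first by apply: (Kle p (n + p)%N) => //; apply: leq_addl.
    by apply: ideal_sum => // j _; apply: idealM.
  apply: idealD (ideal_ext_ideal _ _) _ _; first exact: ideal_ext_mem.
  apply: ideal_sum (ideal_ext_ideal _ _) _ => j _.
  by apply: idealM (ideal_ext_ideal _ _) _; apply: ideal_ext_mem.
split=> [n a /JK/Kf//|n x|x Jx|u du].
- by have [a /KJ] := Kdense n x; exists a.
- by apply: Ksep => n; apply: JK.
have /choice[a aP] : forall n, exists a, J n (u n - f a).
  by move=> n; have [a /KJ] := Kdense n (u n); exists a.
have [n|x [xP _]] := Klim a.
  apply/Kf; rewrite rmorphB.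
  have -> : f (a n.+1) - f (a n) = (u n.+1 - u n) + (u n - f (a n)) - (u n.+1 - f (a n.+1)) by ring.
  apply: idealB => //; last by apply: (Kle n n.+1) => //; apply: JK.
  by apply: idealD => //; apply: JK.
exists x => n; apply: (ideal_sub_trans (y := f (a n)) (ideal_ext_ideal f (ideal_exp I n))).
  by apply: KJ; apply: xP.
exact: (ideal_sub_sym (ideal_ext_ideal _ _) (aP n)).
Qed.

End Completion.

(* If [R / (a)] is finite, an ideal containing [a] is generated by [a] and a
   lift of its finite image in [R / (a)]. *)
Lemma finite_quotient_fg (R : comNzRingType) (I : set R) (a : R) (T : finType) (f : T -> R) :
  is_ideal I -> I a -> (forall x, exists u y, x = f u + y * a) -> finitely_generated I.
Proof.
move=> iI Ia cover.
pose g (o : option T) := if o is Some u then (if `[< I (f u) >] then f u else 0) else a.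
exists #|{: option T}|, (fun k => g (enum_val k)); split=> [k|x Ix].
  rewrite /g; case: (enum_val k) => [u|//]; case: asboolP => // _; exact: ideal0.
have [u [y xE]] := cover x.
pose c (o : option T) := if o is Some w then (w == u)%:R else y.
exists (fun k => c (enum_val k)).
have -> : \sum_(j < #|{: option T}|) c (enum_val j) * g (enum_val j) = \sum_o c o * g o.
  rewrite [RHS](reindex (@enum_val _ predT)) /=; last first.
    by apply: onW_bij; apply: enum_val_bij.
  by apply: eq_big.
rewrite (bigD1 None) //= (bigD1 (Some u)) //= eqxx mul1r big1; last first.
  move=> [w|] //= wu; rewrite (_ : (w == u) = false) ?mul0r //.
  by apply: contraNF wu => /eqP->.
have -> : `[< I (f u) >] = true.
  apply/asboolP; have -> : f u = x - y * a by rewrite xE addrK.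
  by apply: idealB => //; apply: idealM.
by rewrite xE addr0 addrC.
Qed.

(** * Frobenius-fixed vectors *)

Section FinFieldAlgebra.
Context (F : finFieldType) (R : comNzRingType) (f : {rmorphism F -> R}).
Local Notation q := #|F|.

(** Translation by 1 permutes [F], so that adding [q] leaves the sum of all elements unchanged. *)
Lemma card_finField_natr : q%:R = 0 :> R.
Proof.
suff q0 : q%:R = 0 :> F by rewrite -(rmorph_nat f) q0 rmorph0.
have E : \sum_(x : F) x = \sum_(x : F) x + q%:R.
  rewrite {1}(reindex_inj (addIr (1 : F))) /= big_split /=; congr (_ + _).
  by rewrite sumr_const.
by apply: (addrI (\sum_(x : F) x)); rewrite addr0 -E.
Qed.

Lemma frobD n (x y : R) : (x + y) ^+ (q ^ n) = x ^+ (q ^ n) + y ^+ (q ^ n).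
Proof.
apply: exprDn_pchar; rewrite pnatX; apply/orP; left.
have [p pr_p pF] := finPcharP F.
have pR : p \in [pchar R] by apply: rmorph_pchar pF.
have /abelem_pgroup pG := fin_ring_pchar_abelem pF.
rewrite -cardsT; apply: sub_in_pnat pG => r _; rewrite inE => /eqP->.
exact: pR.
Qed.

Lemma frobX n (x : R) : (x ^+ (q ^ n)) ^+ q = x ^+ (q ^ n.+1).
Proof. by rewrite -exprM expnSr. Qed.

Lemma frob_sum n (I : finType) (G : I -> R) :
  (\sum_i G i) ^+ (q ^ n) = \sum_i (G i) ^+ (q ^ n).
Proof.
have qn : (0 < q ^ n)%N by rewrite expn_gt0 (ltnW (finNzRing_gt1 F)).
by apply: (big_morph _ (frobD n)); rewrite expr0n gtn_eqF.
Qed.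

Lemma frob_const n c : f c ^+ (q ^ n) = f c.
Proof.
rewrite -rmorphXn; congr (f _).
elim: n => [|n IHn]; first by rewrite expr1.
by rewrite expnSr exprM IHn expf_card.
Qed.

End FinFieldAlgebra.

(** [X^q - X] already splits over [F]. *)
Lemma frob_fixed (F : finFieldType) (E : fieldType) (f : {rmorphism F -> E}) x :
  x ^+ #|F| = x -> exists c, x = f c.
Proof.
move=> xq; have := congr1 (fun p => (map_poly f p).[x]) (finField_genPoly F).
rewrite rmorphB /= map_polyXn map_polyX !hornerE xq subrr => /esym/eqP.
rewrite rmorph_prod horner_prod prodf_seq_eq0 => /hasP[c _ /=].
rewrite rmorphB /= map_polyX map_polyC !hornerE subr_eq0 => /eqP->.
by exists c.
Qed.

Section SeparablyClosed.
Context (F : finFieldType) (E : fieldType) (f : {rmorphism F -> E}).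
Local Notation q := #|F|.
Hypothesis E_closed : forall p : {poly E}, separable_poly p -> (1 < size p)%N ->
  exists x, root p x.

Lemma separable_splits (p : {poly E}) : separable_poly p -> p \is monic ->
  exists rs, p = \prod_(z <- rs) ('X - z%:P).
Proof.
have [n] := ubnP (size p); elim: n p => // n IHn p pn sp mp.
have [p1|p1] := leqP (size p) 1.
  exists [::]; rewrite big_nil; move: mp; rewrite (size1_polyC p1) monicE lead_coefC.
  by move=> /eqP->.
have [x /factor_theorem[p' E']] := E_closed sp p1.
have mp' : p' \is monic by move: mp; rewrite E' monicMr // monicXsubC.
have [||rs Ers] := IHn p' _ _ mp'.
- by move: pn; rewrite E' size_Mmonic ?monic_neq0 ?monicXsubC // size_XsubC addn2.
- by move: sp; rewrite E' separable_mul => /and3P[].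
by exists (x :: rs); rewrite big_cons -Ers mulrC.
Qed.

(** [X^q - X - c] has derivative -1, hence is separable. *)
Lemma artin_schreier (c : E) : exists y : E, y ^+ q - y = c.
Proof.
have q1 : (1 < q)%N := finNzRing_gt1 F.
pose p : {poly E} := 'X^q - 'X - c%:P.
have sp : size p = q.+1.
  by rewrite /p -addrA size_polyDl size_polyXn // -opprD size_polyN -[c]opprK polyCN size_XsubC.
have [||x] := E_closed (p := p).
- rewrite unlock /p !derivB derivC derivX derivXn subr0.
  have -> : ('X ^+ q.-1) *+ q = 0 :> {poly E}.
    by rewrite -mulr_natr -polyC_natr (card_finField_natr f) mulr0.
  by rewrite sub0r -[X in coprimep _ X]scaleN1r coprimepZr ?coprimep1 ?oppr_eq0 ?oner_eq0.
- by rewrite sp ltnS ltnW.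
rewrite /root !hornerE subr_eq0 => /eqP <-.
by exists x.
Qed.

(* [rs] lists the nonzero elements of the field with [q ^ n] elements. *)
Lemma frob_power_sums n : (0 < n)%N -> exists rs : seq E,
  (forall l, l \in rs -> l != 0 /\ l ^+ (q ^ n) = l) /\
  forall i, (i < n)%N -> \sum_(l <- rs) l^-1 * l ^+ (q ^ i) = - (i == 0%N)%:R.
Proof.
move=> n_gt0; have q1 : (1 < q)%N := finNzRing_gt1 F.
set Q := (q ^ n)%N.
have Q1 : (1 < Q)%N by rewrite /Q -(exp1n n) ltn_exp2r.
have Q0 : Q%:R = 0 :> E.
  by rewrite /Q -(prednK n_gt0) expnS natrM (card_finField_natr f) mul0r.
pose p : {poly E} := 'X^Q - 'X.
have sp : size p = Q.+1 by rewrite /p size_polyDl size_polyXn // size_polyN size_polyX.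
have mp : p \is monic.
  by rewrite monicE /p lead_coefDl ?lead_coefXn // size_polyXn size_polyN size_polyX.
have sepp : separable_poly p.
  rewrite unlock /p derivB derivX derivXn.
  have -> : ('X ^+ Q.-1) *+ Q = 0 :> {poly E} by rewrite -mulr_natr -polyC_natr Q0 mulr0.
  by rewrite sub0r -[X in coprimep _ X]scaleN1r coprimepZr ?coprimep1 ?oppr_eq0 ?oner_eq0.
have [rs prs] := separable_splits sepp mp.
have urs : uniq rs by rewrite -separable_prod_XsubC -prs.
have mrs l : (l \in rs) = (l ^+ Q == l).
  by rewrite -root_prod_XsubC -prs /root !hornerE subr_eq0.
have srs : size rs = Q by have := size_prod_XsubC rs id; rewrite -prs sp => -[].
have r0 : 0 \in rs by rewrite mrs expr0n gtn_eqF // ltnW.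
pose rs0 := rem 0 rs.
have mrs0 l : (l \in rs0) = (l != 0) && (l ^+ Q == l).
  by rewrite mem_rem_uniq // inE mrs.
have urs0 : uniq rs0 by apply: rem_uniq.
have srs0 : size rs0 = Q.-1 by rewrite size_rem // srs.
exists rs0; split=> [l|i i_n]; first by rewrite mrs0 => /andP[l0 /eqP].
have qi : (0 < q ^ i)%N by rewrite expn_gt0 (ltnW q1).
transitivity (\sum_(l <- rs0) l ^+ (q ^ i).-1).
  rewrite big_seq [RHS]big_seq; apply: eq_bigr => l; rewrite mrs0 => /andP[l0 _].
  by rewrite -{1}(prednK qi) exprS mulKf.
case: i i_n qi => [|i] i_n qi.
  rewrite /= big_const_seq count_predT iter_addr_0 srs0 -[1]/(1%:R) /=.
  by apply/eqP; rewrite -addr_eq0 -mulrSr prednK ?Q0 // ltnW.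
rewrite oppr0; set k := (q ^ i.+1).-1.
have k_gt0 : (0 < k)%N by rewrite /k -ltnS prednK // -[1%N](exp1n i.+1) ltn_exp2r.
have kQ : (k < Q.-1)%N.
  by rewrite /k -ltnS !prednK // ?ltn_exp2l // ltnW.
(* [X^k - 1] has at most [k < Q.-1] roots. Multiplication by such a [g] permutes [rs0] and
   multiplies the power sum by [g ^+ k], which forces the sum to vanish. *)
have [g grs gk] : exists2 g, g \in rs0 & g ^+ k != 1.
  apply: contrapT => no.
  have : (size rs0 < size ('X^k - 1 : {poly E})%R)%N.
    apply: max_poly_roots => //; first by rewrite -size_poly_eq0 size_XnsubC.
    apply/allP => g grs; rewrite /root !hornerE subr_eq0.
    by apply: contrapT => /negP gk; apply: no; exists g.
  by rewrite size_XnsubC // srs0 ltnS leqNgt kQ.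
move: grs; rewrite mrs0 => /andP[g0 /eqP gQ].
have perm : perm_eq rs0 [seq g * l | l <- rs0].
  apply: uniq_perm => //; first by rewrite map_inj_uniq //; apply: mulfI.
  move=> l; apply/idP/mapP => [lrs|[l' l'rs ->]].
    exists (g^-1 * l); last by rewrite mulVKf.
    move: lrs; rewrite !mrs0 => /andP[l0 /eqP lQ].
    by rewrite mulf_neq0 ?invr_eq0 //= exprMn exprVn gQ lQ.
  move: l'rs; rewrite !mrs0 => /andP[l0 /eqP lQ].
  by rewrite mulf_neq0 //= exprMn gQ lQ.
have E1 : \sum_(l <- rs0) l ^+ k = g ^+ k * \sum_(l <- rs0) l ^+ k.
  rewrite {1}(perm_big _ perm) big_map mulr_sumr.
  by apply: eq_bigr => l _; rewrite exprMn.
apply/eqP; move/eqP: E1; rewrite -subr_eq0 -{1}[\sum_(l <- _) _]mul1r -mulrBl mulf_eq0.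
by rewrite subr_eq0 eq_sym (negbTE gk).
Qed.

End SeparablyClosed.

Lemma addrBB (V : zmodType) (a b c d : V) : (a + b) - (c + d) = (a - c) + (b - d).
Proof. by rewrite opprD addrACA. Qed.

Lemma addrBBl (V : zmodType) (p w f s x : V) :
  p + f - (s + w) - x = f - w - (x - (p - s)).
Proof. by rewrite addrBB [- (x - _)]opprB addrAC addrC. Qed.

Lemma subrACA (V : zmodType) (a b c d : V) : a - b - (c - d) = a - c - (b - d).
Proof. by rewrite !opprB addrACA [RHS]addrACA [- b - c]addrC. Qed.

Lemma drop_relation (V : zmodType) (x p s w z : V) :
  x - (s - w) = x - (p + s) + (z + w + (p - z)).
Proof.
rewrite opprB -[RHS]addrA; congr (x + _).
rewrite [z + w]addrC -[w + z + _]addrA [z + _]addrC subrK.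
by rewrite [RHS]addrC opprD addrA addrK.
Qed.

(** * Fixed vectors modulo v and their v-adic lifting *)

Section FixedBasis.
Context (F : finFieldType) (A B : comNzRingType) (E : fieldType).
Context (fA : {rmorphism F -> A}) (fE : {rmorphism F -> E}).
Local Notation q := #|F|.
Hypothesis E_closed : forall p : {poly E}, separable_poly p -> (1 < size p)%N ->
  exists x, root p x.
Context (iota : {rmorphism A -> B}) (lam : {rmorphism E -> B}) (sig : {rmorphism B -> B}).
Hypothesis iota_lam : forall c, iota (fA c) = lam (fE c).
Hypothesis sig_iota : forall a, sig (iota a) = iota a.
Hypothesis sig_lam : forall l, sig (lam l) = lam (l ^+ q).
Context (v : set A) (v_max : maximal_ideal v).

Definition vfilt n : set B := ideal_ext iota (ideal_exp v n).
Local Notation K := vfilt.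
Hypothesis K_sep : forall x, (forall n, K n x) -> x = 0.
Hypothesis K_complete : forall u : nat -> B, (forall n, K n (u n.+1 - u n)) ->
  exists x, forall n, K n (x - u n).
Context (g : nat) (al : 'I_g -> A) (mu : 'I_g -> A -> F).
Hypothesis mu_lin : forall k c x y, mu k (fA c * x + y) = c * mu k x + mu k y.
Hypothesis mu_v : forall k x, v x -> mu k x = 0.
Hypothesis mu_al : forall k l, mu k (al l) = (k == l)%:R.
Hypothesis K1_dense : forall x, exists l : 'I_g -> E,
  K 1 (x - \sum_k iota (al k) * lam (l k)).

Context (N : lmodType B) (phi : {linear N -> N | sig \; *:%R}).
Context (m : nat) (e : 'I_m -> N) (kap : 'I_m -> {linear N -> B^o}).
Hypothesis ekap : forall x, x = \sum_i kap i x *: e i.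
(** This is the submodule [K n N]: the [kap i] are linear and the [e i] generate [N]. *)
Definition vfiltN n : set N := [set x | forall i, K n (kap i x)].
Local Notation NK := vfiltN.
Hypothesis phi_periodic : forall i, exists a n, (0 < n)%N /\
  NK 1 (iter (a + n) phi (e i) - iter a phi (e i)).
Hypothesis phi_span : forall x, exists n (c : 'I_n -> B) (y : 'I_n -> N),
  NK 1 (x - \sum_j c j *: phi (y j)).

Let iv : is_ideal v. Proof. by case: v_max. Qed.
Let iK n : is_ideal (K n). Proof. exact: ideal_ext_ideal. Qed.
Let K_iota n a : ideal_exp v n a -> K n (iota a). Proof. exact: ideal_ext_mem. Qed.
Let K1_iota a : v a -> K 1 (iota a). Proof. by move=> va; apply/K_iota/ideal_exp1. Qed.
Let K0 x : K 0 x.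
Proof.
rewrite -[x]mulr1 -(rmorph1 iota); apply: idealM => //; apply: K_iota.
exact: ideal_exp0.
Qed.

Let K_le n n' x : (n <= n')%N -> K n' x -> K n x.
Proof.
move=> nn; apply: ideal_gen_min => // _ [a Ia <-]; apply: K_iota.
exact: ideal_exp_le nn _ Ia.
Qed.

Let KM n n' x y : K n x -> K n' y -> K (n + n') (x * y).
Proof.
move=> Kx Ky; pose J := [set x | forall y, K n' y -> K (n + n') (x * y)].
suff /(_ x Kx)/(_ y Ky) : K n `<=` J by [].
have iE := iK (n + n'); apply: ideal_gen_min.
  split=> [z _|a b Ja Jb z Iz|a b Jb z Iz]; first by rewrite mul0r; apply: ideal0.
    by rewrite mulrDl; apply: idealD => //; [apply: Ja | apply: Jb].
  by rewrite -mulrA; apply: idealM => //; apply: Jb.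
move=> _ [a Ia <-]; apply: ideal_gen_min.
  split=> [|b c Jb Jc|b c Jc]; first by rewrite /= mulr0; apply: ideal0.
    by rewrite /= mulrDr; apply: idealD.
  by rewrite /= mulrCA; apply: idealM.
move=> _ [w Iw <-] /=; rewrite -rmorphM; apply: ideal_ext_mem.
exact: ideal_expD.
Qed.

Let K_sig n x : K n x -> K n (sig x).
Proof.
apply: (ideal_gen_min (J := [set x | K n (sig x)])).
  split=> [|a b Ja Jb|a b Jb] /=; first by rewrite rmorph0; apply: ideal0.
    by rewrite rmorphD; apply: idealD.
  by rewrite rmorphM; apply: idealM.
by move=> _ [a Ia <-] /=; rewrite sig_iota; apply: K_iota.
Qed.

Let NK0 n : NK n 0. Proof. by move=> i; rewrite linear0; apply: (ideal0 (iK n)). Qed.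
Let NKD n x y : NK n x -> NK n y -> NK n (x + y).
Proof. by move=> Kx Ky i; rewrite linearD; apply: (idealD (iK n) (Kx i) (Ky i)). Qed.
Let NKZ n b x : NK n x -> NK n (b *: x).
Proof. by move=> Kx i; rewrite linearZ; apply: (idealM b (iK n) (Kx i)). Qed.
Let NKN n x : NK n x -> NK n (- x).
Proof. by rewrite -scaleN1r; apply: NKZ. Qed.
Let NKB n x y : NK n x -> NK n y -> NK n (x - y).
Proof. by move=> Kx Ky; apply: NKD => //; apply: NKN. Qed.
Let NK_sum n (I : Type) (r : seq I) (P : pred I) (G : I -> N) :
  (forall j, P j -> NK n (G j)) -> NK n (\sum_(j <- r | P j) G j).
Proof.
by move=> NG; apply: (big_ind (NK n) (@NK0 n) (@NKD n)).
Qed.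
Let NKM n n' b x : K n b -> NK n' x -> NK (n + n') (b *: x).
Proof. by move=> Kb Kx i; rewrite linearZ; apply: (KM Kb (Kx i)). Qed.
Let NKMl n b x : K n b -> NK n (b *: x).
Proof. by move=> Kb i; rewrite linearZ; apply: (idealMr _ (iK n) Kb). Qed.
Let NK_00 x : NK 0 x. Proof. by move=> i; apply: K0. Qed.
Let NK_le n n' x : (n <= n')%N -> NK n' x -> NK n x.
Proof. by move=> nn Kx i; apply: K_le nn _; apply: Kx. Qed.
Let NK_sub_sym n x y : NK n (x - y) -> NK n (y - x).
Proof. by move=> Kxy; rewrite -opprB; apply: NKN. Qed.
Let NK_trans n y x z : NK n (x - y) -> NK n (y - z) -> NK n (x - z).
Proof. by move=> Kxy Kyz; rewrite -(subrKA y); apply: NKD. Qed.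

Let NK_phi n x : NK n x -> NK n (phi x).
Proof.
move=> Kx; rewrite [x]ekap linear_sum; apply: NK_sum => i _.
by rewrite linearZ; apply: NKMl; apply/K_sig/Kx.
Qed.

Let NK_iter n k x : NK n x -> NK n (iter k phi x).
Proof. by move=> Kx; elim: k => //= k IHk; apply: NK_phi. Qed.

Let iter_phiD k x y : iter k phi (x + y) = iter k phi x + iter k phi y.
Proof. by elim: k => //= k ->; rewrite linearD. Qed.

Let iter_phiB k x y : iter k phi (x - y) = iter k phi x - iter k phi y.
Proof. by elim: k => //= k ->; rewrite linearB. Qed.

Let iter_phiZ k b x : iter k phi (b *: x) = iter k sig b *: iter k phi x.
Proof. by elim: k => //= k ->; rewrite linearZ. Qed.

Let iter_phi_sum k (I : Type) (r : seq I) (P : pred I) (G : I -> N) :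
  iter k phi (\sum_(j <- r | P j) G j) = \sum_(j <- r | P j) iter k phi (G j).
Proof. by elim: k => //= k ->; rewrite linear_sum. Qed.

Let N_sep x : (forall n, NK n x) -> x = 0.
Proof.
move=> Kx; rewrite [x]ekap big1 // => i _; rewrite (K_sep (x := kap i x)) ?scale0r //.
by move=> n; apply: Kx.
Qed.

Let N_complete (u : nat -> N) : (forall n, NK n (u n.+1 - u n)) ->
  exists x, forall n, NK n (x - u n).
Proof.
move=> du; have /choice[z zP] i : exists z, forall n, K n (z - kap i (u n)).
  by apply: K_complete => n; rewrite -linearB; apply: du.
exists (\sum_i z i *: e i) => n; rewrite {1}[u n]ekap -sumrB.
by apply: NK_sum => i _; rewrite -scalerBl; apply: NKMl.
Qed.

(** Modulo [NK 1], [U] consists of the fixed vectors and [W] of their combinations over [E]. On [E]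
    the map [sig] is the [q]-th power, which makes Artin-Schreier equations applicable to the
    coefficients. *)
Let U x := NK 1 (phi x - x).
Let W x := exists n (l : 'I_n -> E) (y : 'I_n -> N),
  (forall j, U (y j)) /\ NK 1 (x - \sum_j lam (l j) *: y j).

Let W_NK x : NK 1 x -> W x.
Proof.
move=> Kx; exists 0%N, (fun=> 0), (fun=> 0).
by rewrite big_ord0 subr0; split=> // -[].
Qed.

Let WD x y : W x -> W y -> W (x + y).
Proof.
move=> [n [l [u [Uu Kx]]]] [n' [l' [u' [Uu' Ky]]]].
exists (n + n')%N,
  (fun k : 'I_(n + n') => match fintype.split k with inl j => l j | inr j => l' j end),
  (fun k : 'I_(n + n') => match fintype.split k with inl j => u j | inr j => u' j end).
split=> [k|]; first by case: fintype.split.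
have -> : \sum_(j < n + n')
     lam (match fintype.split j with inl j => l j | inr j => l' j end) *:
     (match fintype.split j with inl j => u j | inr j => u' j end) =
     \sum_j lam (l j) *: u j + \sum_j lam (l' j) *: u' j.
  rewrite big_split_ord /=; congr (_ + _); apply: eq_bigr => k _.
    by rewrite -[lshift n' k]/(unsplit (inl k)) !unsplitK.
  by rewrite -[rshift n k]/(unsplit (inr k)) !unsplitK.
by rewrite opprD addrACA; apply: NKD.
Qed.

Let W_sum (I : Type) (r : seq I) (P : pred I) (G : I -> N) :
  (forall j, P j -> W (G j)) -> W (\sum_(j <- r | P j) G j).
Proof. by move=> WG; apply: (big_ind W (W_NK (@NK0 1%N)) WD). Qed.

Let U_iota a y : U y -> U (iota a *: y).
Proof.
by move=> Uy; rewrite /U linearZ /= sig_iota -scalerBr; apply: NKZ.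
Qed.

Let W_lam l y : U y -> W (lam l *: y).
Proof.
move=> Uy; exists 1%N, (fun=> l), (fun=> y).
by rewrite big_ord1 subrr.
Qed.

(** Modulo [K 1] the scalar [b] is a combination over [E] of the [iota (al k)], and these preserve
    [U]. *)
Let WZ b x : W x -> W (b *: x).
Proof.
move=> [n [l [y [Uy Kx]]]]; have [l' Kb] := K1_dense b.
have -> : b *: x = b *: (x - \sum_j lam (l j) *: y j) +
   ((b - \sum_k iota (al k) * lam (l' k)) *: (\sum_j lam (l j) *: y j) +
    \sum_k \sum_j lam (l' k * l j) *: (iota (al k) *: y j)).
  have -> : \sum_k \sum_j lam (l' k * l j) *: (iota (al k) *: y j) =
      (\sum_k iota (al k) * lam (l' k)) *: (\sum_j lam (l j) *: y j).
    rewrite scaler_suml; apply: eq_bigr => k _.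
    rewrite scaler_sumr; apply: eq_bigr => j _.
    by rewrite !scalerA rmorphM; congr (_ *: _); ring.
  by rewrite -scalerDl subrK -scalerDr subrK.
apply: WD; first by apply/W_NK/NKZ.
apply: WD; first by apply/W_NK/NKMl.
by apply: W_sum => k _; apply: W_sum => j _; apply/W_lam/U_iota.
Qed.

(* Inverting the sums [y_l = sum_i l^(q^i) phi^i x] over the field with [q^n] elements. *)
Let W_periodic n x : (0 < n)%N -> NK 1 (iter n phi x - x) -> W x.
Proof.
move=> n_gt0 Kx; have [rs [rsP rsS]] := frob_power_sums fE E_closed n_gt0.
pose y l := \sum_(i < n) lam (l ^+ (q ^ i)) *: iter i phi x.
have Uy l : l ^+ (q ^ n) = l -> U (y l).
  move=> ln; rewrite /U /y linear_sum /=.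
  have -> : \sum_(i < n) phi (lam (l ^+ (q ^ i)) *: iter i phi x) =
            \sum_(i < n) lam (l ^+ (q ^ i.+1)) *: iter i.+1 phi x.
    by apply: eq_bigr => i _; rewrite linearZ /= sig_lam -exprM expnSr.
  pose G i := lam (l ^+ (q ^ i)) *: iter i phi x.
  rewrite -sumrB -(big_mkord xpredT (fun i => G i.+1 - G i)) telescope_sumr //.
  by rewrite /G ln expn0 expr1 -scalerBr; apply: NKZ.
have inner (i : 'I_n) : \sum_(l <- rs) lam (- l^-1) *: (lam (l ^+ (q ^ i)) *: iter i phi x) =
    lam (i == 0%N :> nat)%:R *: iter i phi x.
  under eq_bigr => l _ do rewrite scalerA -rmorphM mulNr.
  by rewrite -scaler_suml -rmorph_sum sumrN rsS // opprK.
have -> : x = \sum_(l <- rs) lam (- l^-1) *: y l.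
  rewrite /y; under eq_bigr => l _ do rewrite scaler_sumr.
  rewrite exchange_big /= (eq_bigr _ (fun i _ => inner i)) (bigD1 (Ordinal n_gt0)) //=.
  rewrite rmorph1 scale1r big1 ?addr0 // => i; rewrite -val_eqE /= => /negbTE->.
  by rewrite rmorph0 scale0r.
rewrite big_seq; apply: W_sum => l /rsP[_ ln].
by apply/W_lam/Uy.
Qed.

(** From some iterate on, every [e i] is periodic, so that [W] contains the image of a power of
    [phi]; [phi_span] then lowers that power step by step to 0. *)
Let W_all x : W x.
Proof.
have /choice[a /choice[n anP]] : forall i, exists a n, (0 < n)%N /\
  NK 1 (iter (a + n) phi (e i) - iter a phi (e i)) by [].
pose a0 := (\sum_i a i)%N.
have We i : W (iter a0 phi (e i)).
  have [n0 Ki] := anP i; apply: (W_periodic n0).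
  have ai : (a i <= a0)%N by rewrite /a0 (bigD1 i) //= leq_addr.
  have -> : iter (n i) phi (iter a0 phi (e i)) - iter a0 phi (e i) =
     iter (a0 - a i) phi (iter (a i + n i) phi (e i) - iter (a i) phi (e i)).
    by rewrite iter_phiB -!iterD; congr (iter _ _ _ - iter _ _ _); lia.
  exact: NK_iter.
have Wa : forall x, W (iter a0 phi x).
  move=> z; rewrite [z]ekap iter_phi_sum; apply: W_sum => i _.
  by rewrite iter_phiZ; apply: WZ.
clear We; elim: a0 Wa x => [|b IHb] Wb; first exact: Wb.
apply: IHb => z; have [k [c [y Kz]]] := phi_span z.
rewrite -(subrK (\sum_j c j *: phi (y j)) z) iter_phiD.
apply: WD; first by apply/W_NK/NK_iter.
rewrite iter_phi_sum; apply: W_sum => j _.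
by rewrite iter_phiZ -iterSr; apply: WZ.
Qed.

(** One Artin-Schreier equation for each coefficient. *)
Let phi1_surj_mod x : exists y, NK 1 (phi y - y - x).
Proof.
have [n [l [y [Uy Kx]]]] := W_all x.
have /choice[z zP] j := artin_schreier fE E_closed (l j).
exists (\sum_j lam (z j) *: y j).
apply: (NK_trans (y := \sum_j lam (l j) *: y j)); last exact: NK_sub_sym.
rewrite linear_sum -!sumrB; apply: NK_sum => j _.
have -> : phi (lam (z j) *: y j) - lam (z j) *: y j - lam (l j) *: y j =
   lam (z j ^+ q) *: (phi (y j) - y j).
  rewrite linearZ /= sig_lam -zP rmorphB scalerBl scalerBr.
  by rewrite opprB addrA subrK.
exact: (NKZ _ (Uy j)).
Qed.

(** [K n] is generated by the [iota a] with [a] in [v^n]; these are fixed by [sig], so that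
    solutions modulo [NK 1] may be multiplied by them. *)
Let phi1_surj_filt n x : NK n x -> exists y, NK n y /\ NK n.+1 (phi y - y - x).
Proof.
move=> Kx.
pose Z : set B := [set k | forall z, exists y, NK n y /\ NK n.+1 (phi y - y - k *: z)].
have KZ : K n `<=` Z.
  apply: ideal_gen_min.
    split=> [z|k k' Zk Zk' z|b k Zk z].
    - by exists 0; rewrite linear0 scale0r !subrr; split; apply: NK0.
    - have [y [Ky Py]] := Zk z; have [y' [Ky' Py']] := Zk' z.
      exists (y + y'); split; first exact: NKD.
      have -> : phi (y + y') - (y + y') - (k + k') *: z =
        (phi y - y - k *: z) + (phi y' - y' - k' *: z).
        by rewrite linearD scalerDl [phi y + phi y' - _]addrBB addrBB.
      exact: NKD.
    by rewrite mulrC; have [y [Ky Py]] := Zk (b *: z); exists y; rewrite -scalerA.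
  move=> _ [a Ia <-] z; have [y Ky] := phi1_surj_mod z.
  exists (iota a *: y); split; first by apply/NKMl/K_iota.
  have -> : phi (iota a *: y) - iota a *: y - iota a *: z = iota a *: (phi y - y - z).
    by rewrite linearZ /= sig_iota !scalerBr.
  by rewrite -addn1; apply: NKM => //; apply: K_iota.
have /choice[y yP] i : exists y, NK n y /\ NK n.+1 (phi y - y - kap i x *: e i).
  exact: KZ (Kx i) (e i).
exists (\sum_i y i); split; first by apply: NK_sum => i _; case: (yP i).
rewrite linear_sum [x in _ - x]ekap -!sumrB.
by apply: NK_sum => i _; case: (yP i).
Qed.

(** Successive approximation: [s n] solves the equation modulo [NK n.+1]. *)
Let phi1_surj x : NK 1 x -> exists y, NK 1 y /\ phi y - y = x.
Proof.
move=> Kx; have /choice[G GP] : forall nx : nat * N, exists y,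
    NK nx.1 nx.2 -> NK nx.1 y /\ NK nx.1.+1 (phi y - y - nx.2).
  move=> [n z]; have [Kz|nK] := pselect (NK n z); last by exists 0.
  by have [y yP] := phi1_surj_filt Kz; exists y.
pose s := fix s n := if n is p.+1 then s p + G (n, x - (phi (s p) - s p)) else 0.
have sP n : NK n.+1 (x - (phi (s n) - s n)).
  elim: n => [|n IHn]; first by rewrite /= linear0 !subr0.
  have [_ Ky] := GP (n.+1, x - (phi (s n) - s n)) IHn.
  apply: NK_sub_sym.
  have -> : phi (s n.+1) - s n.+1 - x = phi (G (n.+1, x - (phi (s n) - s n)))
     - G (n.+1, x - (phi (s n) - s n)) - (x - (phi (s n) - s n)).
    by rewrite /= linearD addrBBl.
  exact: Ky.
have ds n : NK n.+1 (s n.+1 - s n).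
  by rewrite /= [s n + _]addrC addrK; case: (GP (n.+1, _) (sP n)).
have [y yP] : exists y, forall n, NK n (y - s n).
  by apply: N_complete => n; apply: NK_le (ds n).
exists y; split.
  rewrite -(subrK (s 1%N) y); apply: NKD => //.
  by have := ds 0%N; rewrite /= subr0.
apply/eqP; rewrite -subr_eq0; apply/eqP/N_sep => n.
apply: (NK_trans (y := phi (s n) - s n)); last first.
  by apply/NK_sub_sym; apply: NK_le (sP n).
have -> : phi y - y - (phi (s n) - s n) = phi (y - s n) - (y - s n).
  by rewrite [phi (y - _)]linearB subrACA.
by apply: NKB => //; apply: NK_phi.
Qed.

Let fixed_lift x : U x -> exists t, phi t = t /\ NK 1 (t - x).
Proof.
move=> /phi1_surj[y [Ky yP]]; exists (x - y); split; last first.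
  by rewrite addrAC subrr add0r; apply: NKN.
rewrite [phi (x - y)]linearB; move/eqP: yP; rewrite subr_eq => /eqP->.
by rewrite opprD opprB addrA [phi x + _]addrC subrK.
Qed.

(** Sequences padded with zeros, rather than finite families, allow one common length for all the
    [e i] in [spans_ex]. *)
Let fixed_span x : exists n (l : nat -> E) (t : nat -> N),
  (forall j, phi (t j) = t j) /\
  forall M, (n <= M)%N -> NK 1 (x - \sum_(j < M) lam (l j) *: t j).
Proof.
have [n [l [y [Uy Kx]]]] := W_all x.
have /choice[t tP] j : exists t, phi t = t /\ NK 1 (t - y j) by apply: fixed_lift.
exists n, (fun k => if insub k is Some j then l j else 0),
  (fun k => if insub k is Some j then t j else 0).
split=> [k|M nM].
  by case: insubP => [j _ _|_]; [case: (tP j) | rewrite linear0].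
have -> : \sum_(k < M) lam (if insub (k : nat) is Some j then l j else 0) *:
     (if insub (k : nat) is Some j then t j else 0) = \sum_j lam (l j) *: t j.
  pose G k := lam (if insub k is Some j then l j else 0) *:
     (if insub k is Some j then t j else 0).
  rewrite -[LHS]/(\sum_(k < M) G k).
  have -> : \sum_j lam (l j) *: t j = \sum_(j < n) G j.
    by apply: eq_bigr => j _; rewrite /G valK.
  rewrite (big_ord_widen _ G nM) [RHS]big_mkcond; apply: eq_bigr => k _.
  by case: ifP => // kn; rewrite /G insubF // rmorph0 scale0r.
apply: (NK_trans (y := \sum_j lam (l j) *: y j)) => //.
rewrite -sumrB; apply: NK_sum => j _; rewrite -scalerBr; apply/NKZ/NK_sub_sym.
by case: (tP j).
Qed.

Let spans r := exists t : 'I_r -> N, (forall i, phi (t i) = t i) /\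
  forall x, exists c : 'I_r -> B, NK 1 (x - \sum_i c i *: t i).

Let spans_ex : exists r, spans r.
Proof.
have /choice[n /choice[l /choice[t tP]]] i := fixed_span (e i).
pose M := (\sum_i n i)%N.
pose J := ('I_m * 'I_M)%type.
pose P (k : 'I_#|{: J}|) : J := enum_val k.
exists #|{: J}|, (fun k => t (P k).1 (P k).2); split=> [k|x].
  by case: (tP (P k).1) => ->.
exists (fun k => kap (P k).1 x * lam (l (P k).1 (P k).2)).
have -> : \sum_k (kap (P k).1 x * lam (l (P k).1 (P k).2)) *: t (P k).1 (P k).2 =
   \sum_i kap i x *: \sum_(j < M) lam (l i j) *: t i j.
  transitivity (\sum_(p : J) (kap p.1 x * lam (l p.1 p.2)) *: t p.1 p.2).
    rewrite [RHS](reindex P) //=; apply: onW_bij; exact: enum_val_bij.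
  rewrite -(pair_big xpredT xpredT (fun i (j : 'I_M) => (kap i x * lam (l i j)) *: t i j)) /=.
  apply: eq_bigr => i _; rewrite scaler_sumr; apply: eq_bigr => j _.
  by rewrite scalerA.
rewrite {1}[x]ekap -sumrB; apply: NK_sum => i _; rewrite -scalerBr; apply: NKZ.
by case: (tP i) => _; apply; rewrite /M (bigD1 i) //= leq_addr.
Qed.

(** Artin's argument: normalize one coefficient to 1 and apply [phi] minus the identity. The result
    has smaller support, hence vanishes by induction; so all coefficients are fixed by the [q]-th
    power and lie in [F]. *)
Let frob_independent (J : finType) (w : J -> N) :
  (forall j, phi (w j) = w j) ->
  (forall c : J -> F, NK 1 (\sum_j iota (fA (c j)) *: w j) -> forall j, c j = 0) ->
  forall l : J -> E, NK 1 (\sum_j lam (l j) *: w j) -> forall j, l j = 0.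
Proof.
move=> wfix windep l; have [d] := ubnP #|[pred j | l j != 0]|.
elim: d l => // d IHd l ld Kl j0; apply: contrapT => /eqP lj0.
pose l' j := (l j0)^-1 * l j.
have Kl' : NK 1 (\sum_j lam (l' j) *: w j).
  have -> : \sum_j lam (l' j) *: w j = lam (l j0)^-1 *: \sum_j lam (l j) *: w j.
    by rewrite scaler_sumr; apply: eq_bigr => j _; rewrite rmorphM scalerA.
  exact: NKZ.
have l'j0 : l' j0 = 1 by rewrite /l' mulVf.
have Kd : NK 1 (\sum_j lam (l' j ^+ q - l' j) *: w j).
  have -> : \sum_j lam (l' j ^+ q - l' j) *: w j =
      phi (\sum_j lam (l' j) *: w j) - \sum_j lam (l' j) *: w j.
    rewrite linear_sum -sumrB; apply: eq_bigr => j _.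
    by rewrite linearZ /= sig_lam wfix rmorphB scalerBl.
  by apply: NKB => //; apply: NK_phi.
have lq j : l' j ^+ q = l' j.
  apply/eqP; rewrite -subr_eq0; apply/eqP; apply: IHd Kd j.
  rewrite -ltnS; apply: leq_trans ld; rewrite ltnS; apply: proper_card.
  apply/properP; split; last first.
    by exists j0; rewrite !inE // l'j0 expr1n subrr eqxx.
  apply/fintype.subsetP => j; rewrite !inE; apply: contra => /eqP lj.
  by rewrite /l' lj mulr0 expr0n gtn_eqF ?subr0 // ltnW // finNzRing_gt1.
have /choice[c cP] j := frob_fixed fE (lq j).
have := windep c; have -> : \sum_j iota (fA (c j)) *: w j = \sum_j lam (l' j) *: w j.
  by apply: eq_bigr => j _; rewrite iota_lam -cP.
move=> /(_ Kl' j0) c0; have := l'j0; rewrite cP c0 rmorph0 => /eqP.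
by rewrite eq_sym oner_eq0.
Qed.

Let maximal_inverse a : ~ v a -> exists b, v (1 - b * a).
Proof.
move=> va; pose J : set A := [set x | exists b, v (x - b * a)].
have [//|nJ1] := pselect (J 1).
have [_ _ vmax] := v_max; case: va; rewrite -(vmax J).
- by exists 1; rewrite mul1r subrr; apply: ideal0.
- split=> [|x y [b xb] [c yc]|z x [b xb]].
  + by exists 0; rewrite mul0r subrr; apply: ideal0.
  + by exists (b + c); rewrite mulrDl addrBB; apply: idealD.
  by exists (z * b); rewrite -mulrA -mulrBr; apply: idealM.
- by [].
by move=> x vx; exists 0; rewrite mul0r subr0.
Qed.

(** The [t i] form a family of fixed vectors of least size that spans modulo [v]. Minimality gives
    independence modulo [v]; generation and independence are then lifted through the filtration. *)
Lemma fixed_basis : exists r (t : 'I_r -> N),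
  [/\ forall i, phi (t i) = t i, forall x, exists c : 'I_r -> B, x = \sum_i c i *: t i &
      forall c : 'I_r -> B, \sum_i c i *: t i = 0 -> forall i, c i = 0].
Proof.
have ex : exists r, `[< spans r >] by have [r sr] := spans_ex; exists r; apply/asboolP.
have [r /asboolP[t [tfix tspan]] rmin] := ex_minnP ex.
(* A coefficient outside [v] is invertible modulo [v] and would allow [t i0] to be dropped. *)
have v_indep (a : 'I_r -> A) : NK 1 (\sum_i iota (a i) *: t i) -> forall i, v (a i).
  move=> Ka i0; apply: contrapT => /maximal_inverse[b vb].
  case: r t tfix tspan rmin a Ka i0 vb => [|r] t tfix tspan rmin a Ka i0 vb.
    by case: (i0).
  suff /asboolP/rmin : spans r by rewrite ltnn.
  exists (fun i => t (lift i0 i)); split=> [i|x]; first exact: tfix.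
  have [c Kx] := tspan x.
  exists (fun i => c (lift i0 i) - c i0 * iota (b * a (lift i0 i))).
  have -> : x - \sum_i (c (lift i0 i) - c i0 * iota (b * a (lift i0 i))) *: t (lift i0 i) =
     (x - \sum_i c i *: t i) + ((c i0 * iota b) *: (\sum_i iota (a i) *: t i) +
       (c i0 * iota (1 - b * a i0)) *: t i0).
    rewrite !(bigD1_ord i0) //=.
    have -> : \sum_i (c (lift i0 i) - c i0 * iota (b * a (lift i0 i))) *: t (lift i0 i) =
       \sum_i c (lift i0 i) *: t (lift i0 i) -
       (c i0 * iota b) *: \sum_i iota (a (lift i0 i)) *: t (lift i0 i).
      rewrite scaler_sumr -sumrB; apply: eq_bigr => i _.
      by rewrite scalerBl scalerA rmorphM mulrA.
    rewrite scalerDr scalerA rmorphB rmorph1 rmorphM mulrBr mulr1 mulrA scalerBl.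
    exact: drop_relation.
  by apply: NKD => //; apply: NKD; [apply: NKZ | apply: NKMl; apply: (idealM _ (iK 1)); apply: K1_iota].
(* Modulo [v] the coefficients are expanded in the [al k] over [E]. The vectors [iota (al k) *: t i]
   are again fixed, so that their independence over [F] gives independence over [E]. *)
have B_indep (c : 'I_r -> B) : NK 1 (\sum_i c i *: t i) -> forall i, K 1 (c i).
  move=> Kc; have /choice[l lP] i := K1_dense (c i).
  pose w (p : 'I_r * 'I_g) := iota (al p.2) *: t p.1.
  have wfix p : phi (w p) = w p by rewrite /w linearZ /= sig_iota tfix.
  have sumE (T : comNzRingType) (h : {rmorphism T -> B}) (b : 'I_r -> 'I_g -> T) :
      \sum_(p : 'I_r * 'I_g) h (b p.1 p.2) *: w p = \sum_i (\sum_k iota (al k) * h (b i k)) *: t i.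
    rewrite -(pair_big xpredT xpredT (fun i k => h (b i k) *: w (i, k))) /=.
    apply: eq_bigr => i _; rewrite scaler_suml; apply: eq_bigr => k _.
    by rewrite /w scalerA mulrC.
  have w_indep (d : 'I_r * 'I_g -> F) : NK 1 (\sum_p iota (fA (d p)) *: w p) ->
      forall p, d p = 0.
    move=> Kd p0.
    have := v_indep (fun i => \sum_k fA (d (i, k)) * al k).
    have -> : \sum_i iota (\sum_k fA (d (i, k)) * al k) *: t i =
      \sum_p iota (fA (d p)) *: w p.
      rewrite (eq_bigr (fun p : 'I_r * 'I_g => iota (fA (d (p.1, p.2))) *: w p)); last first.
        by move=> p1 _; rewrite -surjective_pairing.
      rewrite (sumE A iota (fun i k => fA (d (i, k)))); apply: eq_bigr => i _.
      by rewrite rmorph_sum; congr (_ *: _); apply: eq_bigr => k _; rewrite rmorphM mulrC.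
    move=> /(_ Kd p0.1) /(mu_v p0.2) => mu0.
    have mu_0 k : mu k 0 = 0 by apply: mu_v; apply: ideal0.
    have mu_sum k (b : 'I_g -> F) : mu k (\sum_j fA (b j) * al j) = b k.
      transitivity (\sum_j b j * mu k (al j)).
        apply: (big_ind2 (fun x y => mu k x = y)) => // [x1 x2 y1 y2 <- <-|j _].
          by have := mu_lin k 1 x1 y1; rewrite rmorph1 !mul1r.
        by rewrite -[fA _ * _]addr0 mu_lin mu_0 addr0.
      rewrite (bigD1 k) //= mu_al eqxx mulr1 big1 ?addr0 // => j /negbTE jk.
      by rewrite mu_al eq_sym jk mulr0.
    by move: mu0; rewrite mu_sum -surjective_pairing.
  have l0 : forall p, l p.1 p.2 = 0.
    apply: (frob_independent wfix w_indep).
    rewrite (sumE E lam l).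
    rewrite -(subrK (\sum_i c i *: t i) (\sum_i _ *: t i)).
    apply: NKD => //; rewrite -sumrB; apply: NK_sum => i _; rewrite -scalerBl.
    by apply: NKMl; apply: (ideal_sub_sym (iK 1) (lP i)).
  move=> i; have := lP i; rewrite big1 ?subr0 // => k _.
  by rewrite (l0 (i, k)) rmorph0 mulr0.
have step n x : NK n x -> exists c : 'I_r -> B, (forall i, K n (c i)) /\
    NK n.+1 (x - \sum_i c i *: t i).
  move=> Kx.
  pose Z : set B := [set k | forall z, exists c : 'I_r -> B, (forall i, K n (c i)) /\
      NK n.+1 (k *: z - \sum_i c i *: t i)].
  have KZ : K n `<=` Z.
    apply: ideal_gen_min.
      split=> [z|k k' Zk Zk' z|b k Zk z].
      - exists (fun=> 0); split=> [i|]; first exact: (ideal0 (iK n)).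
        rewrite scale0r big1 ?subrr; first exact: NK0.
        by move=> i _; rewrite scale0r.
      - have [c [Kc Pc]] := Zk z; have [d [Kd Pd]] := Zk' z.
        exists (fun i => c i + d i); split=> [i|]; first exact: (idealD (iK n)).
        rewrite scalerDl; under eq_bigr => i _ do rewrite scalerDl.
        by rewrite big_split addrBB; apply: NKD.
      by rewrite mulrC; have [c cP] := Zk (b *: z); exists c; rewrite -scalerA.
    move=> _ [a Ia <-] z; have [c Kc] := tspan z.
    exists (fun i => iota a * c i); split=> [i|]; first by apply: (idealMr _ (iK n)); apply: K_iota.
    have -> : iota a *: z - \sum_i (iota a * c i) *: t i = iota a *: (z - \sum_i c i *: t i).
      by rewrite scalerBr scaler_sumr; congr (_ - _); apply: eq_bigr => i _; rewrite scalerA.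
    by rewrite -addn1; apply: NKM => //; apply: K_iota.
  have /choice[c cP] i := KZ _ (Kx i) (e i).
  exists (fun j => \sum_i c i j); split=> [j|].
    by apply: ideal_sum => // i _; case: (cP i).
  under eq_bigr => j _ do rewrite scaler_suml.
  rewrite exchange_big {1}[x]ekap -sumrB; apply: NK_sum => i _.
  by case: (cP i).
have gen x : exists c : 'I_r -> B, x = \sum_i c i *: t i.
  have /choice[G GP] : forall nx : nat * N, exists c : 'I_r -> B,
      NK nx.1 nx.2 -> (forall i, K nx.1 (c i)) /\ NK nx.1.+1 (nx.2 - \sum_i c i *: t i).
    move=> [n z]; have [Kz|nK] := pselect (NK n z); last by exists (fun=> 0).
    by have [c cP] := step n z Kz; exists c.
  pose s := fix s n : 'I_r -> B := if n is p.+1 then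
    (fun i => s p i + G (p, x - \sum_j s p j *: t j) i) else (fun=> 0).
  have sP n : NK n (x - \sum_i s n i *: t i).
    elim: n => [|n IHn]; first exact: NK_00.
    have [_] := GP (n, x - \sum_i s n i *: t i) IHn.
    by rewrite -addrA -opprD -big_split /=; under eq_bigr => i _ do rewrite -scalerDl.
  have /choice[c cP] i : exists c, forall n, K n (c - s n i).
    apply: K_complete => n /=; rewrite [s n i + _]addrC addrK.
    by have [Kn _] := GP (n, x - \sum_i s n i *: t i) (sP n); apply: Kn.
  exists c; apply/eqP; rewrite -subr_eq0; apply/eqP/N_sep => n.
  apply: (NK_trans (sP n)); rewrite -sumrB; apply: NK_sum => i _.
  by rewrite -scalerBl; apply: NKMl; apply: (ideal_sub_sym (iK n) (cP i n)).
exists r, t; split=> // c ct0.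
(* The family [t] equals [DE] times itself, so that [DE] is the identity modulo [v]. A relation [c]
   satisfies [c D = 0], hence [c = c (1 - DE)], and by iteration [c] lies in every [K n]. *)
have /choice[Em EmP] i := gen (e i).
pose D j i : B := kap i (t j).
pose DE j k := \sum_i D j i * Em i k.
have tE j : t j = \sum_k DE j k *: t k.
  rewrite {1}[t j]ekap; under eq_bigr => i _ do rewrite {1}(EmP i) scaler_sumr.
  rewrite exchange_big; apply: eq_bigr => k _; rewrite /DE scaler_suml.
  by apply: eq_bigr => i _; rewrite scalerA.
have DE1 j k : K 1 ((j == k)%:R - DE j k).
  apply: (B_indep (fun k => (j == k)%:R - DE j k)) k.
  under eq_bigr => k _ do rewrite scalerBl.
  rewrite sumrB -tE (bigD1 j) //= eqxx scale1r big1 ?addr0 ?subrr; first exact: NK0.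
  by move=> k; rewrite eq_sym => /negbTE->; rewrite scale0r.
have cDE k : \sum_j c j * DE j k = 0.
  under eq_bigr => j _ do rewrite /DE mulr_sumr.
  rewrite exchange_big big1 // => i _.
  under eq_bigr => j _ do rewrite mulrA.
  rewrite -mulr_suml; have -> : \sum_j c j * D j i = kap i (\sum_j c j *: t j).
    by rewrite linear_sum; apply: eq_bigr => j _; rewrite linearZ.
  by rewrite ct0 linear0 mul0r.
have cE k : c k = \sum_j c j * ((j == k)%:R - DE j k).
  under eq_bigr => j _ do rewrite mulrBr.
  rewrite sumrB cDE subr0 (bigD1 k) //= eqxx mulr1 big1 ?addr0 // => j /negbTE->.
  by rewrite mulr0.
have cK n : forall i, K n (c i).
  elim: n => [|n IHn] i; first exact: K0.
  rewrite cE -addn1; apply: ideal_sum => // j _.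
  by apply: KM.
by move=> i; apply: K_sep => n; apply: cK.
Qed.

End FixedBasis.

(** * The Frobenius of the scalar extension *)

Lemma fraction_numden (R : idomainType) (z : {fraction R}) :
  exists u s : R, s != 0 /\ z = tofrac u / tofrac s.
Proof.
elim/quotW: z => x; exists (frac x).1, (frac x).2.
have d0 := denom_ratioP x; split=> //.
apply: (canRL (mulfK _)); first by rewrite tofrac_eq0.
unlock tofrac; rewrite -[LHS]FracField.pi_mul; apply/eqmodP => /=.
rewrite FracField.equivfE /FracField.mulf !numden_Ratio ?mulr1 ?oner_neq0 ?mulf_neq0 //.
by rewrite mulrC.
Qed.

Section SigmaFixed.
Context (F : finFieldType) (A : comNzRingType) (L : finFieldType).
Context (fA : {rmorphism F -> A}) (fL : {rmorphism F -> L}) (AL : scalarExt fA fL).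
Context (d : nat) (card_L : #|L| = (#|F| ^ d)%N).
Local Notation q := #|F|.

Lemma iter_sigma_extr n l : iter n (sigma AL) (extr AL l) = extr AL (l ^+ (q ^ n)).
Proof.
elim: n => [|n IHn] /=; first by rewrite expn0 expr1.
by rewrite IHn sigma_extr -exprM expnSr.
Qed.

Lemma iter_sigma_extl n a : iter n (sigma AL) (extl AL a) = extl AL a.
Proof. by elim: n => //= n ->; rewrite sigma_extl. Qed.

Lemma iter_sigmaM n x y :
  iter n (sigma AL) (x * y) = iter n (sigma AL) x * iter n (sigma AL) y.
Proof. by elim: n => //= n ->; rewrite rmorphM. Qed.

Lemma iter_sigma_sum n (I : finType) (G : I -> AL) :
  iter n (sigma AL) (\sum_i G i) = \sum_i iter n (sigma AL) (G i).
Proof. by elim: n => //= n ->; rewrite rmorph_sum. Qed.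

Lemma iter_sigma_id x : iter d (sigma AL) x = x.
Proof.
have [n [a [b ->]]] := tensor_span (ext_tensor AL) x.
rewrite iter_sigma_sum; apply: eq_bigr => k _.
by rewrite iter_sigmaM iter_sigma_extl iter_sigma_extr -card_L expf_card.
Qed.

Let d_gt0 : (0 < d)%N.
Proof. by have := finNzRing_gt1 L; rewrite card_L; case: d. Qed.

(** The trace polynomial has degree at most [q^(d-1)], less than the number of elements of [L]. *)
Lemma trace_nonzero : exists th : L, \sum_(i < d) th ^+ (q ^ i) != 0.
Proof.
have q1 : (1 < q)%N := finNzRing_gt1 F.
pose p : {poly L} := \sum_(i < d) 'X^(q ^ i).
have p0 : p != 0.
  apply/eqP => /polyP/(_ 1%N); rewrite coef0 coef_sum.
  rewrite (bigD1 (Ordinal d_gt0)) //= coefXn expn0 eqxx big1 => [|i].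
    by rewrite addr0 => /eqP; rewrite oner_eq0.
  rewrite -val_eqE /= coefXn => i0.
  by rewrite (_ : (1%N == (q ^ i)%N) = false) // ltn_eqF // -(expn0 q) ltn_exp2l // lt0n.
have sp : (size p <= (q ^ d.-1).+1)%N.
  apply: leq_trans (size_sum _ _ _) _; apply/bigmax_leqP => i _.
  by rewrite size_polyXn ltnS leq_exp2l // -ltnS prednK.
apply: contrapT => no.
have : (size (enum L) < size p)%N.
  apply: max_poly_roots p0 _ (enum_uniq _); apply/allP => th _.
  rewrite /root horner_sum; under eq_bigr => i _ do rewrite hornerXn.
  by apply: contrapT => /negP nz; apply: no; exists th.
rewrite -cardE card_L => H; have := leq_trans H sp.
by rewrite ltnS leq_exp2l // -ltnS prednK // ltnn.
Qed.

(** For [th] of nonzero trace, the sum of the conjugates of [extr AL th * x] is the trace of [th]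
    times [x]; computed on pure tensors it lies in [A], since traces lie in [F]. *)
Lemma sigma_fixed x : sigma AL x = x -> exists a, x = extl AL a.
Proof.
move=> sx; have [th] := trace_nonzero; set t := \sum_i _ => t0.
have trF (b : L) : exists c, \sum_(i < d) b ^+ (q ^ i) = fL c.
  have [|c cE] := frob_fixed fL (x := \sum_(i < d) b ^+ (q ^ i)); last by exists c.
  rewrite -[in LHS](expn1 q) (frob_sum fL); under eq_bigr => i _ do rewrite expn1 (frobX F).
  rewrite -(prednK d_gt0) big_ord_recr [RHS]big_ord_recl /= prednK // addrC.
  by rewrite -card_L expf_card expn0 expr1.
have [c0 tE] := trF th; have c00 : c0 != 0.
  by apply: contraNneq t0 => c00; rewrite /t tE c00 rmorph0.
have [n [a [b xE]]] := tensor_span (ext_tensor AL) x.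
have /choice[c cE] k := trF (th * b k).
have [cc _] := ext_tensor AL.
have itx i : iter i (sigma AL) x = x by elim: i => //= i ->.
have E : \sum_(i < d) iter i (sigma AL) (extr AL th * x) = extr AL t * x.
  under eq_bigr => i _ do rewrite iter_sigmaM itx iter_sigma_extr.
  by rewrite -mulr_suml -rmorph_sum.
have E2 : \sum_(i < d) iter i (sigma AL) (extr AL th * x) =
    extl AL (\sum_k a k * fA (c k)).
  rewrite {1}xE mulr_sumr.
  under eq_bigr => i _ do rewrite iter_sigma_sum.
  rewrite exchange_big rmorph_sum; apply: eq_bigr => k _ /=.
  rewrite rmorphM cc -cE rmorph_sum mulr_sumr; apply: eq_bigr => i _.
  rewrite mulrCA iter_sigmaM iter_sigma_extl; congr (_ * _).
  by rewrite -rmorphM iter_sigma_extr.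
exists (fA c0^-1 * \sum_k a k * fA (c k)).
rewrite rmorphM -E2 E /t tE -cc mulrA -!rmorphM mulVf // !rmorph1.
by rewrite mul1r.
Qed.

End SigmaFixed.

(** * Orders at the place above infinity *)

Section PlaceAbove.
Context (F : finFieldType) (C : curve F) (oo : place (const C)).
Hypothesis oo_rational : rational_place oo.
Context (A : coordRing oo) (L : fieldType) (fL : {rmorphism F -> L}).
Context (AL : scalarExt (coord_const A) fL) (ooL : placeAbove AL).
Local Notation fA := (coord_const A).

(** If [extl AL a] vanished, the placeholder order of zero would give [a] order 0 at [oo], so that
    [a] would be a constant; but nonzero constants remain units. *)
Lemma extl_neq0 a : a != 0 -> extl AL a != 0.
Proof.
move=> a0; apply/eqP => ea.
have oa : oo (coord_fun A a) = 0 by rewrite -(place_aboveP ooL) ea tofrac0 Defs.ord0.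
have [|c [aE|]] := leading_coeff oo_rational a0 (oner_neq0 A).
- by rewrite /pole_order oa rmorph1 place1.
- rewrite mulr1 in aE; have c0 : c != 0 by apply: contraNneq a0 => c0; rewrite aE c0 rmorph0.
  have [cc _] := ext_tensor AL.
  move/eqP: ea; rewrite aE cc => /eqP ec.
  have := congr1 (fun z => extr AL (fL c^-1) * z) ec.
  by rewrite mulr0 -!rmorphM mulVf // !rmorph1 => /eqP; rewrite oner_eq0.
by rewrite {2}/pole_order oa ltn0.
Qed.

Lemma extl_inj : injective (extl AL).
Proof.
move=> a b /eqP; rewrite -subr_eq0 -rmorphB => ab; apply/eqP; rewrite -subr_eq0.
by apply: contraTT ab; apply: extl_neq0.
Qed.

Definition free_over n (b : 'I_n -> L) :=
  forall c : 'I_n -> F, \sum_k fL (c k) * b k = 0 -> forall k, c k = 0.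

(** In a representation of least length the [b k] are free, since a dependence would shorten it. *)
Lemma tensor_free_span x : exists n (a : 'I_n -> A) (b : 'I_n -> L),
  free_over b /\ x = \sum_k extl AL (a k) * extr AL (b k).
Proof.
have ex : exists n, `[< exists (a : 'I_n -> A) (b : 'I_n -> L),
    x = \sum_k extl AL (a k) * extr AL (b k) >].
  by have [n [a [b xE]]] := tensor_span (ext_tensor AL) x; exists n; apply/asboolP; exists a, b.
have [n /asboolP[a [b xE]] nmin] := ex_minnP ex.
exists n, a, b; split=> // c c0 k0; apply: contrapT => /eqP ck0.
case: n a b xE nmin c c0 k0 ck0 => [|n] a b xE nmin c c0 k0 ck0; first by case: (k0).
suff /asboolP/nmin : exists (a : 'I_n -> A) (b : 'I_n -> L),
    x = \sum_k extl AL (a k) * extr AL (b k) by rewrite ltnn.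
exists (fun k => a (lift k0 k) - a k0 * fA (c (lift k0 k) / c k0)),
  (fun k => b (lift k0 k)).
have [cc _] := ext_tensor AL.
have bE : b k0 = - \sum_k fL (c (lift k0 k) / c k0) * b (lift k0 k).
  move: c0; rewrite (bigD1_ord k0) //= => /eqP; rewrite addr_eq0 => /eqP c0.
  have f0 : fL (c k0) != 0 by rewrite fmorph_eq0.
  apply: (mulfI f0); rewrite c0 mulrN mulr_sumr; congr (- _).
  by apply: eq_bigr => k _; rewrite mulrA -rmorphM [c k0 * _]mulrC divfK.
rewrite xE (bigD1_ord k0) //= bE rmorphN mulrN rmorph_sum mulr_sumr addrC -sumrB.
apply: eq_bigr => k _; rewrite rmorphB mulrBl; congr (_ - _).
by rewrite !rmorphM !cc !mulrA.
Qed.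

(** The leading coefficients [c k] relative to [a k0] combine to the factor [l], which is nonzero
    because [c k0 = 1]; the rest [y] has larger order. *)
Lemma place_above_free n (a : 'I_n -> A) (b : 'I_n -> L) k0 : free_over b -> a k0 != 0 ->
  (forall k, a k != 0 -> oo (coord_fun A (a k0)) <= oo (coord_fun A (a k))) ->
  let x := \sum_k extl AL (a k) * extr AL (b k) in
  x != 0 /\ ooL (tofrac x) = oo (coord_fun A (a k0)).
Proof.
move=> bfree ak0 kmin x; set m := oo _.
have f0 : coord_fun A (a k0) != 0 by rewrite coord_fun_eq0.
have [cc _] := ext_tensor AL.
have /choice[c cP] k : exists c, (k = k0 -> c = 1) /\
    vge ooL (m + 1) (tofrac (extl AL (a k - fA c * a k0))).
  have vE (y : A) : vge oo (m + 1) (coord_fun A y) -> vge ooL (m + 1) (tofrac (extl AL y)).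
    by rewrite /vge place_aboveP coord_fun_eq0 => /orP[/eqP->|->]; rewrite ?rmorph0 ?tofrac0 ?eqxx ?orbT.
  have [kk0|kk0] := eqVneq k k0.
    by exists 1; split=> //; apply: vE; rewrite kk0 rmorph1 mul1r subrr rmorph0 vge0.
  have [a0|a0] := eqVneq (a k) 0.
    exists 0; split; first by move=> E; rewrite E eqxx in kk0.
    by apply: vE; rewrite a0 rmorph0 mul0r subrr rmorph0 vge0.
  have fk0 : coord_fun A (a k) != 0 by rewrite coord_fun_eq0.
  have [|c cE] := oo_rational (x := coord_fun A (a k) / coord_fun A (a k0)).
    by rewrite ordM ?invr_eq0 // placeV subr_ge0; apply: kmin.
  exists c; split; first by move=> E; rewrite E eqxx in kk0.
  apply: vE; rewrite rmorphB rmorphM coord_fun_const.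
  have -> : coord_fun A (a k) - const C c * coord_fun A (a k0) =
     (coord_fun A (a k) / coord_fun A (a k0) - const C c) * coord_fun A (a k0).
    by rewrite mulrBl divfK.
  rewrite addrC; apply: vgeM; last by rewrite vgeE.
  case: cE => [->|c_gt0]; first by rewrite subrr vge0.
  by rewrite /vge -gtz0_ge1 c_gt0 orbT.
pose l := \sum_k fL (c k) * b k.
have l0 : l != 0.
  apply/eqP => /bfree/(_ k0); rewrite (proj1 (cP k0)) // => /eqP.
  by rewrite oner_eq0.
pose y := \sum_k extl AL (a k - fA (c k) * a k0) * extr AL (b k).
have xE : x = extl AL (a k0) * extr AL l + y.
  rewrite /l rmorph_sum mulr_sumr -big_split; apply: eq_bigr => k _ /=.
  by rewrite rmorphB !rmorphM cc; ring.
have t1 : tofrac (extl AL (a k0)) != 0 by rewrite tofrac_eq0 extl_neq0.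
have t2 : tofrac (extr AL l) != 0.
  by rewrite -[tofrac _]/(const_ext AL l) fmorph_eq0.
have ul : ooL (tofrac (extl AL (a k0) * extr AL l)) = m.
  rewrite tofracM ordM // place_aboveP -[tofrac (extr AL l)]/(const_ext AL l).
  by rewrite ord_const addr0.
have [||s0 sE] := @place_dom _ _ _ ooL (tofrac (extl AL (a k0) * extr AL l)) (tofrac y).
- by rewrite tofracM mulf_neq0.
- rewrite ul rmorph_sum; apply: vge_sum => k _; rewrite rmorphM -[m + 1]addr0.
  apply: vgeM; first by case: (cP k).
  exact: vge_const.
by rewrite -tofracD -xE tofrac_eq0 ul in s0 sE.
Qed.

(** The order is the least order of the [a k] in a free representation, and the [q]-th powers of the
    [b k] are again free over [F]. *)
Lemma place_above_sigma x : ooL (tofrac (sigma AL x)) = ooL (tofrac x).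
Proof.
have [n [a [b [bfree ->]]]] := tensor_free_span x.
have sE : sigma AL (\sum_k extl AL (a k) * extr AL (b k)) =
    \sum_k extl AL (a k) * extr AL (b k ^+ #|F|).
  by rewrite rmorph_sum; apply: eq_bigr => k _; rewrite rmorphM sigma_extl sigma_extr.
have bfree' : free_over (fun k => b k ^+ #|F|).
  move=> c c0; apply: bfree; apply/eqP.
  suff : (\sum_k fL (c k) * b k) ^+ (#|F| ^ 1) == 0 by rewrite expf_eq0 => /andP[].
  rewrite (frob_sum fL); apply/eqP; rewrite -[RHS]c0; apply: eq_bigr => k _.
  by rewrite exprMn (frob_const fL) expn1.
have [k0 ak0|a0] := pickP (fun k => a k != 0); last first.
  by rewrite sE !big1 // => k _; have /negbFE/eqP-> := a0 k; rewrite rmorph0 mul0r.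
pose k1 := [arg min_(k < k0 | a k != 0) oo (coord_fun A (a k))]%O.
have [ak1 kmin] : a k1 != 0 /\ forall k, a k != 0 -> oo (coord_fun A (a k1)) <= oo (coord_fun A (a k)).
  by rewrite /k1; case: arg_minP.
have [_ E1] := place_above_free bfree ak1 kmin.
have [_ E2] := place_above_free bfree' ak1 kmin.
by rewrite sE E1 E2.
Qed.

Lemma place_above_sK (sK : {rmorphism {fraction AL} -> {fraction AL}}) :
  (forall a, sK (tofrac a) = tofrac (sigma AL a)) -> forall z, ooL (sK z) = ooL z.
Proof.
move=> sKE z; have [u [s [s0 ->]]] := fraction_numden z.
have [->|u0] := eqVneq u 0; first by rewrite tofrac0 mul0r rmorph0.
have tu : tofrac u != 0 by rewrite tofrac_eq0.
have ts : tofrac s != 0 by rewrite tofrac_eq0.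
have su : sK (tofrac u) != 0 by rewrite fmorph_eq0.
have ss : sK (tofrac s) != 0 by rewrite fmorph_eq0.
rewrite fmorph_div !ordM ?invr_eq0 // !placeV !sKE !place_above_sigma //.
Qed.

End PlaceAbove.

(** * Dual bases of locally free modules *)

Section LocallyFree.
Context (R : idomainType) (M : lmodType R).

(** Powers of elements that generate the unit ideal generate it too. This is the gluing device: [J]
    may be the ideal of scalars for which a global statement holds. *)
Lemma radical_unit (S : comNzRingType) (J : set S) n (f g : 'I_n -> S) : is_ideal J ->
  \sum_j g j * f j = 1 -> (forall j, exists N, J (f j ^+ N)) -> J 1.
Proof.
move=> iJ gf1 Jf.
suff [N] : exists N, J ((\sum_j g j * f j) ^+ N) by rewrite gf1 expr1n.
apply: (big_ind (fun x => exists N, J (x ^+ N))).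
- by exists 1%N; rewrite expr1; apply: ideal0.
- move=> x y [N1 J1] [N2 J2]; exists (N1 + N2)%N; rewrite exprDn.
  apply: ideal_sum => // i _; rewrite -mulr_natr; apply: idealMr => //.
  have [N2i|iN2] := leqP N2 i.
    by rewrite -(subnK N2i) [y ^+ _]exprD; apply: (idealM _ iJ (idealM _ iJ J2)).
  have -> : (N1 + N2 - i = (N2 - i) + N1)%N by lia.
  by rewrite exprD; apply: (idealMr _ iJ (idealM _ iJ J1)).
move=> j _; have [N JN] := Jf j; exists N.
by rewrite exprMn; apply: idealM.
Qed.

(** Local coordinates become functionals on [M] after multiplication by a power of [f j], uniform
    because [M] is finitely generated; a combination of these powers equal to 1 glues them. *)
Lemma locally_free_dual_basis r : locally_free r M ->
  exists m (e : 'I_m -> M) (kap : 'I_m -> {linear M -> R^o}),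
    forall x, x = \sum_i kap i x *: e i.
Proof.
move=> [n [f [g [gf1 loc]]]].
have {loc} /choice[e eP] : forall j, exists e : 'I_r -> M,
    (forall x, exists N (c : 'I_r -> R), f j ^+ N *: x = \sum_i c i *: e i) /\
    (forall c : 'I_r -> R, \sum_i c i *: e i = 0 ->
       exists N, forall i, f j ^+ N * c i = 0) by [].
have gen x : exists c : 'I_n -> 'I_r -> R, x = \sum_j \sum_i c j i *: e j i.
  pose J := [set b : R | exists c : 'I_n -> 'I_r -> R, b *: x = \sum_j \sum_i c j i *: e j i].
  have iJ : is_ideal J.
    split=> [|a b [c ac] [d bd]|a b [c bc]].
    - exists (fun _ _ => 0); rewrite scale0r big1 // => j _; rewrite big1 // => i _.
      by rewrite scale0r.
    - exists (fun j i => c j i + d j i); rewrite scalerDl ac bd -big_split.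
      apply: eq_bigr => j _; rewrite -big_split; apply: eq_bigr => i _ /=.
      by rewrite scalerDl.
    exists (fun j i => a * c j i); rewrite -scalerA bc scaler_sumr.
    apply: eq_bigr => j _; rewrite scaler_sumr; apply: eq_bigr => i _.
    by rewrite scalerA.
  have [|c cE] := radical_unit iJ gf1; last by exists c; rewrite -cE scale1r.
  move=> j; have [N [c cE]] := (eP j).1 x; exists N.
  exists (fun j' i => if j' == j then c i else 0).
  rewrite (bigD1 j) //= eqxx -cE big1 ?addr0 // => j' /negbTE->.
  by rewrite big1 // => i _; rewrite scale0r.
have coord j : exists N (kap : 'I_r -> {linear M -> R^o}), forall x,
    f j ^+ N *: x = \sum_i kap i x *: e j i.
  (* For [f j = 0] the chart is empty and local coordinates are not unique; otherwise the domain
     property makes them unique, hence linear. *)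
  have [fj0|fj0] := eqVneq (f j) 0.
    exists 1%N, (fun=> \0 : {linear M -> R^o}) => x.
    by rewrite fj0 expr1 scale0r big1 // => i _; rewrite scale0r.
  have indep (c : 'I_r -> R) : \sum_i c i *: e j i = 0 -> forall i, c i = 0.
    move=> /(eP j).2[N fc] i; have /eqP := fc i.
    by rewrite mulf_eq0 expf_eq0 (negbTE fj0) andbF /= => /eqP.
  have /choice[N0 /choice[c0 cE]] : forall p : 'I_n * 'I_r, exists N (c : 'I_r -> R),
    f j ^+ N *: e p.1 p.2 = \sum_i c i *: e j i by move=> p; apply: (eP j).1.
  pose N := (\sum_p N0 p)%N.
  have exc x : exists c : 'I_r -> R, f j ^+ N *: x = \sum_i c i *: e j i.
    have [c xE] := gen x.
    exists (fun i => \sum_k \sum_l c k l * (f j ^+ (N - N0 (k, l)) * c0 (k, l) i)).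
    rewrite xE scaler_sumr.
    under [RHS]eq_bigr => i _ do rewrite scaler_suml.
    rewrite [RHS]exchange_big; apply: eq_bigr => k _ /=.
    rewrite scaler_sumr; under [RHS]eq_bigr => i _ do rewrite scaler_suml.
    rewrite [RHS]exchange_big; apply: eq_bigr => l _ /=.
    have NN : (N0 (k, l) <= N)%N by rewrite /N (bigD1 (k, l)) //= leq_addr.
    have -> : f j ^+ N *: (c k l *: e k l) =
       (c k l * f j ^+ (N - N0 (k, l))) *: (f j ^+ N0 (k, l) *: e k l).
      by rewrite !scalerA -{1}(subnK NN) exprD; congr (_ *: _); ring.
    rewrite (cE (k, l)) scaler_sumr; apply: eq_bigr => i _.
    by rewrite scalerA mulrA.
  have /choice[k kE] := exc.
  have klin i : linear_for *%R (fun x => k x i : R^o).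
    move=> a x y; apply/eqP; rewrite -subr_eq0; apply/eqP.
    apply: (indep (fun i => k (a *: x + y) i - (a * k x i + k y i))).
    under eq_bigr => l _ do rewrite scalerBl scalerDl -scalerA.
    rewrite sumrB big_split /= -scaler_sumr -!kE scalerDr scalerA mulrC -scalerA.
    by rewrite subrr.
  pose kap i : {linear M -> R^o} :=
    HB.pack (fun x => k x i : R^o) (@GRing.isLinear.Build R M R^o *%R (fun x => k x i : R^o) (klin i)).
  by exists N, kap.
have {coord} /choice[N /choice[kap kapE]] := coord.
pose I := [set b | exists g' : 'I_n -> R, b = \sum_j g' j * f j ^+ N j].
have iI : is_ideal I.
  split=> [|_ _ [a ->] [b ->]|a _ [b ->]].
  + by exists (fun=> 0); rewrite big1 // => j _; rewrite mul0r.
  + exists (fun j => a j + b j); rewrite -big_split; apply: eq_bigr => j _.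
    by rewrite mulrDl.
  exists (fun j => a * b j); rewrite mulr_sumr; apply: eq_bigr => j _.
  by rewrite mulrA.
have [|g' g'1] := radical_unit iI gf1.
  move=> j; exists (N j); exists (fun j' => (j' == j)%:R).
  rewrite (bigD1 j) //= eqxx mul1r big1 ?addr0 // => j' /negbTE->.
  by rewrite mul0r.
pose J := ('I_n * 'I_r)%type.
pose P (a : 'I_#|{: J}|) : J := enum_val a.
have mlin (p : J) : linear_for *%R (fun x => g' p.1 * kap p.1 p.2 x : R^o).
  by move=> a x y; rewrite linearP /= mulrDr; congr (_ + _); rewrite mulrCA.
pose kk (p : J) : {linear M -> R^o} :=
  HB.pack (fun x => g' p.1 * kap p.1 p.2 x : R^o)
    (@GRing.isLinear.Build R M R^o *%R (fun x => g' p.1 * kap p.1 p.2 x : R^o) (mlin p)).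
exists #|{: J}|, (fun a => e (P a).1 (P a).2), (fun a => kk (P a)) => x /=.
transitivity (\sum_(p : J) (g' p.1 * kap p.1 p.2 x) *: e p.1 p.2); last first.
  by rewrite [LHS](reindex P) //=; apply: onW_bij; exact: enum_val_bij.
rewrite -(pair_big xpredT xpredT (fun j i => (g' j * kap j i x) *: e j i)) /=.
rewrite -{1}[x]scale1r g'1 scaler_suml; apply: eq_bigr => j _.
rewrite -scalerA kapE scaler_sumr; apply: eq_bigr => i _.
by rewrite scalerA.
Qed.

End LocallyFree.

(** * The Tate module *)

Section Tate.
Context (F : finFieldType) (C : curve F) (oo : place (const C)).
Hypothesis oo_rational : rational_place oo.
Context (A : coordRing oo) (L : finFieldType) (fL : {rmorphism F -> L}).
Context (AL : scalarExt (coord_const A) fL).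
Context (c : {rmorphism A -> L}) (v : set A).
Hypotheses (v_max : maximal_ideal v) (v_eps : v <> [set a | c a = 0]).
Local Notation q := #|F|.
Local Notation fA := (coord_const A).

Let iv : is_ideal v. Proof. by case: v_max. Qed.

(** A maximal [v] inside the kernel of [c] would equal it. The element serves twice: its powers have
    finite quotients, and [extl AL a - extr AL (c a)] is a unit modulo [v]. *)
Lemma away_from_characteristic : exists2 a, v a & c a != 0.
Proof.
apply: contrapT => no; apply: v_eps; apply/esym.
have [_ _ vmax] := v_max; apply: vmax.
- split=> [|x y /= cx cy|a x /= cx]; first exact: rmorph0.
    by rewrite rmorphD cx cy addr0.
  by rewrite rmorphM cx mulr0.
- by rewrite /= rmorph1; apply/eqP/oner_neq0.
move=> x vx; apply/eqP; apply: contraT => cx; case: no; by exists x.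
Qed.

Lemma vpow_quotient n : exists (T : finType) (f : T -> A) (a : A),
  ideal_exp v n a /\ forall x, exists u y, x = f u + y * a.
Proof.
have [a va ca] := away_from_characteristic.
have a0 : a ^+ n != 0.
  apply: contraTneq ca => an.
  by apply/negPn; have := congr1 c an; rewrite rmorphXn rmorph0 => /eqP; rewrite expf_eq0 => /andP[].
have [T [f fP]] := principal_quotient_finite oo_rational a0.
by exists T, f, (a ^+ n); split=> //; apply: ideal_expX.
Qed.

Lemma vpow_fg n : finitely_generated (ideal_exp v n).
Proof.
have [T [f [a [va fP]]]] := vpow_quotient n.
exact: finite_quotient_fg (ideal_exp_ideal _ _) va fP.
Qed.

Lemma vpow_basis n : exists g (al : 'I_g -> A) (mu : 'I_g -> A -> F),
  [/\ forall k c x y, mu k (fA c * x + y) = c * mu k x + mu k y,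
      forall k x, ideal_exp v n x -> mu k x = 0,
      forall k l, mu k (al l) = (k == l)%:R &
      forall x, ideal_exp v n (x - \sum_k fA (mu k x) * al k)].
Proof.
have [T [f [a [va fP]]]] := vpow_quotient n.
have iE := ideal_exp_ideal v n.
apply: (quotient_basis fA iE (f := f)) => x.
have [u [y ->]] := fP x; exists u; rewrite addrAC subrr add0r.
exact: idealM.
Qed.

Context (D : vadicRings AL v).
Local Notation B := (AvLsep D).
Local Notation AS := (ALsep D).
Definition vadic_iota : {rmorphism A -> B} := (toAvLsep D \o extl AS).
Definition vadic_lam : {rmorphism Lsep D -> B} := (toAvLsep D \o extr AS).
Definition vadic_const : {rmorphism F -> Lsep D} := (sep_in (Lsep D) \o fL).
Local Notation iota := vadic_iota.
Local Notation lam := vadic_lam.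
Local Notation fE := vadic_const.
Local Notation K := (vfilt iota v).
Let w := ideal_ext (extl AS) v.

Let iK n : is_ideal (K n). Proof. exact: ideal_ext_ideal. Qed.

Lemma ext_pow_fg n : finitely_generated (ideal_exp w n).
Proof.
have [m [g [gv gP]]] := vpow_fg n.
exists m, (fun j => extl AS (g j)); split=> [j|x].
  exact: ideal_exp_ext.
move=> /ideal_ext_exp; set J := [set x | exists c : 'I_m -> AS, x = \sum_j c j * extl AS (g j)].
suff H : ideal_ext (extl AS) (ideal_exp v n) `<=` J by move/H.
apply: ideal_gen_min.
  split=> [|_ _ [a ->] [b ->]|a _ [b ->]].
  - by exists (fun=> 0); rewrite big1 // => j _; rewrite mul0r.
  - exists (fun j => a j + b j); rewrite -big_split; apply: eq_bigr => j _.
    by rewrite mulrDl.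
  exists (fun j => a * b j); rewrite mulr_sumr; apply: eq_bigr => j _.
  by rewrite mulrA.
move=> _ [a /gP[b ->] <-]; exists (fun j => extl AS (b j)).
by rewrite rmorph_sum; apply: eq_bigr => j _; rewrite rmorphM.
Qed.

Lemma vfiltE n : ideal_ext (toAvLsep D) (ideal_exp w n) = K n.
Proof.
apply/seteqP; split; last first.
  apply: ideal_gen_min; first exact: ideal_ext_ideal.
  move=> _ [a Ia <-]; apply: (@ideal_ext_mem _ _ (toAvLsep D) _ (extl AS a)).
  exact: ideal_exp_ext.
apply: ideal_gen_min => // _ [x /ideal_ext_exp Ix <-]; move: x Ix.
apply: (ideal_gen_min (J := [set x | K n (toAvLsep D x)])).
  split=> [|a b Ja Jb|a b Jb] /=.
  - by rewrite rmorph0; apply: (ideal0 (iK n)).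
  - by rewrite rmorphD; apply: (idealD (iK n)).
  by rewrite rmorphM; apply: (idealM _ (iK n)).
by move=> _ [a Ia <-]; apply: (@ideal_ext_mem _ _ iota).
Qed.

Lemma vadic_filtration :
  [/\ forall n x, K n (toAvLsep D x) -> ideal_ext (extl AS) (ideal_exp v n) x,
      forall n x, exists a, K n (x - toAvLsep D a),
      forall x, (forall n, K n x) -> x = 0 &
      forall u : nat -> B, (forall n, K n (u n.+1 - u n)) ->
        exists x, forall n, K n (x - u n)].
Proof.
have [H1 H2 H3 H4] := completion_filtration ext_pow_fg (toAvLsepP D).
split=> [n x|n x|x Kx|u du].
- by rewrite -vfiltE => /H1/ideal_ext_exp.
- by rewrite -vfiltE; apply: H2.
- by apply: H3 => n; rewrite vfiltE.
by have [|x xP] := H4 u => [n|]; [rewrite vfiltE | exists x => n; rewrite -vfiltE].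
Qed.

Lemma vadic_quotient n g (al : 'I_g -> A) (mu : 'I_g -> A -> F) :
  (forall k c x y, mu k (fA c * x + y) = c * mu k x + mu k y) ->
  (forall k x, ideal_exp v n x -> mu k x = 0) ->
  (forall k l, mu k (al l) = (k == l)%:R) ->
  (forall x, ideal_exp v n (x - \sum_k fA (mu k x) * al k)) ->
  forall x, exists l : 'I_g -> Lsep D, K n (x - \sum_k iota (al k) * lam (l k)).
Proof.
move=> mulin muI mual muE x.
have [h [hD hp hI hE]] := tensor_quotient (ext_tensor AS) (ideal_exp_ideal v n) mulin muI mual muE.
have [_ dense _ _] := vadic_filtration; have [y Ky] := dense n x.
exists (fun k => h k y); apply: (ideal_sub_trans (y := toAvLsep D y) (iK n)) => //.
have -> : \sum_k iota (al k) * lam (h k y) = toAvLsep D (\sum_k extl AS (al k) * extr AS (h k y)).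
  by rewrite rmorph_sum; apply: eq_bigr => k _; rewrite rmorphM.
rewrite -rmorphB -vfiltE; apply: ideal_ext_mem.
have := hE y; move: (y - _) => z.
apply: (ideal_gen_min (J := ideal_exp w n)); first exact: ideal_exp_ideal.
by move=> _ [a Ia <-]; apply: ideal_exp_ext.
Qed.

Lemma vadic_iota_lam a : iota (fA a) = lam (fE a).
Proof. by have [cc _] := ext_tensor AS; rewrite /= cc. Qed.

Lemma sigmav_iota a : sigmav D (iota a) = iota a.
Proof. by rewrite /= sigmavP sigma_extl. Qed.

Lemma sigmav_lam l : sigmav D (lam l) = lam (l ^+ q).
Proof. by rewrite /= sigmavP sigma_extr. Qed.

Lemma vfilt_sigma n x : K n x -> K n (sigmav D x).
Proof.
apply: (ideal_gen_min (J := [set x | K n (sigmav D x)])).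
  split=> [|a b Ja Jb|a b Jb] /=; first by rewrite rmorph0; apply: (ideal0 (iK n)).
    by rewrite rmorphD; apply: (idealD (iK n)).
  by rewrite rmorphM; apply: (idealM _ (iK n)).
by move=> _ [a Ia <-] /=; rewrite -/(iota a) sigmav_iota; apply: ideal_ext_mem.
Qed.

(** The coordinates of [a] for a basis of [A/v^n] can be read off after tensoring with the separable
    closure. *)
Lemma vfilt_iota n a : K n (iota a) -> ideal_exp v n a.
Proof.
have [H1 _ _ _] := vadic_filtration; move=> /H1 Ka.
have [g [al [mu [mulin muI mual muE]]]] := vpow_basis n.
have [h [hD hp hI hE]] := tensor_quotient (ext_tensor AS) (ideal_exp_ideal v n) mulin muI mual muE.
have mu0 k : mu k a = 0.
  have := hI k _ Ka; rewrite -[extl AS a]mulr1 -(rmorph1 (extr AS)) hp mulr1 => /eqP.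
  by rewrite fmorph_eq0 => /eqP.
by have := muE a; rewrite big1 ?subr0 // => k _; rewrite mu0 rmorph0 mul0r.
Qed.

Lemma AvAvLsep_iota a : AvAvLsep D (toAv D a) = iota a.
Proof. exact: AvAvLsepP. Qed.

Lemma AvAvLsep_vfilt n x : ideal_ext (toAv D) (ideal_exp v n) x -> K n (AvAvLsep D x).
Proof.
apply: (ideal_gen_min (J := [set x | K n (AvAvLsep D x)])).
  split=> [|a b Ja Jb|a b Jb] /=; first by rewrite rmorph0; apply: (ideal0 (iK n)).
    by rewrite rmorphD; apply: (idealD (iK n)).
  by rewrite rmorphM; apply: (idealM _ (iK n)).
by move=> _ [a Ia <-] /=; rewrite AvAvLsep_iota; apply: ideal_ext_mem.
Qed.

Lemma AvAvLsep_inj : injective (AvAvLsep D).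
Proof.
have [H1 H2 H3 H4] := completion_filtration vpow_fg (toAvP D).
have iJ n : is_ideal (ideal_ext (toAv D) (ideal_exp v n)) by apply: ideal_ext_ideal.
move=> x y xy; apply/eqP; rewrite -subr_eq0; apply/eqP/H3 => n.
have [a Ka] := H2 n (x - y).
rewrite -(subrK (toAv D a) (x - y)); apply: (idealD (iJ n)) => //.
apply: ideal_ext_mem; apply: vfilt_iota.
have := AvAvLsep_vfilt Ka; rewrite rmorphB AvAvLsep_iota rmorphB xy subrr sub0r => Kna.
by rewrite -[iota a]opprK; apply: (idealN (iK n)).
Qed.

(** Modulo [v^n] the coordinates of [b] are fixed by the [q]-th power, hence lie in [F]; the
    resulting approximations in [A] converge in [A_v]. *)
Lemma sigmav_fixed b : sigmav D b = b -> exists a, b = AvAvLsep D a.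
Proof.
move=> sb; have [H1 H2 H3 H4] := vadic_filtration.
have /choice[a aP] n : exists a, K n (b - iota a).
  have [y Ky] := H2 n b.
  have [g [al [mu [mulin muI mual muE]]]] := vpow_basis n.
  have [h [hD hp hI hE]] := tensor_quotient (ext_tensor AS) (ideal_exp_ideal v n) mulin muI mual muE.
  have Ksy : K n (toAvLsep D (sigma AS y - y)).
    rewrite rmorphB -sigmavP.
    have -> : sigmav D (toAvLsep D y) - toAvLsep D y =
       (b - toAvLsep D y) - sigmav D (b - toAvLsep D y) by rewrite rmorphB sb; ring.
    by apply: (idealB (iK n)) => //; apply: vfilt_sigma.
  have hB k x z : h k (x - z) = h k x - h k z.
    by apply/eqP; rewrite eq_sym subr_eq -hD subrK.
  have h0 k : h k 0 = 0 by rewrite -(subrr 0) hB subrr.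
  have hsum k (I : finType) (G : I -> AS) : h k (\sum_i G i) = \sum_i h k (G i).
    exact: (big_morph _ (hD k) (h0 k)).
  have hs k : h k (sigma AS y) = h k y ^+ q.
    have [m [a [l ->]]] := tensor_span (ext_tensor AS) y.
    rewrite rmorph_sum !hsum -[q]expn1 (frob_sum fE) expn1; apply: eq_bigr => j _.
    rewrite rmorphM sigma_extl sigma_extr !hp exprMn; congr (_ * _).
    by rewrite -[q]expn1 -[LHS](frob_const fE 1).
  have /choice[cf cP] k : exists cc, h k y = fE cc.
    apply: frob_fixed; rewrite -hs; apply/eqP; rewrite -subr_eq0 -hB.
    by apply/eqP/hI/H1.
  exists (\sum_k fA (cf k) * al k).
  apply: (ideal_sub_trans (y := toAvLsep D y) (iK n)) => //.
  rewrite -[iota _]/(toAvLsep D (extl AS _)) -rmorphB -vfiltE; apply: ideal_ext_mem.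
  have := hE y; have -> : \sum_k extl AS (al k) * extr AS (h k y) = extl AS (\sum_k fA (cf k) * al k).
    rewrite rmorph_sum; apply: eq_bigr => k _; rewrite cP rmorphM mulrC.
    by have [-> _] := ext_tensor AS.
  move: (y - _) => z; apply: (ideal_gen_min (J := ideal_exp w n)); first exact: ideal_exp_ideal.
  by move=> _ [d Id <-]; apply: ideal_exp_ext.
have [G1 G2 G3 G4] := completion_filtration vpow_fg (toAvP D).
have [n|x xP] := G4 (fun n => toAv D (a n)).
  rewrite -rmorphB; apply: ideal_ext_mem; apply: vfilt_iota; rewrite rmorphB.
  have -> : iota (a n.+1) - iota (a n) = (b - iota (a n)) - (b - iota (a n.+1)) by ring.
  apply: (idealB (iK n)) => //; have := aP n.+1.
  apply: (ideal_gen_min (iK n)) => _ [d Id <-]; apply: ideal_ext_mem.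
  exact: ideal_exp_le Id.
exists x; apply/eqP; rewrite -subr_eq0; apply/eqP/H3 => n.
apply: (ideal_sub_trans (y := iota (a n)) (iK n)) => //.
rewrite -AvAvLsep_iota -rmorphB; apply: AvAvLsep_vfilt.
apply: (ideal_sub_sym (ideal_ext_ideal _ _)); exact: xP.
Qed.

Section Module.
Context (M : preMotive AL) (T : tateModule M D) (d : nat).
Context (m : nat) (e : 'I_m -> M) (kap : 'I_m -> {linear M -> (AL : comNzRingType)^o}).
Hypothesis ekap : forall x, x = \sum_i kap i x *: e i.
Hypothesis coker_ann : forall x m, ideal_exp (@char_ideal _ _ _ _ _ _ AL c) d x ->
  exists y, x *: m = mot_tau M y.
Local Notation vAL := (ideal_ext (extl AL) v).
Local Notation vM := [set x : M | forall i, vAL (kap i x)].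
Let iV : is_ideal vAL. Proof. exact: ideal_ext_ideal. Qed.

Let vM_sum (I : Type) (r : seq I) (P : pred I) (G : I -> M) :
  (forall j, P j -> vM (G j)) -> vM (\sum_(j <- r | P j) G j).
Proof.
move=> vG; apply: (big_ind (fun x => vM x)) => //.
  by move=> i; rewrite linear0; apply: (ideal0 iV).
by move=> x y vx vy i; rewrite linearD; apply: (idealD iV (vx i) (vy i)).
Qed.

Let vM_scale b x : vAL b -> vM (b *: x).
Proof. by move=> vb i; rewrite linearZ; apply: (idealMr _ iV). Qed.

Let AL_quotient_finite : exists (S : finType) (f : S -> AL), forall x, exists u, vAL (x - f u).
Proof.
have [g [al [mu [mulin muI mual muE]]]] := vpow_basis 1.
have [h [hD hp hI hE]] := tensor_quotient (ext_tensor AL) (ideal_exp_ideal v 1) mulin muI mual muE.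
exists {ffun 'I_g -> L}, (fun u : {ffun 'I_g -> L} => \sum_k extl AL (al k) * extr AL (u k)) => x.
exists [ffun k => h k x].
under eq_bigr => k _ do rewrite ffunE.
have := hE x; move: (x - _) => z; apply: (ideal_gen_min iV) => _ [a Ia <-].
by apply: ideal_ext_mem; apply: ideal_exp1_sub Ia.
Qed.

Let M_quotient_finite : exists (S : finType) (f : S -> M), forall x, exists u, vM (x - f u).
Proof.
have [S [f fP]] := AL_quotient_finite.
exists {ffun 'I_m -> S}, (fun u : {ffun 'I_m -> S} => \sum_i f (u i) *: e i) => x.
have /choice[u uP] i := fP (kap i x).
exists [ffun i => u i]; rewrite [in X in vM (X - _)](ekap x) -sumrB.
by apply: vM_sum => i _; rewrite ffunE -scalerBl; apply: vM_scale.
Qed.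

(** Since [L] is finite, so is [M/vM], and two iterates agree there. *)
Lemma stau_periodic x : exists a n, (0 < n)%N /\
  vM (iter (a + n) (@stau _ _ _ _ _ _ _ M) x - iter a (@stau _ _ _ _ _ _ _ M) x).
Proof.
have [S [f fP]] := M_quotient_finite.
have /choice[u uP] k := fP (iter k (@stau _ _ _ _ _ _ _ M) x).
have [k [l [kl ukl]]] : exists k l, (k < l)%N /\ u k = u l.
  have /injectivePn[k [l kl ukl]] : ~~ injectiveb (fun k : 'I_#|S|.+1 => u k).
    by apply/negP => /injectiveP/leq_card; rewrite card_ord ltnn.
  case: (ltngtP k l) => [lt|lt|E]; first by exists k, l.
    by exists l, k.
  by case/eqP: kl; apply: val_inj.
exists k, (l - k)%N; rewrite subn_gt0 kl subnKC ?(ltnW kl) //; split=> // i.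
have := idealB iV (uP l i) (uP k i); rewrite -!linearB ukl.
by rewrite opprB addrA subrK.
Qed.

(** For [a] in [v], [th ^+ d] kills the cokernel and is congruent modulo [v] to [(- c a) ^+ d], a
    unit. *)
Lemma stau_span x : exists b : 'I_m -> AL, vM (x - \sum_k b k *: stau (e k)).
Proof.
have [a va ca] := away_from_characteristic.
pose th := extl AL a - extr AL (c a).
have thJ : ideal_exp (@char_ideal _ _ _ _ _ _ AL c) d (th ^+ d).
  by apply: ideal_expX; apply: ideal_gen_mem; exists a.
have [y yE] := coker_ann x thJ.
have [kap' [_ kap'E]] := base_change_dual_basis (@mot_pullP _ _ _ _ _ _ _ M) ekap.
pose u := extr AL ((- c a) ^+ d)^-1.
have uE : u * extr AL ((- c a) ^+ d) = 1.
  by rewrite -rmorphM mulVf ?rmorph1 // expf_neq0 // oppr_eq0.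
exists (fun k => u * kap' k y).
have -> : \sum_k (u * kap' k y) *: stau (e k) = u *: (th ^+ d *: x).
  rewrite yE {2}[y]kap'E linear_sum scaler_sumr; apply: eq_bigr => k _.
  by rewrite linearZ scalerA.
have -> : x - u *: (th ^+ d *: x) = (u * (extr AL ((- c a) ^+ d) - th ^+ d)) *: x.
  by rewrite mulrBr scalerBl uE scale1r scalerA.
apply: vM_scale; apply: (idealM _ iV).
rewrite rmorphXn subrXX; apply: (idealMr _ iV).
have -> : extr AL (- c a) - th = - extl AL a by rewrite /th rmorphN; ring.
by apply: (idealN iV); apply: ideal_ext_mem.
Qed.

Lemma ALAvLsep_iota a : ALAvLsep D (extl AL a) = iota a.
Proof. exact: ALAvLsep_l. Qed.

Let vAL_K x : vAL x -> K 1 (ALAvLsep D x).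
Proof.
apply: (ideal_gen_min (J := [set x | K 1 (ALAvLsep D x)])).
  split=> [|a b Ja Jb|a b Jb] /=; first by rewrite rmorph0; apply: (ideal0 (iK 1)).
    by rewrite rmorphD; apply: (idealD (iK 1)).
  by rewrite rmorphM; apply: (idealM _ (iK 1)).
move=> _ [a Ia <-] /=; rewrite ALAvLsep_iota; apply: ideal_ext_mem.
exact: ideal_exp1.
Qed.

Lemma iter_tate_tau n x : iter n (tate_tau T) (tate_in T x) =
  tate_in T (iter n (@stau _ _ _ _ _ _ _ M) x).
Proof. by elim: n => //= n ->; rewrite tate_tauP. Qed.

Lemma tate_fixed_basis : exists r (t : 'I_r -> tate_amb T),
  [/\ forall i, tate_tau T (t i) = t i,
      forall x, exists b : 'I_r -> B, x = \sum_i b i *: t i &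
      forall b : 'I_r -> B, \sum_i b i *: t i = 0 -> forall i, b i = 0].
Proof.
have [kapB [kapBE kapBsum]] := base_change_dual_basis (tate_inP T) ekap.
have [H1 H2 H3 H4] := vadic_filtration.
have [g [al [mu [mulin muI mual muE]]]] := vpow_basis 1.
have vM_NK x : vM x -> vfiltN iota v kapB 1 (tate_in T x).
  by move=> vx i; rewrite kapBE; apply/vAL_K/vx.
apply: (fixed_basis (@sep_closed _ (Lsep D)) vadic_iota_lam sigmav_iota sigmav_lam
  v_max H3 H4 mulin _ mual (vadic_quotient mulin muI mual muE) kapBsum) => //.
- by move=> k x vx; apply: muI; apply: ideal_exp1.
- move=> i; have [a [n [n0 Ka]]] := stau_periodic (e i); exists a, n; split=> //.
  by rewrite !iter_tate_tau -linearB; apply: vM_NK.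
move=> x; have /choice[b bP] i := stau_span (e i).
exists m, (fun k => \sum_i kapB i x * ALAvLsep D (b i k)), (fun k => tate_in T (e k)).
have -> : \sum_k (\sum_i kapB i x * ALAvLsep D (b i k)) *: tate_tau T (tate_in T (e k)) =
   \sum_i kapB i x *: tate_in T (\sum_k b i k *: stau (e k)).
  under eq_bigr => k _ do rewrite scaler_suml.
  rewrite exchange_big; apply: eq_bigr => i _ /=.
  rewrite linear_sum scaler_sumr; apply: eq_bigr => k _.
  by rewrite tate_tauP linearZ scalerA.
rewrite {1}[x]kapBsum -sumrB; apply: (big_ind (vfiltN iota v kapB 1)).
- by move=> i; rewrite linear0; apply: (ideal0 (iK 1)).
- by move=> y z Ky Kz i; rewrite linearD; apply: (idealD (iK 1) (Ky i) (Kz i)).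
move=> i _ j; rewrite -scalerBr -linearB linearZ.
by apply: (idealM _ (iK 1)); apply: vM_NK.
Qed.

End Module.
End Tate.

(** * Lattices and absolute values *)

(** [E] and [D] pass between the generators [e] and the basis [t]; only one of their products is the
    identity, the other is the idempotent that cuts out [N]. *)
Lemma module_matrix (R : comNzRingType) (N : lmodType R) m (e : 'I_m -> N)
    (kap : 'I_m -> {linear N -> R^o}) r (t : 'I_r -> N) :
  (forall x, x = \sum_i kap i x *: e i) ->
  (forall x, exists c : 'I_r -> R, x = \sum_i c i *: t i) ->
  (forall c : 'I_r -> R, \sum_i c i *: t i = 0 -> forall i, c i = 0) ->
  exists (E : 'M[R]_(m, r)) (D : 'M[R]_(r, m)), D *m E = 1%:M /\
    forall (p : {linear N -> N}) (Q : 'M[R]_r), (forall i, p (t i) = \sum_j Q i j *: t j) ->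
      \matrix_(a, b) (kap b (p (e a)) : R) = E *m Q *m D.
Proof.
move=> ekap gen indep.
have /choice[E0 E0P] a := gen (e a).
pose E : 'M[R]_(m, r) := \matrix_(a, i) E0 a i.
pose D : 'M[R]_(r, m) := \matrix_(i, a) (kap a (t i) : R).
have eE a : e a = \sum_i E a i *: t i.
  by rewrite {1}(E0P a); apply: eq_bigr => i _; rewrite mxE.
exists E, D; split.
  apply/matrixP => i j; apply/eqP; rewrite -subr_eq0; apply/eqP.
  apply: (indep (fun j => (D *m E) i j - (1%:M : 'M[R]_r) i j)).
  under eq_bigr => k _ do rewrite scalerBl.
  rewrite sumrB [X in _ - X](bigD1 i) //= [X in _ - (_ + X)]big1 ?addr0; last first.
    by move=> k ki; rewrite mxE eq_sym (negbTE ki) scale0r.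
  rewrite mxE eqxx scale1r.
  have -> : \sum_k (D *m E) i k *: t k = t i; last by rewrite subrr.
  rewrite [RHS]ekap; under [RHS]eq_bigr => a _ do rewrite {1}eE scaler_sumr.
  rewrite exchange_big; apply: eq_bigr => k _ /=.
  rewrite mxE scaler_suml; apply: eq_bigr => a _.
  by rewrite scalerA !mxE.
move=> p Q pQ; apply/matrixP => a b; rewrite !mxE eE linear_sum.
transitivity (\sum_i \sum_j E a i * (Q i j * (kap b (t j) : R))).
  rewrite linear_sum; apply: eq_bigr => i _.
  rewrite linearZ pQ linearZ linear_sum /= [LHS]mulr_sumr; apply: eq_bigr => j _.
  by rewrite linearZ.
rewrite exchange_big; apply: eq_bigr => j _ /=; rewrite !mxE mulr_suml.
by apply: eq_bigr => i _; rewrite mulrA.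
Qed.

(** This recovers the rank of an idempotent from its characteristic polynomial, even with zero
    divisors: cancel monic factors and evaluate at 1. *)
Lemma XsubC_Xn_rank (R : comNzRingType) a b :
  'X^a * ('X - 1) ^+ b = 'X^b * ('X - 1) ^+ a :> {poly R} -> a = b.
Proof.
wlog ab : a b / (a < b)%N.
  move=> W E; case: (ltngtP a b) => // lt; first exact: W.
  by symmetry; apply: W.
rewrite -(subnK (ltnW ab)) !exprD => E; exfalso.
set k := (b - a)%N in E; have k_gt0 : (0 < k)%N by rewrite subn_gt0.
have mX : 'X^a * ('X - 1) ^+ a \is @monic R.
  by rewrite monicMl ?monicXn // monic_exp // -[1]/(1%:P) monicXsubC.
have /(monic_lreg mX) : ('X^a * ('X - 1) ^+ a) * ('X - 1) ^+ k =
    ('X^a * ('X - 1) ^+ a) * 'X^k :> {poly R}.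
  transitivity ('X^a * (('X - 1) ^+ k * ('X - 1) ^+ a) : {poly R}).
    by rewrite -mulrA; congr (_ * _); rewrite mulrC.
  by rewrite E [_ * 'X^k]mulrC mulrA.
move/(congr1 (fun p => p.[1])); rewrite hornerXn expr1n horner_exp !hornerE subrr.
by rewrite expr0n gtn_eqF // => /esym/eqP; rewrite oner_eq0.
Qed.

Lemma char_poly_1 (R : comNzRingType) n : char_poly (1%:M : 'M[R]_n) = ('X - 1) ^+ n.
Proof.
rewrite char_poly_trig; last exact: scalar_mx_is_trig.
by rewrite (eq_bigr (fun=> 'X - 1)) ?prodr_const ?card_ord // => i _; rewrite mxE eqxx.
Qed.

Section PowerDivisibility.
Context (K : fieldType) (n : nat) (Q : nat -> 'M[K]_n).
Hypotheses (Q0 : Q 0 = 1%:M) (QS : forall l, Q l.+1 = Q l *m Q 1).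

(** As matrices, [X - Q 1] divides [X^l - Q l], since [Q l] is the [l]-th power of [Q 1]; take
    determinants. *)
Lemma char_poly_pow_dvd l : char_poly (Q 1) %| char_poly (Q l) \Po 'X^l.
Proof.
pose f := map_mx (@polyC K) : 'M[K]_n -> 'M[{poly K}]_n.
have [S SE] : exists S, ('X^l)%:M - f (Q l) = char_poly_mx (Q 1) *m S.
  elim: l => [|l [S SE]].
    by exists 0; rewrite Q0 /f map_mx1 expr0 subrr mulmx0.
  exists (('X^l)%:M + S *m f (Q 1)).
  rewrite mulmxDr mulmxA -SE mulmxBl /char_poly_mx mulmxBl -scalar_mxM -exprS.
  by rewrite mul_mx_scalar mul_scalar_mx addrA subrK QS /f map_mxM.
have -> : char_poly (Q l) \Po 'X^l = \det (('X^l)%:M - f (Q l)).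
  rewrite /char_poly -[_ \Po _]/((comp_poly 'X^l : {rmorphism {poly K} -> {poly K}}) _).
  rewrite -det_map_mx; congr (\det _); apply/matrixP => i j; rewrite !mxE.
  rewrite rmorphB /= rmorphMn /= comp_polyX comp_polyC.
  by [].
by rewrite SE det_mulmx dvdp_mulr.
Qed.

End PowerDivisibility.

Section Lattice.
Context (k K : fieldType) (i : {rmorphism k -> K}) (P : place i).
Local Notation vge := (vge P).

Lemma vge_prod n (G : 'I_n -> K) (a : int) :
  (forall j, vge a (G j)) -> vge (a * n%:Z) (\prod_j G j).
Proof.
elim: n G => [|n IHn] G aG; first by rewrite big_ord0 mulr0 vge1.
have -> : a * n.+1%:Z = a + a * n%:Z by rewrite -add1n PoszD; ring.
by rewrite big_ord_recl; apply: vgeM => //; apply: IHn.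
Qed.

Lemma vge_sign n a x : vge a x -> vge a ((-1) ^+ n * x).
Proof. by move=> ax; rewrite -signr_odd; case: (odd n); rewrite ?mulN1r ?vgeN ?mul1r. Qed.

Lemma vge_det n (M : 'M[K]_n) (a : int) :
  (forall x y, vge a (M x y)) -> vge (a * n%:Z) (\det M).
Proof.
by move=> aM; apply: vge_sum => s _; apply: vge_sign; apply: vge_prod => j.
Qed.

(* [Z] maps the standard lattice onto its multiple by an element of valuation [- a]. *)
Definition scaled_lattice (a : int) n (Z : 'M[K]_n) := (forall x y, vge (- a) (Z x y)) /\
  exists (Y : 'M[K]_n) z, [/\ forall x y, vge 0 (Y x y), z != 0, P z = - a & Y *m Z = z%:M].

Lemma scaled_lattice1 n : scaled_lattice 0 (1%:M : 'M[K]_n).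
Proof.
have v1 x y : vge 0 ((1%:M : 'M[K]_n) x y).
  by rewrite mxE; case: eqP => _; [apply: vge1 | apply: vge0].
split; first by rewrite oppr0.
by exists 1%:M, 1; split; rewrite ?oner_neq0 ?place1 ?oppr0 ?mulmx1.
Qed.

Lemma scaled_latticeM a b n (Z1 Z2 : 'M[K]_n) :
  scaled_lattice a Z1 -> scaled_lattice b Z2 -> scaled_lattice (a + b) (Z1 *m Z2).
Proof.
move=> [v1 [Y1 [z1 [vY1 z10 Pz1 E1]]]] [v2 [Y2 [z2 [vY2 z20 Pz2 E2]]]]; split=> [x y|].
  by rewrite mxE opprD; apply: vge_sum => j _; apply: vgeM.
exists (Y2 *m Y1), (z1 * z2); split=> [x y|||].
- by rewrite mxE; apply: vge_sum => j _; rewrite -[0]addr0; apply: vgeM.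
- exact: mulf_neq0.
- by rewrite ordM // Pz1 Pz2 opprD.
by rewrite mulmxA -[Y2 *m Y1 *m Z1]mulmxA E1 mul_mx_scalar -scalemxAl E2 scale_scalar_mx.
Qed.

Lemma scaled_lattice_map a n (s : {rmorphism K -> K}) (Z : 'M[K]_n) :
  (forall x, P (s x) = P x) -> scaled_lattice a Z -> scaled_lattice a (map_mx s Z).
Proof.
move=> sP; have sv b x : vge b x -> vge b (s x) by rewrite /vge sP fmorph_eq0.
move=> [v [Y [z [vY z0 Pz E]]]]; split=> [x y|]; first by rewrite mxE; apply: sv.
exists (map_mx s Y), (s z); split=> [x y|||]; rewrite ?fmorph_eq0 ?sP //.
  by rewrite mxE; apply: sv.
by rewrite -map_mxM E map_scalar_mx.
Qed.

Lemma scaled_lattice_compound a n h (Z : 'M[K]_n) :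
  scaled_lattice a Z -> scaled_lattice (a * h%:Z) (compound h Z).
Proof.
move=> [v [Y [z [vY z0 Pz E]]]]; split=> [x y|].
  by rewrite mxE -mulNr; apply: vge_det => u w; rewrite mxE.
exists (compound h Y), (z ^+ h); split=> [x y|||].
- by rewrite mxE -[0](mul0r h%:Z); apply: vge_det => u w; rewrite mxE.
- exact: expf_neq0.
- by rewrite placeX // Pz mulNrn -mulr_natr natz.
by rewrite -compoundM E -scalemx1 compoundZ compound1 scalemx1.
Qed.

(** The entries of [Z] have order at least [- a], which bounds all coefficients from below. For the
    constant term the opposite bound comes from [\det Y * \det Z = z ^+ n], where [\det Y] has order
    at least 0. *)
Lemma scaled_lattice_char_poly a n (Z : 'M[K]_n) : scaled_lattice a Z ->
  (forall j, vge (a * (j%:Z - n%:Z)) (char_poly Z)`_j) /\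
  (char_poly Z)`_0 != 0 /\ P (char_poly Z)`_0 = - (a * n%:Z).
Proof.
move=> [v [Y [z [vY z0 Pz E]]]].
(* If [X] is given the order [- a], then [W e p] bounds the order of every term of [p] below by
   [- a * e]. The bound is multiplicative and holds with [e = 1] for the entries of [X - Z]. *)
pose W (e : nat) (p : {poly K}) := forall j, vge (a * (j%:Z - e%:Z)) p`_j.
have W0 e : W e 0 by move=> j; rewrite coef0 vge0.
have WD e p q : W e p -> W e q -> W e (p + q).
  by move=> Wp Wq j; rewrite coefD; apply: vgeD.
have WN e p : W e p -> W e (- p) by move=> Wp j; rewrite coefN vgeN.
have WM e f p q : W e p -> W f q -> W (e + f)%N (p * q).
  move=> Wp Wq j; rewrite coefM; apply: vge_sum => l _.
  have -> : a * (j%:Z - (e + f)%N%:Z) = a * (l%:Z - e%:Z) + a * ((j - l)%N%:Z - f%:Z).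
    by rewrite -subzn ?leq_ord // PoszD; ring.
  exact: vgeM.
have W1 : W 0 1.
  by move=> [|j]; rewrite coef1 /= ?vge0 // subrr mulr0 vge1.
split.
  suff : W n (char_poly Z) by [].
  rewrite /char_poly /determinant.
  apply: (big_ind (W n) (W0 n) (WD n)) => s _; rewrite -signr_odd.
  suff Wp : W n (\prod_x char_poly_mx Z x (s x)).
    by case: (odd _); rewrite ?mulN1r ?mul1r //; apply: WN.
  have : forall m (G : 'I_m -> {poly K}), (forall x, W 1%N (G x)) -> W m (\prod_x G x).
    elim=> [|m IHm] G WG; first by rewrite big_ord0.
    by rewrite big_ord_recl; apply: (WM 1%N m _ _ (WG _)); apply: IHm.
  apply=> x [|[|j]]; rewrite !mxE coefB coefMn coefX coefC /=.
  - by rewrite mul0rn !sub0r vgeN mulrN1.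
  - by rewrite subrr mulr0 subr0; case: eqP => _; [apply: vge1 | apply: vge0].
  by rewrite mul0rn subr0 vge0.
have vdY := vge_det vY; have vdZ := vge_det v; rewrite mul0r in vdY.
have dE : \det Y * \det Z = z ^+ n by rewrite -det_mulmx E det_scalar.
have [dY0 dZ0] : \det Y != 0 /\ \det Z != 0.
  by apply/andP; rewrite -negb_or -mulf_eq0 dE expf_neq0.
rewrite char_poly_det -signr_odd.
have H x : (-1) ^+ odd n * x != 0 = (x != 0) :> bool.
  by case: (odd n); rewrite ?mulN1r ?oppr_eq0 ?mul1r.
have H' x : P ((-1) ^+ odd n * x) = P x.
  by case: (odd n); rewrite ?mulN1r ?placeN ?mul1r.
rewrite H H' dZ0; split=> //; apply/le_anti/andP; split; last first.
  by rewrite vgeE // mulNr in vdZ.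
have := congr1 P dE; rewrite ordM // placeX // Pz mulNrn => PdE.
rewrite vgeE // in vdY.
by rewrite -mulr_natr natz in PdE; rewrite -PdE lerDr.
Qed.

End Lattice.

Section NonArchimedean.
Context (R : realType) (K : fieldType) (a : K -> R).
Hypothesis a_abs : nonarch_abs a.

Let a_ge0 x : 0 <= a x. Proof. by case: a_abs. Qed.
Let a_eq0 x : a x = 0 <-> x = 0. Proof. by case: a_abs. Qed.
Let aM x y : a (x * y) = a x * a y. Proof. by case: a_abs. Qed.
Let aD x y : a (x + y) <= Num.max (a x) (a y). Proof. by case: a_abs. Qed.
Let a0 : a 0 = 0. Proof. exact/a_eq0. Qed.

Let a1 : a 1 = 1.
Proof.
have a10 : a 1 != 0 by apply/eqP => /a_eq0/eqP; rewrite oner_eq0.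
by apply: (mulfI a10); rewrite -aM !mulr1.
Qed.

Let aN x : a (- x) = a x.
Proof.
have aN1 : a (-1) = 1.
  have : a (-1) ^+ 2 = 1 by rewrite expr2 -aM mulrNN mulr1 a1.
  move/eqP; rewrite sqrf_eq1 => /orP[/eqP//|/eqP E].
  by have := a_ge0 (-1); rewrite E ler0N1.
by rewrite -mulN1r aM aN1 mul1r.
Qed.

Lemma absX x n : a (x ^+ n) = a x ^+ n.
Proof. by elim: n => [|n IHn]; rewrite ?expr0 // !exprS aM IHn. Qed.

Lemma abs_dominant (I : finType) (G : I -> K) j0 : 0 < a (G j0) ->
  (forall j, j != j0 -> a (G j) < a (G j0)) -> \sum_j G j <> 0.
Proof.
move=> G0 Gdom; rewrite (bigD1 j0) //= => /eqP; rewrite addr_eq0 => /eqP E.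
suff : a (\sum_(j | j != j0) G j) < a (G j0) by rewrite E aN ltxx.
apply: (big_ind (fun x => a x < a (G j0))) => //; first by rewrite a0.
by move=> x y xl yl; apply: le_lt_trans (aD _ _) _; rewrite gt_max xl.
Qed.

(* A polynomial whose Newton polygon is a segment. *)
Lemma abs_root n (G : {poly K}) (rho : R) mu : 0 < rho -> G \is monic -> size G = n.+1 ->
  (forall j, (j <= n)%N -> a G`_j <= rho ^+ (n - j)) -> a G`_0 = rho ^+ n ->
  root G mu -> a mu = rho.
Proof.
move=> rho0 Gm sG Gj G0 /rootP; rewrite horner_coef sG => E.
have Gn : G`_n = 1 by move: Gm; rewrite monicE lead_coefE sG => /eqP.
(* Above [rho] the leading term dominates the value at [mu], below [rho] the constant term does. *)
apply/eqP; rewrite eq_le; apply/andP; split; rewrite leNgt; apply/negP => lt.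
  apply: (abs_dominant (j0 := ord_max) _ _ E); rewrite /= Gn mul1r absX.
    by rewrite exprn_gt0 // (lt_trans rho0).
  move=> j jn; have j_lt : (j < n)%N.
    by rewrite ltn_neqAle -ltnS ltn_ord andbT.
  have -> : a mu ^+ n = a mu ^+ (n - j) * a mu ^+ j by rewrite -exprD subnK // ltnW.
  rewrite aM absX ltr_pM2r; last first.
    by rewrite exprn_gt0 // (lt_trans rho0).
  apply: le_lt_trans (Gj _ (ltnW j_lt)) _.
  by rewrite ltrXn2r ?subn_eq0 -?ltnNge // ?nnegrE ?ltW.
apply: (abs_dominant (j0 := ord0) _ _ E); rewrite /= expr0 mulr1 G0.
  by rewrite exprn_gt0.
move=> j j0; have j_gt : (0 < j)%N by rewrite lt0n.
have jn : (j <= n)%N by rewrite -ltnS.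
have -> : rho ^+ n = rho ^+ (n - j) * rho ^+ j by rewrite -exprD subnK.
rewrite aM absX.
apply: (@le_lt_trans _ _ (rho ^+ (n - j) * a mu ^+ j)).
  by rewrite ler_wpM2r ?exprn_ge0 // Gj.
rewrite ltr_pM2l ?exprn_gt0 // ltrXn2r // ?nnegrE ?a_ge0 ?ltW //.
Qed.

End NonArchimedean.

(** * The Frobenius endomorphism *)

(** Division by the monic [P] is possible over [A] and commutes with [g]; the remainder is too small
    to be a nonzero multiple. *)
Lemma monic_dvdp_descent (A : comNzRingType) (K : fieldType) (g : {rmorphism A -> K})
    (P G : {poly A}) : injective g -> P \is monic ->
  map_poly g P %| map_poly g G -> exists S, G = S * P.
Proof.
move=> g_inj Pm; have E := Pdiv.RingMonic.rdivp_eq Pm G.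
rewrite {1}E rmorphD rmorphM /= dvdp_addr; last exact: dvdp_mull.
have lt := Pdiv.Ring.ltn_rmodpN0 G (monic_neq0 Pm).
have [r0 _|r0 /(dvdp_leq _)] := eqVneq (map_poly g (Pdiv.Ring.rmodp G P)) 0.
  exists (Pdiv.Ring.rdivp G P); rewrite {1}E.
  suff -> : Pdiv.Ring.rmodp G P = 0 by rewrite addr0.
  by apply: (map_inj_poly g_inj (rmorph0 g)); rewrite r0 rmorph0.
rewrite !(size_map_inj_poly g_inj (rmorph0 g)) => /(_ r0).
by rewrite leqNgt lt.
Qed.

Lemma char_poly_conj (K : fieldType) n (U U' X : 'M[K]_n) :
  U' *m U = 1%:M -> char_poly (U *m X *m U') = char_poly X.
Proof.
move=> U'U; apply: (mulfI (x := 'X^n)); first by rewrite -size_poly_eq0 size_polyXn.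
by rewrite char_poly_mulmxC mulmxA U'U mul1mx.
Qed.

Section GenericFibre.
Context (F : finFieldType) (C : curve F) (oo : place (const C)).
Hypothesis oo_rational : rational_place oo.
Context (A : coordRing oo) (L : finFieldType) (fL : {rmorphism F -> L}).
Context (d : nat) (card_L : #|L| = (#|F| ^ d)%N).
Context (AL : scalarExt (coord_const A) fL) (ooL : placeAbove AL).
Context (M : preMotive AL).
Context (m : nat) (e : 'I_m -> M) (kap : 'I_m -> {linear M -> (AL : comNzRingType)^o}).
Hypothesis ekap : forall x, x = \sum_i kap i x *: e i.
Local Notation f := (@tofrac AL : {rmorphism AL -> {fraction AL}}).
Local Notation K := {fraction AL}.
Local Notation stauM := (@stau _ _ _ _ _ _ _ M).
Local Notation g := (f \o extl AL : {rmorphism A -> K}).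
Context (r k l : nat) (l_gt0 : (0 < l)%N) (pur : pure_at ooL M r k l).

(** The matrix of the [n]-th power of [pi] in the dual basis. For [n = 0] it is an idempotent, in
    general not the identity. *)
Definition frob_matrix n : 'M[AL]_m := \matrix_(a, b) (kap b (iter (d * n) stauM (e a)) : AL).

(** [Q n] is the matrix of [pi^n] on the generic fibre in the basis given by purity, and [Th] that
    of [tau]. The relation between [Q n] and its twist by [sK] says that [pi] commutes with
    [tau]. *)
Lemma generic_frobenius :
  exists (Q : nat -> 'M[K]_r) (E : 'M[K]_(m, r)) (D : 'M[K]_(r, m)),
  [/\ D *m E = 1%:M, Q 0%N = 1%:M, forall n, Q n.+1 = Q n *m Q 1%N,
      forall n, map_mx f (frob_matrix n) = E *m Q n *m D &
      scaled_lattice ooL (k * d)%N%:Z (Q l)] /\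
  exists (sK : {rmorphism K -> K}) (Th : 'M[K]_r),
    [/\ forall a, sK (f a) = f (sigma AL a), \det Th != 0 &
        forall n, map_mx sK (Q n) *m Th = Th *m Q n].
Proof.
have [sK [V [j [tV [b [sKE jP tVj b_basis [b'_basis stalk]]]]]]] := pur.
have [kapV [kapVE kapVsum]] := base_change_dual_basis jP ekap.
have gen x : exists c : 'I_r -> K, x = \sum_i c i *: b i.
  by have [c [cE _]] := b_basis x; exists c.
have indep (c : 'I_r -> K) : \sum_i c i *: b i = 0 -> forall i, c i = 0.
  move=> c0 i; have [z [_ zU]] := b_basis 0.
  have : [ffun i => c i] = [ffun => 0] :> {ffun 'I_r -> K}.
    transitivity z; [symmetry|]; apply: zU.
      by rewrite -[LHS]c0; apply: eq_bigr => i' _; rewrite ffunE.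
    by rewrite big1 // => i' _; rewrite ffunE scale0r.
  by move/ffunP/(_ i); rewrite !ffunE.
have mxU (X Y : 'M[K]_r) : (forall i, \sum_j X i j *: b j = \sum_j Y i j *: b j) -> X = Y.
  move=> XY; apply/matrixP => i0 j0; apply/eqP; rewrite -subr_eq0; apply/eqP.
  apply: (indep (fun j => X i0 j - Y i0 j)).
  under eq_bigr => j1 _ do rewrite scalerBl.
  by rewrite sumrB XY subrr.
have sKd n z : iter (d * n) sK z = z.
  have sKdf a : iter d sK (f a) = f a.
    have H p : iter p sK (f a) = f (iter p (sigma AL) a) by elim: p => //= p ->.
    by rewrite H iter_sigma_id.
  have sKd1 y : iter d sK y = y.
    have [u [s [s0 ->]]] := fraction_numden y.
    have H p x1 x2 : iter p sK (x1 / x2) = iter p sK x1 / iter p sK x2.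
      by elim: p => //= p ->; rewrite fmorph_div.
    by rewrite H; congr (_ / _); apply: sKdf.
  by elim: n => [|n IHn]; rewrite ?muln0 // mulnS iterD IHn.
have tVlin n (I : finType) (c : I -> K) (x : I -> V) :
    iter n tV (\sum_i c i *: x i) = \sum_i iter n sK (c i) *: iter n tV (x i).
  elim: n => //= n ->; rewrite linear_sum; apply: eq_bigr => i _.
  by rewrite linearZ.
have /choice[Z0 Z0P] : forall ni : nat * 'I_r, exists c : 'I_r -> K,
    iter ni.1 tV (b ni.2) = \sum_j c j *: b j by move=> ni; apply: gen.
have [Z ZE] : exists Z : nat -> 'M[K]_r, forall n i, iter n tV (b i) = \sum_j Z n i j *: b j.
  exists (fun n => \matrix_(i, j) Z0 (n, i) j) => n i.
  by rewrite (Z0P (n, i)); apply: eq_bigr => j1 _; rewrite mxE.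
have Z_0 : Z 0%N = 1%:M.
  apply: mxU => i; rewrite -ZE /= (bigD1 i) //= mxE eqxx scale1r big1 ?addr0 // => j1.
  by rewrite mxE eq_sym => /negbTE->; rewrite scale0r.
(* The cocycle rule for semilinear iterates; after [d * n] steps the twist is trivial. *)
have ZD a n : Z (a + n)%N = map_mx (iter a sK) (Z n) *m Z a.
  apply: mxU => i; rewrite -ZE iterD ZE tVlin.
  under [RHS]eq_bigr => j1 _ do rewrite mxE scaler_suml.
  rewrite [RHS]exchange_big; apply: eq_bigr => j1 _ /=.
  rewrite ZE scaler_sumr; apply: eq_bigr => j2 _.
  by rewrite scalerA mxE.
have map_id n (X : 'M[K]_r) : map_mx (iter (d * n) sK) X = X.
  by apply/matrixP => x y; rewrite mxE sKd.
have latl : scaled_lattice ooL k%:Z (Z l).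
  have mem0 i : stalk_twist ooL (fun i => iter l tV (b i)) 0 (iter l tV (b i)).
    exists (fun j => (j == i)%:R); split=> [j1|].
      by case: eqP; rewrite ?place1 ?Defs.ord0.
    rewrite (bigD1 i) //= eqxx scale1r big1 ?addr0 // => j1 /negbTE->.
    by rewrite scale0r.
  have vk x : - k%:Z <= ooL x -> vge ooL (- k%:Z) x by rewrite /vge => ->; rewrite orbT.
  split=> [i j1|].
    have := mem0 i; rewrite stalk => -[c [cv E]].
    have -> : Z l i j1 = c j1.
      apply/eqP; rewrite -subr_eq0; apply/eqP.
      apply: (indep (fun j => Z l i j - c j)).
      under eq_bigr => j2 _ do rewrite scalerBl.
      by rewrite sumrB -ZE E subrr.
    exact: vk (cv j1).
  have [z z0 zk] := place_surj ooL (- k%:Z).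
  have /choice[Y0 Y0P] i : exists c : 'I_r -> K, (forall j, 0 <= ooL (c j)) /\
      z *: b i = \sum_j c j *: iter l tV (b j).
    have : stalk_twist ooL b k (z *: b i).
      exists (fun j => if j == i then z else 0); split=> [j1|].
        by case: eqP; rewrite ?zk ?Defs.ord0 ?oppr_le0.
      rewrite (bigD1 i) //= eqxx big1 ?addr0 // => j1 /negbTE->.
      by rewrite scale0r.
    by rewrite -stalk => -[c [cv E]]; exists c; split=> // j1; have := cv j1; rewrite oppr0.
  exists (\matrix_(i, j) Y0 i j), z; split=> [x y|||] //.
    by rewrite mxE /vge (proj1 (Y0P x)) orbT.
  apply: mxU => i.
  transitivity (z *: b i); last first.
    rewrite (bigD1 i) //= mxE eqxx mulr1n big1 ?addr0 // => j1.
    by rewrite mxE eq_sym => /negbTE->; rewrite scale0r.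
  rewrite (proj2 (Y0P i)).
  under eq_bigr => j1 _ do rewrite mxE scaler_suml.
  rewrite exchange_big; apply: eq_bigr => j1 _ /=.
  rewrite ZE scaler_sumr; apply: eq_bigr => j2 _.
  by rewrite scalerA mxE.
have sKP := place_above_sK oo_rational ooL sKE.
have lat_iter p a (X : 'M[K]_r) : scaled_lattice ooL a X -> scaled_lattice ooL a (map_mx (iter p sK) X).
  move=> aX; elim: p => [|p IHp] /=.
    by rewrite (_ : map_mx id X = X) //; apply/matrixP => x y; rewrite mxE.
  have := scaled_lattice_map sKP IHp; rewrite -map_mx_comp.
  by [].
(* Purity describes [l] steps only, so that multiples of [l] are treated, in the end [l * d]. *)
have latn n : scaled_lattice ooL (k * n)%N%:Z (Z (l * n)%N).
  elim: n => [|n IHn]; first by rewrite !muln0 Z_0; apply: scaled_lattice1.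
  have -> : (l * n.+1 = l * n + l)%N by rewrite mulnSr.
  have -> : (k * n.+1)%N%:Z = k%:Z + (k * n)%N%:Z by rewrite mulnS PoszD.
  rewrite ZD.
  by apply: scaled_latticeM => //; apply: lat_iter.
have [E [D [DE EDP]]] := module_matrix kapVsum gen indep.
have iterV p a x y : iter p tV (a *: x + y) = iter p sK a *: iter p tV x + iter p tV y.
  by elim: p => //= p ->; rewrite linearP.
have iterj p x : j (iter p stauM x) = iter p tV (j x).
  by elim: p => //= p <-; rewrite tVj.
exists (fun n => Z (d * n)%N), E, D; split; last first.
  exists sK, (Z 1%N); split=> // [|n].
    have [_ [Y [z [_ z0 _ YZ]]]] := latl.
    have dZ : \det (Z l) != 0.
      apply: contraNneq (expf_neq0 r z0) => dZ.
      by rewrite -(det_scalar r z) -YZ det_mulmx dZ mulr0.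
    apply: contraNneq dZ => d1.
    by rewrite -(prednK l_gt0) -add1n ZD det_mulmx d1 mulr0.
  (* Both sides are [Z (d * n + 1)], decomposed in two ways. *)
  rewrite -[map_mx sK _]/(map_mx (iter 1 sK) _) -ZD addnC ZD.
  by rewrite map_id.
split=> [||n|n|]; rewrite ?muln0 //.
- by rewrite mulnS ZD -[X in iter X](muln1 d) map_id muln1.
- have lin : linear_for *:%R (iter (d * n) tV).
    by move=> a x y; rewrite iterV sKd.
  pose G : {linear V -> V} := HB.pack (iter (d * n) tV)
    (@GRing.isLinear.Build K V V *:%R (iter (d * n) tV) lin).
  rewrite -(EDP G (Z (d * n)%N) (ZE (d * n)%N)); apply/matrixP => a b0.
  by rewrite !mxE -kapVE iterj.
by rewrite [(d * l)%N]mulnC; apply: latn.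
Qed.

Let f_inj : injective f.
Proof. by move=> x y /eqP; rewrite tofrac_eq => /eqP. Qed.

Let g_inj : injective g.
Proof. by move=> x y /f_inj/(extl_inj oo_rational ooL). Qed.

(** This carries the rank [r] to the Tate module: over [A_{v,L^sep}] the same idempotent counts the
    fixed vectors. *)
Lemma idempotent_char_poly :
  'X^r * char_poly (frob_matrix 0) = 'X^m * ('X - 1) ^+ r.
Proof.
have [Q [E [D [[DE Q0 _ QE _] _]]]] := generic_frobenius.
apply: (map_inj_poly f_inj (rmorph0 f)).
rewrite !rmorphM !rmorphXn rmorphB rmorph1 /= map_polyX map_char_poly QE Q0 mulmx1.
by rewrite char_poly_mulmxC DE char_poly_1.
Qed.

(** [P] and [G] belong to the exterior powers of [pi] and [pi^l]. Their coefficients lie in [A_L],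
    because they occur, shifted, in a characteristic polynomial over [A_L], and are
    [sigma]-invariant, because [Q p] is conjugate to its twist. *)
Lemma generic_char_polys h : let n := #|{: kset h r}| in let N := #|{: kset h m}| in
  exists P G S : {poly A},
  [/\ 'X^n * char_poly (compound h (frob_matrix 1)) = 'X^N * map_poly (extl AL) P,
      G \Po 'X^l = S * P, G \is monic, size G = n.+1 &
      [/\ forall j, vge oo ((k * d * h)%N%:Z * (j%:Z - n%:Z)) (coord_fun A G`_j),
          G`_0 != 0 & oo (coord_fun A G`_0) = - (k * d * h * n)%N%:Z]].
Proof.
move=> n N.
have [Q [E [D [[DE Q0 QS QE latQ] [sK [Th [sKE dTh sTh]]]]]]] := generic_frobenius.
pose Cq p := compound h (Q p).
have CD : compound h D *m compound h E = 1%:M by rewrite -compoundM DE compound1.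
have CS p : Cq p.+1 = Cq p *m Cq 1%N by rewrite /Cq QS compoundM.
have C0 : Cq 0%N = 1%:M by rewrite /Cq Q0 compound1.
have fC p : map_poly f ('X^n * char_poly (compound h (frob_matrix p))) =
    'X^N * char_poly (Cq p).
  rewrite rmorphM /= map_polyXn map_char_poly map_compound QE !compoundM.
  by rewrite char_poly_mulmxC mulmxA CD mul1mx.
have Cfix p : map_poly sK (char_poly (Cq p)) = char_poly (Cq p).
  rewrite map_char_poly map_compound.
  have Thu : Th \in unitmx by rewrite unitmxE unitfE.
  have -> : map_mx sK (Q p) = Th *m Q p *m invmx Th by rewrite -sTh mulmxK.
  rewrite !compoundM.
  by apply: char_poly_conj; rewrite -compoundM mulVmx // compound1.
have descent p : exists P : {poly A}, map_poly g P = char_poly (Cq p) /\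
    'X^n * char_poly (compound h (frob_matrix p)) = 'X^N * map_poly (extl AL) P.
  pose H := 'X^n * char_poly (compound h (frob_matrix p)).
  have HE j : f (H`_(j + N)) = (char_poly (Cq p))`_j.
    by rewrite -coef_map fC coefXnM ltnNge leq_addl /= addnK.
  have /choice[a aE] j : exists a, H`_(j + N) = extl AL a.
    apply: (sigma_fixed card_L); apply: f_inj; rewrite -[f (sigma _ _)]sKE HE.
    by rewrite -[in RHS]Cfix coef_map.
  have PE : map_poly g (\poly_(j < n.+1) a j) = char_poly (Cq p).
    apply/polyP => j; rewrite coef_map coef_poly; case: ltnP => [jn|nj].
      by rewrite /= -aE HE.
    by rewrite /= (rmorph0 (extl AL)) (rmorph0 f) nth_default // size_char_poly.
  exists (\poly_(j < n.+1) a j); split=> //.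
  apply: (map_inj_poly f_inj (rmorph0 f)).
  by rewrite fC rmorphM /= map_polyXn -map_poly_comp PE.
have monicP (P : {poly A}) p : map_poly g P = char_poly (Cq p) -> P \is monic /\ size P = n.+1.
  move=> PE; rewrite -(size_map_inj_poly g_inj (rmorph0 g)) PE size_char_poly.
  split=> //; rewrite monicE -(inj_eq g_inj) -(lead_coef_map_inj g_inj (rmorph0 g)) PE rmorph1.
  by rewrite -monicE char_poly_monic.
have [P [gP PE]] := descent 1%N; have [G [gG _]] := descent l.
have [Pm _] := monicP P 1%N gP; have [Gm Gs] := monicP G l gG.
have [S SE] : exists S, G \Po 'X^l = S * P.
  apply: (monic_dvdp_descent g_inj Pm).
  by rewrite map_comp_poly gP gG map_polyXn; apply: char_poly_pow_dvd.
have ooE a : oo (coord_fun A a) = ooL (g a) by rewrite /= place_aboveP.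
have [v1 [v2 v3]] := scaled_lattice_char_poly (scaled_lattice_compound h latQ).
have Gj j : g G`_j = (char_poly (Cq l))`_j by rewrite -gG coef_map.
exists P, G, S; split=> //; split=> [j||].
- rewrite /vge coord_fun_eq0 ooE -(inj_eq g_inj) (rmorph0 g) Gj.
  by have := v1 j; rewrite /vge -PoszM.
- by apply: contraNneq v2 => G0; rewrite -Gj G0 (rmorph0 g).
by rewrite ooE Gj v3 -!PoszM.
Qed.

End GenericFibre.

Lemma free_dual_basis (R : comNzRingType) (M : lmodType R) r (t : 'I_r -> M) :
  (forall x, exists c : 'I_r -> R, x = \sum_i c i *: t i) ->
  (forall c : 'I_r -> R, \sum_i c i *: t i = 0 -> forall i, c i = 0) ->
  exists kap : 'I_r -> {linear M -> R^o},
    (forall x, x = \sum_i kap i x *: t i) /\ forall i j, kap i (t j) = (i == j)%:R.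
Proof.
move=> gen indep; have /choice[c cE] := gen.
have uniq x (a : 'I_r -> R) : x = \sum_i a i *: t i -> forall i, c x i = a i.
  move=> xE i; apply/eqP; rewrite -subr_eq0; apply/eqP.
  apply: (indep (fun i => c x i - a i)).
  under eq_bigr => j _ do rewrite scalerBl.
  by rewrite sumrB -cE -xE subrr.
have clin i : linear_for *%R (fun x => c x i : R^o).
  move=> a x y; apply: (uniq _ (fun i => a * c x i + c y i)).
  rewrite {1}[x]cE {1}[y]cE scaler_sumr -big_split; apply: eq_bigr => j _ /=.
  by rewrite scalerDl scalerA.
pose kap i : {linear M -> R^o} := HB.pack (fun x => c x i : R^o)
  (@GRing.isLinear.Build R M R^o *%R (fun x => c x i : R^o) (clin i)).
exists kap; split=> [x|i j]; first exact: cE.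
apply: (uniq _ (fun i => (i == j)%:R)).
rewrite (bigD1 j) //= eqxx scale1r big1 ?addr0 // => k /negbTE->.
by rewrite scale0r.
Qed.

Section FrobeniusCharPoly.
Context (F : finFieldType) (C : curve F) (oo : place (const C)).
Hypothesis oo_rational : rational_place oo.
Context (A : coordRing oo) (L : finFieldType) (fL : {rmorphism F -> L}).
Context (d : nat) (card_L : #|L| = (#|F| ^ d)%N).
Context (AL : scalarExt (coord_const A) fL) (ooL : placeAbove AL).
Context (c : {rmorphism A -> L}) (r dim : nat) (M : preMotive AL).
Hypothesis M_pure : is_pure_motive ooL c r dim M.
Context (k l : nat) (l_gt0 : (0 < l)%N) (pur : pure_at ooL M r k l).
Context (v : set A) (v_max : maximal_ideal v) (v_eps : v <> [set a | c a = 0]).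
Context (D : vadicRings AL v) (T : tateModule M D).
Context (pi_v : 'End(tate_V T)) (pi_vP : is_tate_frobenius d pi_v).

(** Over [A_{v,L^sep}] the matrix of [pi] in the dual basis also factors through its matrix [Q] on
    the fixed vectors, so that the polynomial [P] of the generic fibre is the one on the Tate
    module. *)
Lemma frobenius_char_poly h (W : exteriorPower h (tate_V T)) (wpi : 'End(W)) :
  is_exterior_map pi_v wpi ->
  let n := #|{: kset h r}| in
  exists P G S : {poly A},
  [/\ map_poly (@tofrac (Av D) : {rmorphism Av D -> {fraction Av D}}) (map_poly (toAv D) P) = lfun_char_poly wpi,
      G \Po 'X^l = S * P, G \is monic, size G = n.+1 &
      [/\ forall j, vge oo ((k * d * h)%N%:Z * (j%:Z - n%:Z)) (coord_fun A G`_j),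
          G`_0 != 0 & oo (coord_fun A G`_0) = - (k * d * h * n)%N%:Z]].
Proof.
move=> wpiP n.
have [M_free _ _ coker_ann _] := M_pure.
have [m [e [kap ekap]]] := locally_free_dual_basis M_free.
have [P [G [S [PE GS Gm Gs Gv]]]] :=
  generic_char_polys oo_rational card_L ekap l_gt0 pur h.
exists P, G, S; split=> //.
have [r' [t [tfix tgen tindep]]] :=
  tate_fixed_basis oo_rational v_max v_eps T ekap coker_ann.
have [kapB [kapBE kapBsum]] := base_change_dual_basis (tate_inP T) ekap.
have [E [D' [DE EDP]]] := module_matrix kapBsum tgen tindep.
pose f := ALAvLsep D.
have eps : map_mx f (frob_matrix d e kap 0) = E *m D'.
  rewrite -[E]mulmx1 -(EDP idfun 1%:M) => [|i].
    by apply/matrixP => a b; rewrite !mxE muln0 -kapBE.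
  by rewrite (bigD1 i) //= mxE eqxx scale1r big1 ?addr0 // => j; rewrite mxE eq_sym => /negbTE->; rewrite scale0r.
(* The characteristic polynomial of the idempotent [frob_matrix 0] yields [r] by way of the generic
   fibre and [r'] by way of the fixed vectors. *)
have rr : r = r'.
  apply: (@XsubC_Xn_rank (AvLsep D)).
  have E1 := congr1 (map_poly f) (idempotent_char_poly oo_rational card_L ekap l_gt0 pur).
  rewrite !rmorphM !rmorphXn rmorphB rmorph1 /= map_polyX map_char_poly eps in E1.
  have E2 := char_poly_mulmxC E D'; rewrite DE char_poly_1 in E2.
  apply: (monic_lreg (monicXn _ m)).
  by rewrite mulrCA -E2 mulrCA E1 mulrCA.
case: r' / rr t tfix tgen tindep E D' DE EDP eps => t tfix tgen tindep E D' DE EDP _.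
have /choice[tau tauE] i : exists s, tate_fix T s = t i by apply/tate_fixP/tfix.
(* The coefficients of a fixed vector in the basis of fixed vectors are invariant under [sigmav],
   hence come from [A_v]. *)
have taugen (x : tate_T T) : exists a : 'I_r -> Av D, x = \sum_i a i *: tau i.
  have [b bE] := tgen (tate_fix T x).
  have bfix i : sigmav D (b i) = b i.
    apply/eqP; rewrite -subr_eq0; apply/eqP.
    apply: (tindep (fun i => sigmav D (b i) - b i)).
    under eq_bigr => j _ do rewrite scalerBl.
    rewrite sumrB -bE.
    have -> : \sum_i sigmav D (b i) *: t i = tate_tau T (tate_fix T x).
      by rewrite bE linear_sum; apply: eq_bigr => j _; rewrite linearZ tfix.
    have -> : tate_tau T (tate_fix T x) = tate_fix T x by apply/tate_fixP; exists x.
    by rewrite subrr.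
  have /choice[a aE] i := sigmav_fixed oo_rational v_max v_eps (bfix i).
  exists a; apply: (@tate_fix_inj _ _ _ _ _ _ _ _ _ _ T); rewrite bE linear_sum.
  by apply: eq_bigr => j _; rewrite linearZ /= tauE -aE.
have tauindep (a : 'I_r -> Av D) : \sum_i a i *: tau i = 0 -> forall i, a i = 0.
  move=> a0 i; apply: (AvAvLsep_inj oo_rational v_max v_eps (D := D)); rewrite rmorph0.
  apply: (tindep (fun i => AvAvLsep D (a i))).
  have := congr1 (tate_fix T) a0; rewrite linear0 linear_sum => H; rewrite -[RHS]H.
  by apply: eq_bigr => j _; rewrite linearZ /= tauE.
have [kapT [kapTE kapTd]] := free_dual_basis taugen tauindep.
have [kapV [kapVE kapVsum]] := base_change_dual_basis (@tate_ratP _ _ _ _ _ _ _ _ _ _ T) kapTE.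
have [p [pE pfix]] := pi_vP.
have /choice[tau' tau'E] i := pfix (tau i).
pose Q : 'M[Av D]_r := \matrix_(i, j) (kapT j (tau' i) : Av D).
have piE i : pi_v (tate_rat T (tau i)) = \sum_j map_mx (@tofrac (Av D)) Q i j *: tate_rat T (tau j).
  rewrite (proj2 (tau'E i)) {1}[tau' i]kapTE linear_sum; apply: eq_bigr => j _.
  by rewrite linearZ !mxE.
have ptE i : p (t i) = \sum_j map_mx (AvAvLsep D) Q i j *: t j.
  rewrite -tauE -(proj1 (tau'E i)) {1}[tau' i]kapTE linear_sum; apply: eq_bigr => j _.
  by rewrite linearZ !mxE tauE.
have PiB : map_mx f (frob_matrix d e kap 1) = E *m map_mx (AvAvLsep D) Q *m D'.
  rewrite -(EDP p _ ptE); apply/matrixP => a b.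
  by rewrite !mxE muln1 pE -kapBE.
have charQ : map_poly (toAv D) P = char_poly (compound h Q).
  apply: (map_inj_poly (AvAvLsep_inj oo_rational v_max v_eps (D := D)) (rmorph0 (AvAvLsep D))).
  rewrite map_char_poly map_compound.
  have -> : map_poly (AvAvLsep D) (map_poly (toAv D) P) = map_poly f (map_poly (extl AL) P).
    rewrite -!map_poly_comp; apply: eq_map_poly => a /=.
    by rewrite /f ALAvLsep_l AvAvLsepP.
  apply: (monic_lreg (monicXn _ #|{: kset h m}|)).
  have := congr1 (map_poly f) PE.
  rewrite !rmorphM /= !map_polyXn map_char_poly map_compound PiB !compoundM => <-.
  by rewrite char_poly_mulmxC mulmxA -compoundM DE compound1 mul1mx.
rewrite charQ map_char_poly map_compound.
pose Drow (x : tate_V T) : 'rV[{fraction Av D}]_r := \row_i (kapV i x : {fraction Av D}).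
have Dlin : linear_for *:%R Drow.
  by move=> a x y; apply/rowP => i; rewrite !mxE linearP.
pose DV : {linear tate_V T -> 'rV[{fraction Av D}]_r} := HB.pack Drow
  (@GRing.isLinear.Build _ _ _ *:%R Drow Dlin).
symmetry; apply: (exterior_char_poly (D := DV) _ _ piE wpiP).
  move=> a; apply/rowP => i; rewrite !mxE kapVE kapTd eqxx /=.
  by rewrite eq_sym; case: eqP => _; rewrite ?rmorph1 ?rmorph0.
by move=> x; rewrite {1}[x]kapVsum; apply: eq_bigr => i _; rewrite mxE.
Qed.

End FrobeniusCharPoly.

(** * Absolute values of the Frobenius eigenvalues *)

Theorem theorem7p8 (R : realType)
  (F : finFieldType) (C : curve F)
  (oo : place (const C)) (oo_rational : rational_place oo)
  (A : coordRing oo)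
  (Qoo : absCompletion (@place_abs R F C oo))
  (Qoobar : absAlgClosure (@compl_abs _ _ _ Qoo))
  (L : finFieldType) (fL : {rmorphism F -> L})
  (e : nat) (card_L : #|L| = (#|F| ^ e)%N)
  (AL : scalarExt (coord_const A) fL) (ooL : placeAbove AL)
  (c : {rmorphism A -> L}) (c_const : forall x, c (coord_const A x) = fL x)
  (r d : nat) (M : preMotive AL) (M_pure : is_pure_motive ooL c r d M)
  (w : rat) (M_weight : is_weight ooL r M w)
  (v : set A) (v_max : maximal_ideal v) (v_eps : v <> [set a | c a = 0])
  (D : vadicRings AL v) (T : tateModule M D)
  (pi_v : 'End(tate_V T)) (pi_vP : is_tate_frobenius e pi_v)
  (iQv : {rmorphism C -> {fraction Av D}})
  (iQvP : forall a : A, iQv (coord_fun A a) = tofrac (toAv D a))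
  (i : nat) (i_le_r : (i <= r)%N)
  (W : exteriorPower i (tate_V T))
  (wpi : 'End(W)) (wpiP : is_exterior_map pi_v wpi) :
  exists p : {poly C},
    map_poly iQv p = lfun_char_poly wpi /\
    forall lambda : Qoobar,
      root (map_poly (acl_in Qoobar \o compl_in Qoo) p) lambda ->
      acl_abs lambda = #|L|%:R `^ (i%:R * ratr w).
Proof.
have [k [l [k_gt0 l_gt0 pur wE]]] := M_weight.
have [P [G [S [PE GS Gm Gs [Gj G00 G0]]]]] :=
  frobenius_char_poly oo_rational card_L M_pure l_gt0 pur v_max v_eps pi_vP wpiP.
set n := #|_| in Gs Gj G0; set q : R := #|F|%:R.
have q1 : 1 < q by rewrite ltr1n finNzRing_gt1.
have q0 : 0 < q := lt_trans ltr01 q1.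
exists (map_poly (coord_fun A) P); split.
  by rewrite -PE -!map_poly_comp; apply: eq_map_poly => a; apply: iQvP.
move=> lambda; rewrite -map_poly_comp => root_lambda.
pose g : {rmorphism A -> Qoobar} := acl_in Qoobar \o compl_in Qoo \o coord_fun A.
have gE a : acl_abs (g a) = place_abs R oo (coord_fun A a) by rewrite /= acl_absE compl_absE.
have g_inj : injective g.
  by move=> x y /= /(fmorph_inj (acl_in Qoobar))/(fmorph_inj (compl_in Qoo))/coord_fun_inj.
(* [P] divides [G(X^l)], and only the Newton polygon of [G] is known to be a segment. *)
have rootG : root (map_poly g G) (lambda ^+ l).
  have : root (map_poly g (S * P)) lambda by rewrite rmorphM rootM /= root_lambda orbT.
  by rewrite -GS map_comp_poly map_polyXn /root horner_comp hornerXn.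
have absl : acl_abs (lambda ^+ l) = q ^+ (k * e * i).
  apply: (abs_root (acl_abs_nonarch Qoobar) _ _ _ _ _ rootG (n := n)).
  - exact: exprn_gt0.
  - exact: monic_map.
  - by rewrite (size_map_inj_poly g_inj (rmorph0 g)).
  - move=> j jn; rewrite coef_map gE /place_abs; case: eqP => [_|/eqP Gj0].
      by rewrite exprn_ge0 // exprn_ge0 // ltW.
    have := Gj j; rewrite /vge (negbTE Gj0) /= => le.
    rewrite -exprM exprnP; apply: ler_weXz2l; first exact: ltW.
    by rewrite PoszM -subzn // lerNl -mulrN opprB.
  rewrite coef_map gE /place_abs coord_fun_eq0 (negbTE G00) G0 opprK.
  by rewrite -exprnP -exprM.
have [abs_ge0 _ _ _] := acl_abs_nonarch Qoobar.
(* Both sides are nonnegative, so that it suffices to compare [l]-th powers; this is where the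
   denominator of the weight [k / l] cancels. *)
apply: (@pexpIrn _ l); rewrite ?nnegrE ?powR_ge0 //.
rewrite -(absX (acl_abs_nonarch Qoobar)) absl card_L natrX -/q.
rewrite -[RHS]powR_mulrn ?powR_ge0 // -[q ^+ e]powR_mulrn ?(ltW q0) //.
rewrite -!powRrM -powR_mulrn ?(ltW q0) //; congr (_ `^ _).
rewrite wE fmorph_div /= !ratr_nat !natrM; field.
by rewrite pnatr_eq0 -lt0n.
Qed.
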